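(* Let $n\ge 1$ be an integer and let $\{\mathbf{X}_{e}\}_{e\in\binom{\mathbb{N}}{n}}$ be an exchangeable array of random variables (defined on a common probability space) valued in a measurable space $(T,\mathcal{U})$. Suppose that the common distribution of the individual random variables $\mathbf{X}_e$, a probability measure on $(T,\mathcal{U})$, is compact, witnessed by a collection $\mathcal{K}\subseteq\mathcal{U}$. Then there are probability spaces $(\Delta_k,\mathcal{D}_k,\mu_k)$ for $0\le k\le n$ and a measurable function $\rho:\prod_{\sigma\subseteq[n]}\Delta_{|\sigma|}\to T$ such that the following holds. Let $\{\xi_\sigma\}_{\sigma\in\binom{\mathbb{N}}{\le n}}$ be independent random elements, where $\xi_\sigma$ is chosen from $\Delta_{|\sigma|}$ according to $\mu_{|\sigma|}$. For every $\{i_1,\ldots,i_n\}\in\binom{\mathbb{N}}{n}$ put $$\mathbf{Y}_{\{i_1,\ldots,i_n\}}=\rho\bigl(\{\xi_\sigma\}_{\sigma\subseteq\{i_1,\ldots,i_n\}}\bigr).$$ Then $\{\mathbf{Y}_e\}_{e\in\binom{\mathbb{N}}{n}}$ is an exchangeable array with the same distribution as $\{\mathbf{X}_e\}_{e\in\binom{\mathbb{N}}{n}}$.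
   Context: Notation: $[n]=\{1,\ldots,n\}$. For a set $S$, $\binom{S}{n}$ is the set of subsets of $S$ of size exactly $n$, and $\binom{S}{\le n}$ is the set of subsets of $S$ of size at most $n$ (including $\emptyset$). Event hypergraphs: An event hypergraph (in $\mathcal{U}$) consists of a finite set $S$ and, for each $e\in\binom{S}{n}$, a set $B_e\in\mathcal{U}$. Given an event hypergraph $(S,\{B_e\})$, an injective function $f:S\to\mathbb{N}$, and an array $\mathbf{X}=\{\mathbf{X}_e\}_{e\in\binom{\mathbb{N}}{n}}$ of $T$-valued random variables, $B_{S,\{B_e\},f,\mathbf{X}}$ denotes the event that $\mathbf{X}_{f(e)}\in B_e$ for every $e\in\binom{S}{n}$ (where $f(e)$ is the image of $e$). Exchangeability: The array $\mathbf{X}$ is exchangeable if, for every event hypergraph $(S,\{B_e\})$, the probability $\mathbb{P}(B_{S,\{B_e\},f,\mathbf{X}})$ is the same for all injective $f:S\to\mathbb{N}$; this value is then written $\mathbb{P}(B_{S,\{B_e\},\mathbf{X}})$. The common distribution of an exchangeable array $\mathbf{X}$ is the distribution of $\mathbf{X}_{\{1,\ldots,n\}}$ on $(T,\mathcal{U})$ (the same for every $\mathbf{X}_e$). Same distribution: Two exchangeable arrays $\mathbf{X},\mathbf{Y}$ with values in $(T,\mathcal{U})$ have the same distribution if $\mathbb{P}(B_{S,\{B_e\},\mathbf{X}})=\mathbb{P}(B_{S,\{B_e\},\mathbf{Y}})$ for every event hypergraph $(S,\{B_e\})$ in $\mathcal{U}$. Compactness: A probability space $(X,\mathcal{B},\mu)$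 (or the measure $\mu$) is compact if there exists a collection $\mathcal{K}\subseteq\mathcal{B}$, said to witness compactness, such that: (i) whenever $\mathcal{A}\subseteq\mathcal{K}$ has the finite intersection property (every finite subset of $\mathcal{A}$ has non-empty intersection), $\bigcap\mathcal{A}\neq\emptyset$; and (ii) $\mu$ is $\mathcal{K}$-inner regular: for every $B\in\mathcal{B}$, $\mu(B)=\sup\{\mu(K): K\in\mathcal{K},\ K\subseteq B\}$. No topology on $X$ is assumed. Conventions: $\prod_{\sigma\subseteq[n]}\Delta_{|\sigma|}$ carries the product probability measure $\prod_{\sigma\subseteq[n]}\mu_{|\sigma|}$, and measurability of $\rho$ is with respect to the completion of this product measure, i.e. $\rho^{-1}(B)$ belongs to the completed product $\sigma$-algebra for every $B\in\mathcal{U}$. In the definition of $\mathbf{Y}_{\{i_1,\ldots,i_n\}}$, list the indices as $i_1<\cdots<i_n$; the family $\{\xi_\sigma\}_{\sigma\subseteq\{i_1,\ldots,i_n\}}$ is regarded as a point of $\prod_{\sigma\subseteq[n]}\Delta_{|\sigma|}$ whose coordinate at $\tau\subseteq[n]$ is $\xi_{\{i_j : j\in\tau\}}$. *)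

(* Defs.v *)
From HB Require Import structures.
From mathcomp Require Import all_boot all_order all_algebra finmap.
From mathcomp Require Import all_classical all_reals all_analysis.
From mathcomp Require Import measurable_realfun.

Set Implicit Arguments.
Unset Strict Implicit.
Unset Printing Implicit Defensive.

Import Order.TTheory GRing.Theory Num.Theory.

Local Open Scope classical_set_scope.
Local Open Scope ring_scope.

Definition pi_display (I : Type) : (I -> measure_display) -> measure_display.
Proof. exact. Qed.

Section pi_space.
Context (I : finType) (d : I -> measure_display)
  (E : forall i, measurableType (d i)).

Definition pi_space : Type := forall i, E i.

Definition cylinders : set (set pi_space) :=
  [set C | exists i, exists2 A : set (E i),
     measurable A & C = [set x | A (x i)]].

HB.instance Definition _ := Pointed.on pi_space.
HB.instance Definition _ := @isMeasurable.Build (pi_display d) pi_space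
  <<s cylinders >> (@sigma_algebra0 _ setT cylinders)
  (@sigma_algebraC _ cylinders) (@sigma_algebra_bigcup _ setT cylinders).

Lemma measurable_pi_proj i : measurable_fun [set: pi_space] (fun x => x i).
Proof.
move=> _ A mA; rewrite setTI; apply: sub_sigma_algebra.
by exists i; exists A.
Qed.

Lemma measurable_pi_fun d' (T : measurableType d') (f : T -> pi_space) :
  (forall i, measurable_fun [set: T] (fun x => f x i)) ->
  measurable_fun [set: T] f.
Proof.
move=> mf; apply: (measurability cylinders) => //.
by move=> _ [_ [i [A mA ->]] <-]; exact: mf.
Qed.

Definition rectangle (A : forall i, set (E i)) : set pi_space :=
  [set x | forall i, A i (x i)].

Lemma measurable_rectangle A :
  (forall i, measurable (A i)) -> measurable (rectangle A).
Proof.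
move=> mA.
have -> : rectangle A = \big[setI/setT]_(i <- enum I) [set x | A i (x i)].
  apply/seteqP; split=> x /=.
    by move=> Ax; rewrite -bigcap_seq => i /= _; exact: Ax.
  by rewrite -bigcap_seq => Ax i; apply: Ax; rewrite /= mem_enum.
apply: bigsetI_measurable => i _.
by rewrite -[X in measurable X]setTI; exact: measurable_pi_proj.
Qed.

Definition pi_update i (p : pi_space * E i) : pi_space := dfwith p.1 i p.2.

Lemma measurable_pi_update i : measurable_fun setT (@pi_update i).
Proof.
apply: measurable_pi_fun => j; rewrite /pi_update.
have [->|ij] := eqVneq j i.
  apply: (eq_measurable_fun snd) => [x _|]; last exact: measurable_snd.
  by rewrite dfwithin.
apply: (eq_measurable_fun (fun x : pi_space * E i => x.1 j)) => [x _|].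
  by rewrite dfwithout// eq_sym.
exact: (measurableT_comp (@measurable_pi_proj j) measurable_fst).
Qed.

HB.instance Definition _ i := isMeasurableFun.Build _ _ _ _ (@pi_update i)
  (@measurable_pi_update i).

Context (R : realType) (mu : forall i, probability (E i) R).

(* The product measure is obtained by resampling the coordinates of an
   arbitrary point one after the other, each time independently of the
   coordinates already drawn; [pi_probE] is its characteristic property. *)
Fixpoint pi_prob_seq (s : seq I) : probability pi_space R :=
  if s is i :: s' then
    distribution (pi_prob_seq s' \x mu i)%E (@pi_update i)
  else dirac (point : pi_space).

Definition pi_prob : probability pi_space R := pi_prob_seq (enum I).

Let pi_prob_seqE (s : seq I) (A : forall i, set (E i)) : uniq s ->
  (forall i, measurable (A i)) -> (forall i, i \notin s -> A i = setT) ->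
  pi_prob_seq s (rectangle A) = (\prod_(i <- s) mu i (A i))%E.
Proof.
elim: s A => [|i s IH] A /=.
  move=> _ _ AT; rewrite big_nil diracE mem_set// => i.
  by rewrite AT.
move=> /andP[iNs us] mA AT.
pose A' := @dfwith _ (fun j => set (E j)) A i setT.
have A'i : A' i = setT by rewrite /A' dfwithin.
have A'j j : j != i -> A' j = A j by move=> ji; rewrite /A' dfwithout// eq_sym.
rewrite /distribution /pushforward.
have -> : @pi_update i @^-1` rectangle A = rectangle A' `*` A i.
  apply/seteqP; split=> -[x y] /=.
    move=> Ax; split; last by have := Ax i; rewrite /pi_update dfwithin.
    move=> j; have [->|ji] := eqVneq j i; first by rewrite A'i.
    by rewrite A'j//; have := Ax j; rewrite /pi_update dfwithout// eq_sym.
  move=> [Ax Ay] j; rewrite /pi_update.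
  have [->|ji] := eqVneq j i; first by rewrite dfwithin.
  by rewrite dfwithout 1?eq_sym//=; have := Ax j; rewrite A'j.
have mA' j : measurable (A' j).
  by have [->|ji] := eqVneq j i; [rewrite A'i|rewrite A'j].
rewrite product_measure1E//; last exact: measurable_rectangle.
have A'T j : j \notin s -> A' j = setT.
  by move=> js; have [->//|ji] := eqVneq j i; rewrite A'j// AT// in_cons negb_or ji.
rewrite big_cons muleC; congr (_ * _)%E; rewrite [LHS](IH A')//.
apply: eq_big_seq => j js; rewrite A'j//.
by apply: contraNneq iNs => <-.
Qed.

Lemma pi_probE (A : forall i, set (E i)) : (forall i, measurable (A i)) ->
  pi_prob (rectangle A) = (\prod_i mu i (A i))%E.
Proof.
move=> mA; rewrite /pi_prob pi_prob_seqE ?enum_uniq// ?big_enum//.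
by move=> i; rewrite mem_enum.
Qed.

End pi_space.

Section completion.
Context d (T : measurableType d) (R : realType) (P : probability T R).

Definition completion := g_sigma_algebraType (completed_algebra_gen P).

(* On the completed sigma-algebra the outer measure of [P] is the completion
   of [P]: it sends [A `|` N] to [P A] when [N] is negligible. *)
Definition completed_prob (A : set completion) : \bar R := (P^*)%mu A.

Lemma completed_probE (A : set T) : measurable A -> completed_prob A = P A.
Proof. exact: measurable_mu_extE. Qed.

Let completion_cara (A : set completion) :
  measurable A -> ((P^*)%mu).-caratheodory A.
Proof.
have sub B : measurable B -> ((P^*)%mu).-caratheodory B.
  by move=> mB; apply: (@sub_caratheodory _ _ _ P); exact: sub_sigma_algebra.
move: A; apply: smallest_sub.
  split => //.
  - exact: caratheodory_measurable_set0.
  - by move=> A mA; rewrite setTD; exact: caratheodory_measurable_setC.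
  - exact: caratheodory_measurable_bigcup.
move=> _ [A mA] [N negN] <-.
apply: caratheodory_measurable_setU; first exact: sub.
case: negN => B [mB B0 NB].
apply: (@measure_is_complete_caratheodory _ _ (P^*)%mu).
exists B; split => //; first exact: sub.
by rewrite -B0; exact: measurable_mu_extE.
Qed.

Let completed_prob0 : completed_prob set0 = 0%E.
Proof. exact: mu_ext0. Qed.

Let completed_prob_ge0 A : (0 <= completed_prob A)%E.
Proof. exact: mu_ext_ge0. Qed.

Let completed_prob_sigma_additive : semi_sigma_additive completed_prob.
Proof.
move=> F mF tF mUF.
apply: (@caratheodory_measure_sigma_additive _ _ (P^*)%mu) => //.
  by move=> i; exact: completion_cara.
exact: completion_cara.
Qed.

HB.instance Definition _ := isMeasure.Build _ _ _ completed_prob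
  completed_prob0 completed_prob_ge0 completed_prob_sigma_additive.

Let completed_prob_setT : completed_prob setT = 1%E.
Proof. by rewrite completed_probE// probability_setT. Qed.

HB.instance Definition _ :=
  Measure_isProbability.Build _ _ _ completed_prob completed_prob_setT.

End completion.

Arguments completed_prob {d T R} P A.

(* The supremum is taken in [[0, +oo]], i.e. the supremum of the empty set
   is 0, so that [set0] need not belong to [K]. *)
Definition compact_witness d (T : measurableType d) (R : realType)
    (mu : set T -> \bar R) (K : set (set T)) : Prop :=
  [/\ K `<=` measurable,
      forall A : set (set T), A `<=` K -> finI A id ->
        \bigcap_(B in A) B !=set0
    & forall B, measurable B ->
        mu B = ereal_sup (0%E |` [set mu C | C in [set C | K C /\ C `<=` B]])].

Definition independent d (Omega : measurableType d) (R : realType)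
    (P : probability Omega R) (I : choiceType) (d' : I -> measure_display)
    (E : forall i, measurableType (d' i)) (X : forall i, {RV P >-> E i}) :=
  forall (J : {fset I}) (A : forall i, set (E i)),
    (forall i, i \in J -> measurable (A i)) ->
    P (\bigcap_(i in [set` J]) (X i @^-1` A i)) =
    (\prod_(i <- J) P (X i @^-1` A i))%E.

Definition nsubset (n : nat) := {e : {fset nat} | #|` e| == n}.

(* The subsets of [nat] of size at most [n], as the disjoint union over
   [k <= n] of the [k]-subsets: the type of the coordinate at such a subset
   then depends on [k] alone and no cast between sizes is needed. *)
Definition lesubset (n : nat) := {k : 'I_n.+1 & nsubset k}.

Lemma card_imfset_set (S : finType) (f : S -> nat) (n : nat) (e : {set S}) :
  injective f -> #|e| == n -> #|` [fset f x | x in e]%fset| == n.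
Proof. by move=> fi /eqP <-; rewrite card_imfset//= -cardE. Qed.

Definition image_nsubset (S : finType) (f : S -> nat) (fi : injective f)
    (n : nat) (e : {e : {set S} | #|e| == n}) : nsubset n :=
  exist _ [fset f x | x in sval e]%fset (card_imfset_set fi (svalP e)).

Lemma card_first_nsubset n : #|` [fset i in iota 1 n]%fset| == n.
Proof. by rewrite card_fseq undup_id ?iota_uniq// size_iota. Qed.

Definition first_nsubset n : nsubset n :=
  exist _ [fset i in iota 1 n]%fset (card_first_nsubset n).

Definition random_array (n : nat) d (Omega : measurableType d) (R : realType)
    (P : probability Omega R) d' (T : measurableType d') :=
  nsubset n -> {RV P >-> T}.

Definition increasing_enum n (e : nsubset n) (j : 'I_n) : nat :=
  nth 0%N (sort leq (sval e)) j.

Lemma increasing_enum_inj n (e : nsubset n) : injective (increasing_enum e).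
Proof.
move=> i j; have sz : size (sort leq (sval e)) = n.
  by rewrite size_sort; exact/eqP/(svalP e).
move=> /eqP; rewrite /increasing_enum nth_uniq ?sz ?sort_uniq ?fset_uniq//.
by move=> /eqP /val_inj.
Qed.

Record event_hypergraph (n : nat) d (T : measurableType d) := EventHypergraph {
  eh_vertex : finType;
  eh_event : {e : {set eh_vertex} | #|e| == n} -> set T;
  eh_measurable : forall e, measurable (eh_event e) }.

Arguments eh_event {n d T} _ _.

Definition hypergraph_event (n : nat) d' (T : measurableType d')
    (H : event_hypergraph n T) (f : eh_vertex H -> nat) (fi : injective f)
    d (Omega : measurableType d) (R : realType) (P : probability Omega R)
    (X : random_array n P T) : set Omega :=
  [set w | forall e, eh_event H e (X (image_nsubset fi e) w)].

Definition exchangeable (n : nat) d (Omega : measurableType d) (R : realType)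
    (P : probability Omega R) d' (T : measurableType d')
    (X : random_array n P T) : Prop :=
  forall (H : event_hypergraph n T) (f g : eh_vertex H -> nat)
    (fi : injective f) (gi : injective g),
    P (hypergraph_event fi X) = P (hypergraph_event gi X).

(* For exchangeable arrays, the common value of [P (hypergraph_event fi X)]
   over all injections agrees with that of [Q (hypergraph_event gi Y)]. *)
Definition same_distribution (n : nat) (R : realType) d' (T : measurableType d')
    d1 (Omega1 : measurableType d1) (P : probability Omega1 R)
    d2 (Omega2 : measurableType d2) (Q : probability Omega2 R)
    (X : random_array n P T) (Y : random_array n Q T) : Prop :=
  forall (H : event_hypergraph n T) (f g : eh_vertex H -> nat)
    (fi : injective f) (gi : injective g),
    P (hypergraph_event fi X) = Q (hypergraph_event gi Y).

Lemma subset_size_lt n (tau : {set 'I_n}) : (#|tau| < n.+1)%N.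
Proof. by rewrite ltnS -[X in (_ <= X)%N]card_ord max_card. Qed.

Definition subset_size n (tau : {set 'I_n}) : 'I_n.+1 :=
  Ordinal (subset_size_lt tau).

Definition subsets_space n (d : 'I_n.+1 -> measure_display)
    (D : forall k, measurableType (d k)) : measurableType _ :=
  pi_space (fun tau : {set 'I_n} => D (subset_size tau)).

Definition subsets_prob n (d : 'I_n.+1 -> measure_display)
    (D : forall k, measurableType (d k)) (R : realType)
    (mu : forall k, probability (D k) R) : probability (subsets_space D) R :=
  pi_prob (fun tau : {set 'I_n} => mu (subset_size tau)).

(* With [e] = {i_0 < ... < i_(n-1)}, this is {i_j : j in tau}. *)
Definition subset_at n (e : nsubset n) (tau : {set 'I_n}) : lesubset n :=
  @Tagged _ (subset_size tau) (fun k : 'I_n.+1 => nsubset k)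
    (image_nsubset (@increasing_enum_inj n e)
       (exist (fun s : {set 'I_n} => #|s| == subset_size tau) tau
          (eqxx #|tau|))).

Definition subsets_point n (d : 'I_n.+1 -> measure_display)
    (D : forall k, measurableType (d k))
    (xi : forall s : lesubset n, D (tag s)) (e : nsubset n) :
    subsets_space D :=
  fun tau => xi (subset_at e tau).

(* Main.v *)
(** By exchangeability, [X] may be indexed by the visible (even) vertices of a
    larger copy of itself that also has an infinite reservoir of hidden (odd)
    vertices. To a finite set [s] of visible vertices attach the events
    [X_(s u a) in B], [a] a set of hidden vertices. Exchanging the visible
    vertices outside [s] with fresh hidden ones shows that, given the data
    attached to the proper subsets of [s], the data attached to [s] are
    independent of all the data attached to sets that do not contain [s].
    The whole family of events can therefore be sampled one at a time along a
    well-order: each event is decided, with its conditional probability given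
    the earlier ones, by fresh coins indexed by [s].  This represents every
    indicator [1_B(X_e)] as a measurable function of the coins at the subsets
    of [e], but these functions respect the Boolean operations on the sets [B]
    only up to null sets, which depend on [B].  A lower density for the
    (non-separable) coin-tossing measure corrects this: at every point, the
    compact sets whose event has density 1 have the finite intersection
    property, and [rho] selects a point of their intersection. *)

Require Import Defs.
From HB Require Import structures.
From mathcomp Require Import all_boot all_order all_algebra finmap.
From mathcomp Require Import all_classical all_reals all_analysis.
From mathcomp Require Import measurable_realfun.
From mathcomp Require Import ring lra zify wochoice.

Set Implicit Arguments.
Unset Strict Implicit.
Unset Printing Implicit Defensive.

Import Order.TTheory GRing.Theory Num.Theory.

Local Open Scope classical_set_scope.
Local Open Scope ring_scope.

(** * Spaces of bit sequences *)

(** The sigma-algebra on [T] need not be countably generated and [T] carries no topology, so a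
    regular conditional distribution of a value [X_e] may not exist. The conditional probability of
    a single event always does, and a sequence of fair coins realizes it; this is why bits and not
    values are sampled. The price is one coordinate for each vertex set and each event, uncountably
    many in general, hence a transfinite recursion and coin spaces over arbitrary index sets.

    Without hidden vertices no event would be attached to a set of fewer than [n] vertices, and what
    overlapping edges share would be recorded nowhere; with them, the proper subsets of [s] carry
    all the information that [s] shares with the rest.

    One [rho] has to serve every edge although the sampling rules are obtained by choice. They are
    therefore chosen on [{0,...,k-1}] only and transported along increasing enumerations. Every
    space [Delta_k] is the same coin space, with a separate sequence of coins for each mark, that
    is, for each pair of a hidden set and an event. *)

Definition bits_display (J : Type) : measure_display.
Proof. by move: J => _; exact: default_measure_display. Qed.

Definition bits (J : Type) : Type := J -> bool.

HB.instance Definition _ (J : Type) := Pointed.on (bits J).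

Definition dep_on J (S : set J) (A : set (bits J)) :=
  forall x y : bits J, (forall c, S c -> x c = y c) -> A x -> A y.

(** Only the value [true] is prescribed. These sets are closed under intersection and still
    generate, so a law on [bits J] is determined by the probabilities that finitely many events
    occur together, which are what exchangeability controls. *)
Definition cyl (J : choiceType) (F : {fset J}) : set (bits J) :=
  [set x | forall c, c \in F -> x c].

Definition coord_sets (J : choiceType) : set (set (bits J)) :=
  range (@cyl J).

HB.instance Definition _ (J : choiceType) :=
  @isMeasurable.Build (bits_display J) (bits J)
  <<s @coord_sets J >> (@sigma_algebra0 _ setT _)
  (@sigma_algebraC _ _) (@sigma_algebra_bigcup _ setT _).

Section bits.
Context (J : choiceType).
Implicit Types (S : set J) (A B : set (bits J)) (x y : bits J) (F G : {fset J}) (c : J).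

Lemma measurable_cyl F : measurable (cyl F).
Proof. by apply: sub_sigma_algebra; exists F. Qed.

Lemma cyl0 : cyl (fset0 : {fset J}) = setT.
Proof. by apply/seteqP; split. Qed.

Lemma cyl1 c : cyl [fset c]%fset = [set x | x c].
Proof.
apply/seteqP; split=> x /=; first by apply; rewrite in_fset1.
by move=> xc c'; rewrite in_fset1 => /eqP ->.
Qed.

Lemma cylU F G : cyl (F `|` G)%fset = cyl F `&` cyl G.
Proof.
apply/seteqP; split=> x /=.
  by move=> h; split=> c cF; apply: h; rewrite in_fsetU cF ?orbT.
by move=> [hF hG] c; rewrite in_fsetU => /orP[/hF|/hG].
Qed.

Lemma measurable_coord c : measurable [set x : bits J | x c].
Proof. by rewrite -cyl1; exact: measurable_cyl. Qed.

Lemma measurable_coordb c b : measurable [set x : bits J | x c = b].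
Proof.
case: b; first exact: measurable_coord.
have -> : [set x : bits J | x c = false] = ~` [set x | x c].
  by apply/seteqP; split=> x /=; [move=> -> | move/negP/negbTE].
by apply: measurableC; exact: measurable_coord.
Qed.

Lemma measurable_bits d (T : measurableType d) (f : T -> bits J) :
  (forall c, measurable [set t | f t c]) -> measurable_fun setT f.
Proof.
move=> mf; apply: (measurability (@coord_sets J)) => //.
move=> _ [_ [F _ <-] <-]; rewrite setTI.
have -> : f @^-1` cyl F = \bigcap_(c in [set` F]) [set t | f t c].
  by apply/seteqP; split=> t h c cF; exact: h.
by apply: fin_bigcap_measurable => // c _; exact: mf.
Qed.

Lemma bits_measure_unique (R : realType) (m1 m2 : {measure set (bits J) -> \bar R}) :
  (m1 setT < +oo)%E -> (forall F, m1 (cyl F) = m2 (cyl F)) ->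
  forall A, measurable A -> m1 A = m2 A.
Proof.
move=> m1oo m12; apply: (@measure_unique _ R (bits J) (@coord_sets J) (fun=> setT)) => //.
- by move=> _ _ [F _ <-] [G _ <-]; exists (F `|` G)%fset => //; rewrite cylU.
- by move=> _; exists fset0 => //; rewrite cyl0.
- by rewrite bigcup_const.
- by move=> _ [F _ <-]; exact: m12.
Qed.

Lemma dep_onS S S' A : S `<=` S' -> dep_on S A -> dep_on S' A.
Proof. by move=> SS' dA x y xy; apply: dA => c /SS'; exact: xy. Qed.

Lemma dep_onE S A x y : dep_on S A -> (forall c, S c -> x c = y c) -> A x = A y.
Proof.
move=> dA xy; apply/propext; split; first exact: dA.
by apply: dA => c Sc; rewrite xy.
Qed.

Lemma dep_onI S A B : dep_on S A -> dep_on S B -> dep_on S (A `&` B).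
Proof. by move=> dA dB x y xy [Ax Bx]; split; [exact: dA Ax|exact: dB Bx]. Qed.

Lemma dep_onU S A B : dep_on S A -> dep_on S B -> dep_on S (A `|` B).
Proof. by move=> dA dB x y xy [Ax|Bx]; [left; exact: dA Ax|right; exact: dB Bx]. Qed.

Lemma dep_onC S A : dep_on S A -> dep_on S (~` A).
Proof. by move=> dA x y xy nAx Ay; apply: nAx; apply: dA Ay => c Sc; rewrite xy. Qed.

Lemma dep_on_cyl F : dep_on [set` F] (cyl F).
Proof. by move=> x y xy h c cF; rewrite -xy//; exact: h. Qed.

Lemma dep_on_bigcup S (I : Type) (D : set I) (f : I -> set (bits J)) :
  (forall i, D i -> dep_on S (f i)) -> dep_on S (\bigcup_(i in D) f i).
Proof. by move=> df x y xy [i Di fx]; exists i => //; exact: df fx. Qed.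

Definition finitely_determined A := exists s : seq J, dep_on [set` s] A.

(** The sets with a countable support form a sigma-algebra containing the cylinders. This controls
    the initial segments that have no countable cofinal sequence. *)
Lemma countable_support A : measurable A ->
  exists2 S : set J, countable S & dep_on S A.
Proof.
move: A; apply: smallest_sub.
  split.
  - by exists set0 => // x y _ [].
  - move=> A [S cS dA]; exists S => //.
    by rewrite setTD; exact: dep_onC.
  - move=> f /= /(_ _)/cid2-/all_sig2 [S cS dA].
    exists (\bigcup_i S i); first exact: bigcup_countable.
    apply: dep_on_bigcup => i _; apply: dep_onS (dA i).
    exact: bigcup_sup.
move=> _ [F _ <-]; exists [set` F]; first exact/finite_set_countable/finite_fset.
exact: dep_on_cyl.
Qed.

End bits.

(** * The coin-tossing measure *)

Section finitely_determined.
Context (J : choiceType).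
Implicit Types (A B : set (bits J)) (x y : bits J) (c : J).

Lemma finitely_determined0 : finitely_determined (set0 : set (bits J)).
Proof. by exists [::]. Qed.

Lemma finitely_determinedU : setU_closed (@finitely_determined J).
Proof.
move=> A B [s dA] [t dB]; exists (s ++ t); apply: dep_onU.
  by apply: dep_onS dA => c /= cs; rewrite mem_cat cs.
by apply: dep_onS dB => c /= cs; rewrite mem_cat cs orbT.
Qed.

Lemma finitely_determinedC : setC_closed (@finitely_determined J).
Proof. by move=> A [s dA]; exists s; exact: dep_onC. Qed.

(* Compactness of the Cantor cube: an ultrafilter containing all the [F k]
   converges coordinatewise. *)
Lemma finitely_determined_compact (F : (set (bits J))^nat) :
  (forall k, finitely_determined (F k)) -> nonincreasing_seq F ->
  (forall k, F k !=set0) -> \bigcap_k F k !=set0.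
Proof.
move=> fF ndF F0.
have pF : ProperFilter (filter_from [set: nat] F).
  apply: filter_from_proper => //.
  apply: filter_from_filter; first by exists 0%N.
  move=> i j _ _; exists (maxn i j) => // x Fx; split.
    by have /subsetPset := ndF _ _ (leq_maxl i j); apply.
  by have /subsetPset := ndF _ _ (leq_maxr i j); apply.
have [G [uG FG]] := ultraFilterLemma pF.
exists (fun c => `[< G [set y : bits J | y c] >]) => k _.
have [s ds] := fF k.
have GF : G (F k) by apply: FG; exists k.
have Gs : G [set y : bits J | forall c, c \in s -> `[< G [set y : bits J | y c] >] = y c].
  elim: s {ds} => [|c s IH]; first by apply: filterS filterT.
  have Gc : G [set y : bits J | `[< G [set y : bits J | y c] >] = y c].
    case: asboolP => h; first by apply: filterS h => y /= ->.
    have [//|/filterS] := in_ultra_setVsetC [set y : bits J | y c] uG.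
    by apply => y /= /negP/negbTE ->.
  apply: filterS (filterI Gc IH) => y /= [yc ys] c'.
  by rewrite in_cons => /orP[/eqP ->|/ys].
have [y [Fy ys]] := filter_ex (filterI GF Gs).
by apply: ds Fy => c cs; rewrite ys.
Qed.

Definition algebra_bits : Type := bits J.
HB.instance Definition _ := Pointed.on algebra_bits.
HB.instance Definition _ := @isAlgebraOfSets.Build (bits_display J)
  algebra_bits (@finitely_determined J) finitely_determined0
  finitely_determinedU finitely_determinedC.

Definition upd x c b : bits J := fun j => if j == c then b else x j.

Section coin_content.
Context (R : realType).
Implicit Types (f g : bits J -> R) (s t : seq J).

(** Integration over the coin [c] alone; iterated along a list it integrates a function of finitely
    many coins before any measure on [bits J] exists. *)
Definition resample c f x : R := (f (upd x c true) + f (upd x c false)) / 2.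

Definition average s f := foldr resample f s.

Lemma resampleC c d f : resample c (resample d f) = resample d (resample c f).
Proof.
apply/funext => x; rewrite /resample.
have [->//|cd] := eqVneq c d.
have updC b b' : upd (upd x c b) d b' = upd (upd x d b') c b.
  by apply/funext => j; rewrite /upd; case: eqVneq => // ->; case: eqVneq => // dc;
     rewrite dc eqxx in cd.
by rewrite !updC; lra.
Qed.

Lemma averageC s t f : average s (average t f) = average t (average s f).
Proof.
elim: s => // c s /= ->.
elim: t => // d t /= IH; by rewrite resampleC IH.
Qed.

Lemma average_cst s (a : R) : average s (cst a) = cst a.
Proof.
elim: s => // c s IH; rewrite /= [X in resample c X]IH.
by apply/funext => x; rewrite /resample /cst/=; lra.
Qed.

Lemma averageD s f g : average s (f \+ g) = average s f \+ average s g.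
Proof.
elim: s => // c s /= ->; apply/funext => x; rewrite /resample/=; lra.
Qed.

Lemma average_ge0 s f x : (forall x, 0 <= f x) -> 0 <= average s f x.
Proof.
move=> f0; elim: s x => [//|c s IH] x /=; rewrite /resample.
by have := IH (upd x c true); have := IH (upd x c false); lra.
Qed.

Lemma average_const s f : (forall x y, {in s, x =1 y} -> f x = f y) ->
  average s f = cst (average s f point).
Proof.
move=> fs.
have H (t : seq J) (x y : bits J) :
    (forall j, j \in s -> j \notin t -> x j = y j) -> average t f x = average t f y.
  elim: t x y => [|c t IH] x y xy /=.
    by apply: fs => j js; exact: xy.
  rewrite /resample; congr ((_ + _) / _); apply: IH => j js jt;
    rewrite /upd; case: eqVneq => // jc; apply: xy => //;
    by rewrite inE (negbTE jc).
by apply/funext => x; apply: H => j ->.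
Qed.

Definition indicatorR A x : R := (x \in A)%:R.

(** Averages commute, and averaging over a support leaves a constant, which further averaging
    preserves: both sides equal the average over [s] and [t] together. *)
Lemma average_indep A s t : dep_on [set` s] A -> dep_on [set` t] A ->
  average s (indicatorR A) = average t (indicatorR A).
Proof.
have indA u x y : dep_on [set` u] A -> {in u, x =1 y} ->
    indicatorR A x = indicatorR A y.
  move=> dA xy; rewrite /indicatorR; congr (_%:R); congr nat_of_bool.
  apply/idP/idP; rewrite !inE; first exact: dA.
  by apply: dA => c /= cu; rewrite xy.
move=> ds dt.
have -> : average s (indicatorR A) = average s (average t (indicatorR A)).
  rewrite averageC [X in average t X]average_const; last by move=> x y; exact: indA.
  by rewrite average_cst -average_const// => x y; exact: indA.
rewrite [X in average s X](@average_const t) ?average_cst; last first.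
  by move=> x y; exact: indA.
by rewrite -average_const// => x y; exact: indA.
Qed.

Definition coin_content A : R :=
  if pselect (finitely_determined A) is left e
  then average (sval (cid e)) (indicatorR A) point else 0.

Lemma coin_contentE s A : dep_on [set` s] A ->
  coin_content A = average s (indicatorR A) point.
Proof.
move=> dA; rewrite /coin_content; case: pselect => [e|[]]; last by exists s.
by rewrite (@average_indep _ (sval (cid e)) s)//; exact: (svalP (cid e)).
Qed.

Lemma coin_content0 : coin_content set0 = 0.
Proof. by rewrite (@coin_contentE [::])//= /indicatorR in_set0. Qed.

Lemma coin_content_ge0 A : 0 <= coin_content A.
Proof.
rewrite /coin_content; case: pselect => // e.
by apply: average_ge0 => x; rewrite /indicatorR ler0n.
Qed.

Lemma coin_contentU A B : finitely_determined A -> finitely_determined B ->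
  [disjoint A & B] -> coin_content (A `|` B) = coin_content A + coin_content B.
Proof.
move=> [s dA] [t dB] AB.
have dA' : dep_on [set` s ++ t] A.
  by apply: dep_onS dA => c /= cs; rewrite mem_cat cs.
have dB' : dep_on [set` s ++ t] B.
  by apply: dep_onS dB => c /= cs; rewrite mem_cat cs orbT.
rewrite !(@coin_contentE (s ++ t))//; last exact: dep_onU.
have -> : indicatorR (A `|` B) = indicatorR A \+ indicatorR B.
  apply/funext => x; rewrite /indicatorR/= -natrD; congr (_%:R).
  rewrite in_setU; have [xA|//] := boolP (x \in A).
  have [xB|//] := boolP (x \in B); rewrite !inE in xA xB.
  by move/disj_setPS: AB => /(_ x); case.
by rewrite averageD.
Qed.

Definition algebra_coin (A : set algebra_bits) : \bar R := (coin_content A)%:E.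

Let algebra_coin0 : algebra_coin set0 = 0%E.
Proof. by rewrite /algebra_coin coin_content0. Qed.

Let algebra_coin_ge0 A : (0 <= algebra_coin A)%E.
Proof. by rewrite lee_fin coin_content_ge0. Qed.

Let algebra_coin_sigma_additive : semi_sigma_additive algebra_coin.
Proof.
move=> F mF tF mUF.
(* The remainders [U n] decrease, are finitely determined and have empty intersection, so by
   compactness one of them is empty: finite additivity is enough. *)
pose U n := \bigcup_k F k `\` \big[setU/set0]_(i < n) F i.
have mV n : measurable (\big[setU/set0]_(i < n) F i) by exact: bigsetU_measurable.
have [n0 Un0] : exists n, U n = set0.
  apply: contrapT => /forallNP nU.
  have [||k|x Ux] := @finitely_determined_compact U.
  - by move=> k; exact: (@measurableD _ algebra_bits).
  - move=> m n mn; apply/subsetPset; apply: setDS.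
    exact: subset_bigsetU.
  - by apply/set0P/eqP; exact: nU.
  have [k _ Fkx] : (\bigcup_k F k) x by have [] := Ux 0%N I.
  have [_] := Ux k.+1 I; apply.
  by rewrite big_ord_recr/=; right.
have sumE n : (\sum_(0 <= i < n) algebra_coin (F i))%E =
    algebra_coin (\big[setU/set0]_(i < n) F i).
  elim: n => [|n IH]; first by rewrite big_nil big_ord0.
  rewrite big_nat_recr//= IH big_ord_recr/= /algebra_coin.
  rewrite (@coin_contentU _ (F n) (mV n) (mF n))//.
  apply/disj_setPS => x [+ Fx]; rewrite -bigcup_mkord => -[i /= ni Fix].
  have /trivIsetP/(_ i n I I) := tF; rewrite (ltn_eqF ni) => /(_ isT).
  by move/seteqP => [/(_ x) + _]; apply.
apply: cvg_near_cst; exists n0 => // n /= n0n.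
rewrite sumE; congr algebra_coin; apply/seteqP; split=> x.
  by rewrite -bigcup_mkord => -[k _ Fk]; exists k.
move=> Fx; apply: contrapT => nx.
have : U n0 x.
  split=> // h; by apply: nx; move: h; apply: (@subset_bigsetU _ F).
by rewrite Un0.
Qed.

HB.instance Definition _ := isMeasure.Build _ _ _ algebra_coin
  algebra_coin0 algebra_coin_ge0 algebra_coin_sigma_additive.

Definition coin (A : set (bits J)) : \bar R := (algebra_coin^*)%mu A.

Let coin0 : coin set0 = 0%E. Proof. exact: mu_ext0. Qed.

Let coin_ge0 A : (0 <= coin A)%E. Proof. exact: mu_ext_ge0. Qed.

Let coin_sigma_additive : semi_sigma_additive coin.
Proof.
have sub (A : set (bits J)) : measurable A -> ((algebra_coin^*)%mu).-caratheodory A.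
  move=> mA; apply: (@sub_caratheodory _ _ _ algebra_coin).
  move: A mA; apply: smallest_sub; first exact: smallest_sigma_algebra.
  move=> _ [F _ <-]; apply: sub_sigma_algebra; exists F; exact: dep_on_cyl.
move=> F mF tF mUF.
apply: (@caratheodory_measure_sigma_additive _ _ (algebra_coin^*)%mu) => //.
  by move=> i; exact: sub.
exact: sub.
Qed.

HB.instance Definition _ := isMeasure.Build _ _ _ coin
  coin0 coin_ge0 coin_sigma_additive.

Lemma coin_cyl (F : {fset J}) : coin (cyl F) = ((2^-1) ^+ #|` F|)%:E.
Proof.
have dF : dep_on [set` enum_fset F] (cyl F) by exact: dep_on_cyl.
rewrite /coin measurable_mu_extE; last by exists (enum_fset F).
rewrite /= /algebra_coin (coin_contentE dF); congr (_%:E).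
(* [t] lists the coins still to be averaged and [u] those already set. Each average moves one coin
   to [u]; only its value [true] contributes, with weight 1/2. *)
have avgE (t u : seq J) x : uniq t -> (forall j, j \in u -> j \notin t) ->
    F =i t ++ u ->
    average t (indicatorR (cyl F)) x = (2^-1) ^+ size t * (all x u)%:R.
  elim: t u x => [|c t IH] u x /=.
    move=> _ _ Fu; rewrite expr0 mul1r /indicatorR; congr (_%:R).
    congr nat_of_bool; apply/idP/allP; rewrite inE.
      by move=> h j ju; apply: h; rewrite Fu.
    by move=> h j; rewrite Fu; exact: h.
  move=> /andP[ct ut] uct Fu.
  have cu : c \notin u by apply/negP => /uct; rewrite mem_head.
  rewrite /resample.
  have tu j : j \in rcons u c -> j \notin t.
    rewrite mem_rcons inE => /orP[/eqP ->//|/uct].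
    by rewrite inE negb_or => /andP[].
  have Ftu : F =i t ++ rcons u c.
    by move=> j; rewrite Fu !inE !mem_cat mem_rcons !inE orbCA.
  have updu b : all (upd x c b) (rcons u c) = b && all x u.
    rewrite all_rcons {1}/upd eqxx; congr (_ && _); apply: eq_in_all => j ju.
    by rewrite /upd; case: eqVneq => // jc; rewrite -jc ju in cu.
  rewrite !(IH (rcons u c))// !updu/= exprS mulr0 addr0.
  by rewrite mulrC mulrA.
have /(_ point) := @avgE (enum_fset F) [::].
by rewrite /= mulr1 => ->//; rewrite cats0.
Qed.

Let coin_setT : coin setT = 1%E.
Proof. by rewrite -cyl0 coin_cyl cardfs0 expr0. Qed.

HB.instance Definition _ := Measure_isProbability.Build _ _ _ coin coin_setT.

End coin_content.
End finitely_determined.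

Arguments coin J R : clear implicits.

(** * Well-orders and conditional probabilities *)

Section well_order.
Context (J : eqType).
Implicit Types x y z : J.

Definition wle : rel J := sval (well_ordering_principle J).

Definition wlt : rel J := fun x y => (x != y) && wle x y.

Let wo : wo_chain wle predT.
Proof. by move=> A _; exact: (svalP (well_ordering_principle J)). Qed.

Lemma wle_total : total wle.
Proof. by move=> x y; apply: (wo_chainW wo). Qed.

Lemma wle_anti : antisymmetric wle.
Proof. by move=> x y; apply: (wo_chain_antisymmetric wo). Qed.

Lemma wlexx x : wle x x.
Proof. by have := wle_total x x; rewrite orbb. Qed.

Lemma wle_min (A : {pred J}) : (exists x, x \in A) ->
  exists2 m, m \in A & forall x, x \in A -> wle m x.
Proof. by move=> /(svalP (well_ordering_principle J))[m [[mA lA] _]]; exists m. Qed.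

Lemma wle_trans : transitive wle.
Proof.
move=> y x z xy yz.
have [m] := @wle_min [pred t | t \in [:: x; y; z]] (ex_intro _ x (mem_head _ _)).
rewrite !inE => /or3P[] /eqP -> h.
- by apply: h; rewrite !inE eqxx !orbT.
- suff -> : x = y by [].
  by apply: wle_anti; rewrite xy h// !inE eqxx.
- suff <- : y = z by [].
  by apply: wle_anti; rewrite yz h// !inE eqxx orbT.
Qed.

Lemma wltxx x : wlt x x = false.
Proof. by rewrite /wlt eqxx. Qed.

Lemma wltW x y : wlt x y -> wle x y.
Proof. by case/andP. Qed.

Lemma wltNge x y : wlt x y = ~~ wle y x.
Proof.
rewrite /wlt; have [->|xy] := eqVneq x y; first by rewrite wlexx.
have := wle_total x y; case: (boolP (wle y x)) => [yx _|_]; last by rewrite orbF.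
by apply/negbTE/negP => /= h; move/eqP: xy; apply; apply: wle_anti; rewrite h yx.
Qed.

Lemma wle_lt_trans y x z : wle x y -> wlt y z -> wlt x z.
Proof.
by rewrite !wltNge => xy; apply: contra => zx; exact: wle_trans xy.
Qed.

Lemma wlt_wf : well_founded wlt.
Proof.
move=> x; apply: contrapT => nx.
have [|m] := @wle_min [pred y | ~~ `[< Acc wlt y >]].
  by exists x; rewrite inE/=; apply/asboolPn.
rewrite inE/= => /asboolPn nm hm; apply: nm; constructor => y ym.
apply: contrapT => ny; move: ym; rewrite wltNge hm// inE/=.
exact/asboolPn.
Qed.

End well_order.

Section mix.
Context (J : choiceType) (R : realType).
Implicit Types (S : set J) (A B : set (bits J)) (x y : bits J) (c : J).
Local Notation mu := (coin J R).

Definition mix S x y : bits J := fun c => if `[< S c >] then x c else y c.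

Definition mix_pair S (p : bits J * bits J) := mix S p.1 p.2.

Lemma measurable_mix_pair S : measurable_fun setT (mix_pair S).
Proof.
apply: measurable_bits => c; rewrite /mix_pair /mix.
have [Sc|nSc] := pselect (S c).
  rewrite asboolT//= -[X in measurable X]setTI.
  exact: (@measurable_fst _ _ (bits J) (bits J) measurableT _ (measurable_coord c)).
rewrite asboolF//= -[X in measurable X]setTI.
exact: (@measurable_snd _ _ (bits J) (bits J) measurableT _ (measurable_coord c)).
Qed.

HB.instance Definition _ S := isMeasurableFun.Build _ _ _ _ (mix_pair S)
  (measurable_mix_pair S).

Lemma measurable_mix S x : measurable_fun setT (mix S x).
Proof. exact: measurableT_comp (measurable_mix_pair S) (pair1_measurable x). Qed.

(** A cylinder splits into its part in [S] and its part outside [S], and the exponents of 1/2 add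
    up. All conditioning on the coordinates in [S] rests on this identity. *)
Lemma coin_mix S A : measurable A ->
  (mu \x mu)%E (mix_pair S @^-1` A) = mu A.
Proof.
apply: (@bits_measure_unique _ _ (distribution (mu \x mu)%E (mix_pair S)) mu).
  by apply: (@le_lt_trans _ _ 1%E); [exact: probability_le1|exact: ltry].
move=> F; rewrite /distribution/= /pushforward.
pose G := [fset c in F | `[< S c >]]%fset.
pose H := [fset c in F | ~~ `[< S c >]]%fset.
have -> : mix_pair S @^-1` cyl F = cyl G `*` cyl H.
  apply/seteqP; split=> -[x y]; rewrite /mix_pair/=.
    move=> h; split=> c; rewrite !inE/= => /andP[cF Sc]; have := h _ cF.
      by rewrite /mix Sc.
    by rewrite /mix (negbTE Sc).
  move=> [hx hy] c cF; rewrite /mix; case: ifPn => Sc.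
    by apply: hx; rewrite !inE/= cF Sc.
  by apply: hy; rewrite !inE/= cF Sc.
rewrite product_measure1E; [|exact: measurable_cyl..].
rewrite [in LHS]/= !coin_cyl -EFinM -exprD; congr (_ ^+ _)%:E.
have FG : (F `&` G = G)%fset.
  by apply/fsetP => c; rewrite !inE; case: (c \in F).
have FH : (F `\` G = H)%fset.
  by apply/fsetP => c; rewrite !inE; case: (c \in F); rewrite ?andbT ?andbF.
by rewrite -(cardfsID G F) FG FH.
Qed.

Definition section S A x : set (bits J) := [set y | A (mix S x y)].

Lemma measurable_section S A x : measurable A -> measurable (section S A x).
Proof.
by move=> mA; rewrite -[section _ _ _]setTI; apply: measurable_mix.
Qed.

(** A version, defined at every point, of the conditional probability of [A] given the coordinates
    in [S]: keep these and toss all the others afresh. *)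
Definition cprob S A x : \bar R := mu (section S A x).

Lemma measurable_cprob S A : measurable A -> measurable_fun setT (cprob S A).
Proof.
move=> mA.
have mB : measurable (mix_pair S @^-1` A).
  by rewrite -[X in measurable X]setTI; exact: measurable_mix_pair.
have := measurable_fun_xsection mu mB; apply: eq_measurable_fun => x _ /=.
by rewrite /cprob; congr (mu _); apply/seteqP; split=> y; rewrite /xsection/= inE.
Qed.

Lemma dep_on_cprob S A x y : (forall c, S c -> x c = y c) ->
  cprob S A x = cprob S A y.
Proof.
move=> xy; congr (mu _); rewrite /section; suff -> : mix S x = mix S y by [].
apply/funext => z; apply/funext => c; rewrite /mix.
by case: asboolP => // /xy.
Qed.

Lemma dep_on_section S A x : dep_on S A ->
  section S A x = if x \in A then setT else set0.
Proof.
move=> dA; have AE y : A (mix S x y) = A x.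
  by apply: (dep_onE dA) => c Sc; rewrite /mix asboolT.
by case: ifPn => [|/negP]; rewrite inE => Ax; apply/seteqP; split=> y;
  rewrite /section/= AE.
Qed.

(** Fubini after [coin_mix]: over a point of [B] the sections of [A] and of its intersection with
    [B] coincide, because [B] depends on [S] only. *)
Lemma cprob_ge S A B (l : \bar R) : measurable A -> measurable B ->
  dep_on S B -> (0 <= l)%E -> (forall x, B x -> (l <= cprob S A x)%E) -> (l * mu B <= mu (A `&` B))%E.
Proof.
move=> mA mB dB l0 lB; rewrite -(@coin_mix S (A `&` B)); last exact: measurableI.
have mAB : measurable (mix_pair S @^-1` (A `&` B)).
  have := @measurable_mix_pair S measurableT _ (measurableI _ _ mA mB).
  by rewrite setTI.
have mf := measurable_fun_xsection mu mAB.
rewrite /product_measure1 -integral_cst//.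
apply: (@le_trans _ _ (\int[mu]_(x in B) mu (xsection (mix_pair S @^-1` (A `&` B)) x))%E).
  apply: ge0_le_integral => //.
    exact: measurable_funS mf.
  move=> x Bx; apply: (le_trans (lB _ Bx)).
  rewrite le_eqVlt; apply/orP; left; apply/eqP; congr (mu _).
  apply/seteqP; split=> y; rewrite /xsection/= inE /mix_pair/=; last by case.
  move=> Ay; split=> //; apply: dB Bx => c Sc.
  by rewrite /mix asboolT.
by apply: ge0_subset_integral => //.
Qed.
End mix.

Section real_probability.
Context d (T : measurableType d) (R : realType) (P : probability T R).
Implicit Types A B C : set T.

Definition pr A : R := fine (P A).

Lemma prE A : measurable A -> P A = (pr A)%:E.
Proof. by move=> mA; rewrite /pr fineK// fin_num_measure. Qed.

Lemma pr_ge0 A : 0 <= pr A.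
Proof. exact: fine_ge0. Qed.

Lemma pr_le A B : measurable A -> measurable B -> A `<=` B -> pr A <= pr B.
Proof.
by move=> mA mB AB; rewrite -lee_fin -!prE//; apply: le_measure; rewrite ?inE.
Qed.

Lemma prUD A B : measurable A -> measurable B -> [disjoint A & B] ->
  pr (A `|` B) = pr A + pr B.
Proof.
move=> mA mB AB; apply: EFin_inj; rewrite EFinD -!prE//.
  by rewrite measureU//; exact/disj_set2P.
exact: measurableU.
Qed.

Lemma prID A B : measurable A -> measurable B ->
  pr A = pr (A `&` B) + pr (A `\` B).
Proof.
move=> mA mB; have mI : measurable (A `&` B) by exact: measurableI.
have mD : measurable (A `\` B) by exact: measurableD.
rewrite -prUD//; first by rewrite setUIDK.
by apply/disj_setPS => x [[? ?] []].
Qed.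

Lemma prU A B : measurable A -> measurable B -> pr (A `|` B) <= pr A + pr B.
Proof.
move=> mA mB; rewrite (_ : A `|` B = A `|` (B `\` A)); last first.
  by apply/seteqP; split=> x [?|]; [left|have [?|?] := pselect (A x); [left|right]|left|case; right].
have mD : measurable (B `\` A) by exact: measurableD.
rewrite prUD//; last by apply/disj_setPS => x [? []].
by rewrite lerD2l pr_le//; exact: subDsetl.
Qed.

Lemma measurableY A B : measurable A -> measurable B -> measurable (A `+` B).
Proof.
by move=> mA mB; rewrite setY_def; apply: measurableU; exact: measurableD.
Qed.

Lemma pr_dist A B : measurable A -> measurable B ->
  `|pr A - pr B| <= pr (A `+` B).
Proof.
move=> mA mB; have mAB : measurable (A `\` B) by exact: measurableD.
have mBA : measurable (B `\` A) by exact: measurableD.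
rewrite setY_def prUD//; last by apply/disj_setPS => x [[? ?] [? ?]].
rewrite (prID mA mB) (prID mB mA) setIC.
have := pr_ge0 (A `\` B); have := pr_ge0 (B `\` A).
by rewrite ler_norml; lra.
Qed.

Lemma prT : pr setT = 1.
Proof. by rewrite /pr probability_setT. Qed.

Lemma pr_eq0 A : measurable A -> (pr A = 0) <-> (P A = 0%E).
Proof. by move=> mA; rewrite prE//; split => [-> //|[]]. Qed.

Lemma pr_cvg (F : (set T)^nat) e : (forall i, measurable (F i)) ->
  nondecreasing_seq F -> 0 < e -> exists n, pr (\bigcup_i F i `\` F n) <= e.
Proof.
move=> mF ndF e0.
have mU : measurable (\bigcup_i F i) by exact: bigcupT_measurable.
have : (P \o F @ \oo --> (pr (\bigcup_i F i))%:E)%E.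
  by rewrite -prE//; exact: nondecreasing_cvg_mu.
move=> /fine_cvgP[_] /cvgrPdist_le /(_ _ e0)[n _ /(_ n)].
rewrite /= leqnn => /(_ isT) h; exists n.
have := prID mU (mF n); rewrite setIidr; last exact: bigcup_sup.
by move: h; rewrite -/(pr _) ler_norml => /andP[]; lra.
Qed.

End real_probability.

(** * Approximation by events on finitely many coordinates *)

Section approximation.
Context (J : choiceType) (R : realType).
Implicit Types (P : probability (bits J) R) (S : set J) (A B : set (bits J)).

Definition approximable P A := forall e : R, 0 < e -> exists F : {fset J},
  exists B, [/\ measurable B, dep_on [set` F] B & pr P (A `+` B) <= e].

Let approximableU P A B : measurable A -> measurable B ->
  approximable P A -> approximable P B -> approximable P (A `|` B).
Proof.
move=> mA mB aA aB e e0.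
have e20 : 0 < e / 2 by lra.
have [F [A' [mA' dA' AA']]] := aA _ e20.
have [G [B' [mB' dB' BB']]] := aB _ e20.
exists (F `|` G)%fset, (A' `|` B'); split; first exact: measurableU.
  apply: dep_onU; [apply: dep_onS dA'|apply: dep_onS dB'] => c /=;
    by rewrite in_fsetU => ->; rewrite ?orbT.
have mAA' : measurable (A `+` A') by exact: measurableY.
have mBB' : measurable (B `+` B') by exact: measurableY.
apply: (@le_trans _ _ (pr P ((A `+` A') `|` (B `+` B')))).
  apply: pr_le; [by apply: measurableY; exact: measurableU|exact: measurableU|].
  rewrite !setY_def => x /= [] [].
    by move=> [Ax|Bx] /not_orP[]; [left|right]; left.
  by move=> [Ax|Bx] /not_orP[]; [left|right]; right.
by have := prU P mAA' mBB'; lra.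
Qed.

Lemma measurable_approximable P A : measurable A -> approximable P A.
Proof.
move=> mA; suff : measurable A /\ approximable P A by case.
move: A mA; apply: smallest_sub.
  have sC A : measurable A /\ approximable P A -> measurable (~` A) /\ approximable P (~` A).
    move=> [mA aA]; split; first exact: measurableC.
    move=> e e0; have [F [B [mB dB AB]]] := aA _ e0.
    exists F, (~` B); split; [exact: measurableC|exact: dep_onC|].
    rewrite (_ : ~` A `+` ~` B = A `+` B)//.
    by rewrite !setY_def !setDE !setCK setUC (setIC _ B) (setIC A).
  have s0 : measurable (set0 : set (bits J)) /\ approximable P set0.
    split=> // e e0; exists fset0, set0; split=> //.
    by rewrite setYK /pr measure0 ltW.
  split => //; first by move=> A; rewrite setTD; exact: sC.
  move=> F aF; have mF i : measurable (F i) by case: (aF i).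
  have mU : measurable (\bigcup_i F i) by exact: bigcupT_measurable.
  split=> // e e0; pose G n := \big[setU/set0]_(i < n) F i.
  have aG n : measurable (G n) /\ approximable P (G n).
    elim: n => [|n [mG aGn]]; first by rewrite /G big_ord0.
    rewrite /G big_ord_recr/=; split; first exact: measurableU.
    by apply: approximableU => //; case: (aF n).
  have mG n : measurable (G n) by case: (aG n).
  have ndG : nondecreasing_seq G.
    by move=> m n mn; apply/subsetPset; exact: subset_bigsetU.
  have UG : \bigcup_i G i = \bigcup_i F i.
    apply/seteqP; split=> x [i _].
      by rewrite /G -bigcup_mkord => -[k _ Fk]; exists k.
    by move=> Fx; exists i.+1 => //; rewrite /G big_ord_recr/=; right.
  have e20 : 0 < e / 2 by lra.
  have [n Gn] := pr_cvg P mG ndG e20; rewrite UG in Gn.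
  have [H [B [mB dB GB]]] := (aG n).2 _ e20.
  exists H, B; split=> //.
  have mGB : measurable (G n `+` B) by exact: measurableY.
  have mUG : measurable (\bigcup_i F i `\` G n) by exact: measurableD.
  apply: (@le_trans _ _ (pr P ((\bigcup_i F i `\` G n) `|` (G n `+` B)))).
    apply: pr_le; [exact: measurableY|exact: measurableU|].
    rewrite !setY_def => x /= [] [].
      by move=> Fx nBx; have [Gx|nGx] := pselect (G n x); [right; left|left].
    move=> Bx nFx; right; right; split=> // Gx; apply: nFx.
    by rewrite -UG; exists n.
  by have := prU P mUG mGB; lra.
move=> _ [F _ <-]; split; first exact: measurable_cyl.
move=> e e0; exists F, (cyl F); split; [exact: measurable_cyl|exact: dep_on_cyl|].
by rewrite setYK /pr measure0 ltW.
Qed.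

Definition mask S (x : bits J) : bits J := fun c => `[< S c >] && x c.

Lemma measurable_mask S : measurable_fun setT (mask S).
Proof.
apply: measurable_bits => c; rewrite /mask.
have [Sc|nSc] := pselect (S c).
  by rewrite asboolT//=; exact: measurable_coord.
rewrite asboolF//= (_ : [set _ | _] = set0)//.
by apply/seteqP; split.
Qed.

HB.instance Definition _ S := isMeasurableFun.Build _ _ _ _ (mask S)
  (measurable_mask S).

Lemma mask_id S x c : S c -> mask S x c = x c.
Proof. by move=> Sc; rewrite /mask asboolT. Qed.

Lemma preimage_mask S A : dep_on S A -> mask S @^-1` A = A.
Proof.
move=> dA; apply/seteqP; split=> x /=; first by apply: dA => c /mask_id.
by apply: dA => c /mask_id ->.
Qed.

Lemma dep_on_preimage_mask S S' A : dep_on S' A ->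
  dep_on (S `&` S') (mask S @^-1` A).
Proof.
move=> dA x y xy /=; apply: dA => c S'c; rewrite /mask.
by case: asboolP => //= Sc; exact: xy.
Qed.

Lemma measurable_preimage_mask S A : measurable A -> measurable (mask S @^-1` A).
Proof. by move=> mA; rewrite -[X in measurable X]setTI; exact: measurable_mask. Qed.

(** Approximate under the image of [P] by [mask S], which erases the coordinates outside [S];
    pulling back along [mask S] then confines the support to [S] and leaves [A] unchanged. *)
Lemma approximate P S A (e : R) : measurable A -> dep_on S A -> 0 < e ->
  exists F : {fset J}, exists B, [/\ measurable B, [set` F] `<=` S,
    dep_on [set` F] B & pr P (A `+` B) <= e].
Proof.
move=> mA dA e0.
have [F [B [mB dB AB]]] := @measurable_approximable (distribution P (mask S)) A mA e e0.
exists [fset c in F | `[< S c >]]%fset, (mask S @^-1` B); split.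
- exact: measurable_preimage_mask.
- by move=> c /=; rewrite !inE/= => /andP[_ /asboolP].
- apply: dep_onS (@dep_on_preimage_mask S _ _ dB) => c [Sc Fc] /=.
  by rewrite !inE/= Fc/=; apply/asboolP.
- by move: AB; rewrite -{2}(preimage_mask dA).
Qed.

End approximation.

Section coin_sections.
Context (J : choiceType) (R : realType).
Implicit Types (S : set J) (A B : set (bits J)) (x y : bits J) (c : J).
Local Notation mu := (coin J R).
Local Notation prc := (pr (coin J R)).

Lemma coin_coordb c b : prc [set x | x c = b] = 2^-1.
Proof.
have h : prc [set x | x c] = 2^-1.
  by rewrite -cyl1 /pr /= coin_cyl cardfs1 expr1.
case: b; first exact: h.
have /(_ setT [set x | x c]) := prID mu.
move=> /(_ measurableT (measurable_coord c)); rewrite prT setTI h.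
rewrite (_ : setT `\` _ = [set x : bits J | x c = false]).
  by set p := pr _ _; lra.
apply/seteqP; split=> x /=; first by case=> _ /negP/negbTE.
by move=> ->.
Qed.

Lemma upd_id x c : upd x c (x c) = x.
Proof. by apply/funext => j; rewrite /upd; case: eqP => [->|]. Qed.

Lemma measurable_upd c b : measurable_fun setT (fun x : bits J => upd x c b).
Proof.
apply: measurable_bits => j; rewrite /upd; case: eqP => [_|_].
  case: b; first by rewrite (_ : [set _ | _] = setT)//; apply/seteqP; split.
  by rewrite (_ : [set _ | _] = set0)//; apply/seteqP; split.
exact: measurable_coord.
Qed.

Lemma measurable_preimage_upd c b A : measurable A ->
  measurable [set x | A (upd x c b)].
Proof. by move=> mA; rewrite -[X in measurable X]setTI; exact: measurable_upd. Qed.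

(** Since the coin [c] is independent of the others, the modified set has at most twice the measure
    of [A]. *)
Lemma null_upd c b A : measurable A -> mu A = 0%E ->
  mu [set x | A (upd x c b)] = 0%E.
Proof.
move=> mA A0; set A' := [set x | _].
have mA' : measurable A' by exact: measurable_preimage_upd.
have mB : measurable [set x : bits J | x c = b] by exact: measurable_coordb.
have : (mu A' * mu [set x : bits J | x c = b] <= mu (A `&` [set x | x c = b]))%E.
  apply: (@cprob_ge _ _ [set c]) => //.
    by move=> x y xy /= <-; rewrite xy.
  move=> x xcb; rewrite le_eqVlt; apply/orP; left; apply/eqP.
  rewrite /cprob; congr (mu _); apply/seteqP.
  have E y : mix [set c] x y = upd y c b.
    apply/funext => j; rewrite /mix /upd; case: asboolP => /= [->|/eqP/negbTE ->//].
    by rewrite eqxx.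
  by split=> y; rewrite /section/= E.
have : (mu (A `&` [set x | x c = b]) <= mu A)%E.
  by apply: le_measure; rewrite ?inE//; exact: measurableI.
move=> le1 /le_trans /(_ le1); rewrite A0.
rewrite [X in (X * _)%E]prE// [X in (_ * X)%E]prE// coin_coordb -EFinM lee_fin => h.
apply/pr_eq0 => //; apply/eqP; rewrite eq_le pr_ge0 andbT; move: h.
by rewrite pmulr_lle0.
Qed.

Lemma measurable_cprob_ge S A (l : \bar R) : measurable A ->
  measurable [set x | (l <= cprob R S A x)%E].
Proof.
move=> mA; rewrite -[X in measurable X]setTI.
by apply: measurable_lee => //; exact: measurable_cprob.
Qed.

Lemma measurable_cprob_lt S A (l : \bar R) : measurable A ->
  measurable [set x | (cprob R S A x < l)%E].
Proof.
move=> mA; rewrite (_ : [set x | _] = ~` [set x | (l <= cprob R S A x)%E]).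
  by apply: measurableC; exact: measurable_cprob_ge.
by apply/seteqP; split=> x /=; rewrite ltNge => /negP.
Qed.

Lemma dep_on_cprob_lt S A (l : \bar R) : dep_on S [set x | (cprob R S A x < l)%E].
Proof. by move=> x y xy /=; rewrite (dep_on_cprob R A xy). Qed.

Lemma null_cprob S A : measurable A -> mu A = 0%E ->
  mu [set x | (0 < cprob R S A x)%E] = 0%E.
Proof.
move=> mA A0.
have B0 n : mu [set x | ((n.+1%:R^-1)%:E <= cprob R S A x)%E] = 0%E.
  set B := [set x | _].
  have mB : measurable B by exact: measurable_cprob_ge.
  have : ((n.+1%:R^-1)%:E * mu B <= mu (A `&` B))%E.
    apply: (@cprob_ge _ _ S) => //.
    by move=> x y xy; rewrite /B/= (dep_on_cprob R A xy).
  have : (mu (A `&` B) <= mu A)%E.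
    by apply: le_measure; rewrite ?inE//; exact: measurableI.
  move=> le1 /le_trans /(_ le1); rewrite A0.
  rewrite prE// -EFinM lee_fin => h.
  congr (_%:E); apply/eqP; rewrite eq_le pr_ge0 andbT; move: h.
  by rewrite pmulr_rle0// invr_gt0.
rewrite (_ : [set x | _] = \bigcup_n [set x | ((n.+1%:R^-1)%:E <= cprob R S A x)%E]).
  apply: measure_negligible; first by apply: bigcupT_measurable => n; exact: measurable_cprob_ge.
  apply: negligible_bigcup => n; apply/negligibleP; last exact: B0.
  exact: measurable_cprob_ge.
apply/seteqP; split=> x /=; last first.
  by move=> [n _ /=]; apply: lt_le_trans; rewrite lte_fin invr_gt0.
have cE : cprob R S A x = (fine (cprob R S A x))%:E.
  by rewrite fineK// /cprob fin_num_measure//; exact: measurable_section.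
rewrite cE lte_fin => c0; set r := fine _ in cE c0.
exists (Num.truncn (r^-1)) => //=; rewrite cE lee_fin.
rewrite invf_ple ?posrE//; exact/ltW/truncnS_gt.
Qed.

End coin_sections.

(** * Maximal inequality and zero-one law *)

Section martingale.
Context (J : choiceType) (R : realType).
Implicit Types (A B H : set (bits J)) (x y : bits J) (c : J).
Local Notation mu := (coin J R).
Local Notation prc := (pr (coin J R)).
Variable S : nat -> set J.
Hypothesis ndS : forall i j, (i <= j)%N -> S i `<=` S j.

(** Doob's argument: cut the union according to the first index at which the level [l] is reached.
    The piece of index [i] is determined by [S i], so [cprob_ge] applies to it. *)
Lemma maximal_inequality H (l : R) : measurable H -> 0 <= l ->
  l * prc (\bigcup_i [set x | (l%:E <= cprob R (S i) H x)%E]) <= prc H.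
Proof.
move=> mH l0; pose E i := [set x | (l%:E <= cprob R (S i) H x)%E].
have mE i : measurable (E i) by exact: measurable_cprob_ge.
pose D := seqDU E.
have mD i : measurable (D i).
  by apply: measurableD => //; exact: bigsetU_measurable.
have mUD : measurable (\bigcup_i D i) by exact: bigcupT_measurable.
have dE i : dep_on (S i) (E i).
  by move=> x y xy; rewrite /E/= (dep_on_cprob R H xy).
have dD i : dep_on (S i) (D i).
  rewrite /D /seqDU setDE; apply: dep_onI => //; apply: dep_onC.
  rewrite -bigcup_mkord; apply: dep_on_bigcup => j /= ji.
  by apply: dep_onS (dE j); apply: ndS; exact: ltnW.
have step i : (l%:E * mu (D i) <= mu (H `&` D i))%E.
  apply: (cprob_ge mH (mD i) (dD i)); first by rewrite lee_fin.
  by move=> x [].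
rewrite (_ : \bigcup_i _ = \bigcup_i D i); last exact: seqDU_bigcup_eq.
rewrite -lee_fin EFinM -!prE//.
apply: (@le_trans _ _ (mu (H `&` \bigcup_i D i))); last first.
  by apply: le_measure; rewrite ?inE//; exact: measurableI.
rewrite setI_bigcupr !measure_semi_bigcup//.
- rewrite -nneseriesZl//; apply: lee_nneseries => [i _ _|i _]; [exact: mule_ge0|exact: step].
- by move=> i; exact: measurableI.
- exact/trivIset_setIl/trivIset_seqDU.
- by rewrite -setI_bigcupr; exact: measurableI.
- exact: trivIset_seqDU.
Qed.

(* [A] is close to a set [B] determined at stage [k]; after stage [k], on [B],
   only [B `\` A] contributes to the conditional probability of [~` A], and the
   maximal inequality applies to it. *)
Lemma levy_zero_one A (l : R) : measurable A -> dep_on (\bigcup_i S i) A -> 0 < l ->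
  mu (A `&` \bigcap_k \bigcup_(i in [set i | (k <= i)%N])
    [set x | (l%:E <= cprob R (S i) (~` A) x)%E]) = 0%E.
Proof.
move=> mA dA l0; set N := _ `&` _.
have mA' : measurable (~` A) by exact: measurableC.
have mN : measurable N.
  apply: measurableI => //; apply: bigcap_measurable => // k _.
  by apply: bigcup_measurable => i _; exact: measurable_cprob_ge.
apply: (pr_eq0 mu mN).1; apply/eqP; rewrite eq_le pr_ge0 andbT.
apply/ler_addgt0Pl => e e0; rewrite addr0.
(* Both differences of [A] and [B] will have at most this measure; the maximal inequality multiplies
   one of them by [l^-1], and the two errors add up to [e]. *)
have e10 : 0 < e / (1 + l^-1) by rewrite divr_gt0// ltr_wpDr// ltW// invr_gt0.
have [F [B [mB FS dB AB]]] := approximate mu mA dA e10.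
have [k Fk] : exists k, [set` F] `<=` S k.
  have : forall s : seq J, {subset s <= F} -> exists k, [set` s] `<=` S k.
    elim=> [_|c s IH sF]; first by exists 0%N.
    have [|k sk] := IH; first by move=> c' c's; apply: sF; rewrite inE c's orbT.
    have [i _ ci] := FS c (sF c (mem_head _ _)).
    exists (maxn i k) => c' /=; rewrite inE => /orP[/eqP ->|c's].
      exact: (ndS (leq_maxl i k)).
    by apply: (ndS (leq_maxr i k)); exact: sk.
  by move=> /(_ F); apply.
pose H := B `\` A.
have mH : measurable H by exact: measurableD.
have mAB : measurable (A `\` B) by exact: measurableD.
pose U := \bigcup_i [set x | (l%:E <= cprob R (S i) H x)%E].
have mU : measurable U by apply: bigcupT_measurable => i; exact: measurable_cprob_ge.
have NU : N `<=` (A `\` B) `|` U.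
  move=> x [Ax /(_ k I)[i /= ki lx]].
  have [Bx|nBx] := pselect (B x); [right|by left].
  exists i => //=; apply: (le_trans lx); rewrite /cprob.
  apply: le_measure; rewrite ?inE; [exact: measurable_section..|].
  move=> y /= nA; split=> //; apply: dB Bx => c /Fk/(ndS ki) Sc.
  by rewrite /mix asboolT.
have le1 : prc N <= prc (A `\` B) + prc U.
  by apply: le_trans (prU _ mAB mU); apply: pr_le => //; exact: measurableU.
have le2 := maximal_inequality mH (ltW l0); rewrite -/U in le2.
have le3 : prc (A `\` B) <= e / (1 + l^-1).
  by apply: le_trans AB; apply: pr_le => //; [exact: measurableY|rewrite setY_def; left].
have le4 : prc H <= e / (1 + l^-1).
  by apply: le_trans AB; apply: pr_le => //; [exact: measurableY|rewrite setY_def; right].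
have le5 : prc U <= l^-1 * (e / (1 + l^-1)).
  by rewrite ler_pdivlMl//; exact: le_trans le4.
have -> : e = e / (1 + l^-1) + l^-1 * (e / (1 + l^-1)).
  rewrite [X in _ + X]mulrC -[X in X + _]mulr1 -mulrDr mulfVK//.
  by rewrite gt_eqF// ltr_wpDr// ltW// invr_gt0.
by apply: (le_trans le1); exact: lerD.
Qed.

End martingale.

(** * Lower densities *)

Section lower_density.
Context (J : choiceType) (R : realType).
Implicit Types (S : set J) (A B C : set (bits J)) (x y : bits J) (b c : J).
Local Notation mu := (coin J R).
Local Notation operator := (set (bits J) -> set (bits J)).

Lemma cprobC S A x : measurable A -> exists p : R,
  cprob R S A x = p%:E /\ cprob R S (~` A) x = (1 - p)%:E.
Proof.
move=> mA; exists (pr mu (section S A x)).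
have mS : measurable (section S A x) by exact: measurable_section.
split; first by rewrite /cprob prE.
rewrite /cprob (_ : section _ (~` A) x = ~` section S A x)//.
by rewrite probability_setC// EFinB -(prE mu mS).
Qed.

(** A lower density on the [S]-determined sets. The third clause combines monotonicity and
    invariance under null changes (take [A] = [B]) with stability under intersection (take for [C]
    the intersection). *)
Definition is_density S (D : operator) :=
  [/\ forall A, measurable A -> dep_on S A -> mu.-negligible (A `+` D A),
      forall A, measurable A -> dep_on S A -> mu A = 0%E -> D A `<=` set0 &
      forall A B C, measurable A -> measurable B -> measurable C ->
        dep_on S A -> dep_on S B -> dep_on S C ->
        mu ((A `&` B) `\` C) = 0%E -> D A `&` D B `<=` D C].

Definition below b : set J := [set c | wle c b].

Definition cofinal S (s : nat -> J) :=
  [/\ forall i, S (s i), forall i j, (i <= j)%N -> wle (s i) (s j) &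
      forall b, S b -> exists i, wle b (s i)].

(* Density along the initial segment [S]: by the zero-one law the conditional
   probabilities of a set along a countable cofinal sequence converge to its
   indicator; without such a sequence every measurable set is already
   determined below some element of [S]. *)
Definition lim_density S (th : J -> operator) : operator := fun A =>
  if pselect (S !=set0) then
    if pselect (exists s, cofinal S s) is left e then
      [set x | forall m : nat, exists k : nat, forall i, (k <= i)%N ->
        th (sval (cid e) i)
          [set y | (cprob R (below (sval (cid e) i)) (~` A) y < m.+1%:R^-1%:E)%E] x]
    else [set x | exists2 b, S b & dep_on (below b) A /\ th b A x]
  else A.

Lemma eq_lim_density S th th' : (forall b, S b -> th b = th' b) ->
  lim_density S th = lim_density S th'.
Proof.
move=> E; apply/funext => A; rewrite /lim_density.
case: pselect => // S0; case: pselect => [e|_].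
  have [sS _ _] := svalP (cid e).
  apply/seteqP; split=> x h m; have [k hk] := h m; exists k => i /hk;
    by rewrite E//; exact: sS.
by apply/seteqP; split=> x [b Sb [dA h]]; exists b => //; split=> //;
  move: h; rewrite E.
Qed.

Lemma dep_on_two S S' A : dep_on S A -> dep_on S' A -> dep_on (S `&` S') A.
Proof.
by move=> dS dS'; rewrite -(preimage_mask dS); exact: dep_on_preimage_mask.
Qed.

(** If a countable support of [A] were unbounded in [S], the running maximum of an enumeration of
    its part in [S] would be a cofinal sequence. *)
Lemma bounded_support S A : S !=set0 -> ~ (exists s, cofinal S s) ->
  measurable A -> dep_on S A -> exists2 b, S b & dep_on (below b) A.
Proof.
move=> [b0 Sb0] nS mA dA.
have [K cK dK] := countable_support mA.
have [[b [Sb hb]]|nb] := pselect (exists b, S b /\ S `&` K `<=` below b).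
  by exists b => //; exact: (dep_onS hb (dep_on_two dA dK)).
exfalso; apply: nS.
have cSK : countable (S `&` K) by apply: sub_countable cK; apply: subset_card_le => x [].
have SK0 : S `&` K !=set0.
  apply/set0P/negP => /eqP SK0; apply: nb; exists b0; split=> //.
  by rewrite SK0.
have [f fSK] : exists f : nat -> J, f @` setT = S `&` K.
  by have /pfcard_geP [/eqP|[f]] := cSK;
    [move/set0P: SK0 => /negbTE -> //|exists f; rewrite image_eq].
have fS i : S (f i) by have : (S `&` K) (f i) by [rewrite -fSK; exists i]; case.
pose s := fix s i := if i is i'.+1 then
  (if wle (s i') (f i'.+1) then f i'.+1 else s i') else f 0%N.
have sle i : wle (s i) (s i.+1) by rewrite /=; case: ifP => // _; exact: wlexx.
have fs i : wle (f i) (s i).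
  case: i => [|i]; first exact: wlexx.
  rewrite /=; case: ifPn => [_|]; first exact: wlexx.
  by rewrite -wltNge => /wltW.
exists s; split.
- by elim=> [|i IH] /=; [exact: fS|case: ifP].
- move=> i j; elim: j => [|j IH]; first by rewrite leqn0 => /eqP ->; exact: wlexx.
  rewrite leq_eqVlt => /orP[/eqP ->|]; first exact: wlexx.
  by rewrite ltnS => /IH h; exact: wle_trans (sle j).
- move=> b Sb; apply: contrapT => nsb; apply: nb; exists b; split=> // c.
  rewrite -fSK => -[i _ <-]; apply: wle_trans (fs i) _.
  by have /orP[//|h] := wle_total (s i) b; exfalso; apply: nsb; exists i.
Qed.

Definition coherent S (th : J -> operator) := forall b c, S b -> S c -> wle b c ->
  forall A, measurable A -> dep_on (below b) A -> th c A = th b A.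

Section limit.
Variables (S : set J) (th : J -> operator).
Hypothesis Sdown : forall b c, S c -> wle b c -> S b.
Hypothesis thP : forall b, S b -> is_density (below b) (th b).
Hypothesis thC : coherent S th.

Let belowS b : S b -> below b `<=` S.
Proof. by move=> Sb c; exact: Sdown. Qed.

Lemma lim_density_coherent b A : S b -> measurable A -> dep_on (below b) A ->
  lim_density S th A = th b A.
Proof.
move=> Sb mA dA; rewrite /lim_density; case: pselect => [S0|nS]; last by exfalso; apply: nS; exists b.
case: pselect => [e|ne]; last first.
  apply/seteqP; split=> [x [c Sc [dcA]]|x tx]; last by exists b.
  have [bc|cb] := orP (wle_total b c); first by rewrite (thC Sb Sc).
  by rewrite (thC Sc Sb).
case: (cid e) => s [sS sle sc] /=; have [i0 bi0] := sc _ Sb.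
(* Beyond [b] the conditional probability of the complement is 0 or 1, and every threshold is
   positive and at most 1: the threshold event is [A] itself. *)
have E i m : wle b (s i) ->
    [set y | (cprob R (below (s i)) (~` A) y < m.+1%:R^-1%:E)%E] = A.
  move=> bi; have dA' : dep_on (below (s i)) (~` A).
    by apply: dep_onC; apply: dep_onS dA => c /= cb; exact: wle_trans bi.
  apply/seteqP; split=> y /=; rewrite /cprob dep_on_section//.
    case: ifPn; last by rewrite notin_setE /= => /contrapT.
    by rewrite probability_setT lte_fin ltNge invf_le1 ?ltr0n// ler1n.
  move=> Ay; rewrite ifF ?measure0 ?lte_fin ?invr_gt0//.
  by apply/negbTE; rewrite notin_setE.
apply/seteqP; split=> x.
  move=> /(_ 0%N)[k /(_ (maxn k i0))]; rewrite leq_maxl => /(_ isT).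
  have bi : wle b (s (maxn k i0)) by apply: wle_trans bi0 _; exact/sle/leq_maxr.
  by rewrite E// (thC Sb).
move=> tx m; exists i0 => i ii0.
have bi : wle b (s i) by apply: wle_trans bi0 _; exact: sle.
by rewrite E// (thC Sb).
Qed.

Let sub_cprob U A B C x : measurable A -> measurable B -> measurable C ->
  (cprob R U (~` C) x <= cprob R U (~` A) x + cprob R U (~` B) x
      + cprob R U ((A `&` B) `\` C) x)%E.
Proof.
move=> mA mB mC; rewrite /cprob.
have mCA : measurable (section U (~` A) x) by apply: measurable_section; exact: measurableC.
have mCB : measurable (section U (~` B) x) by apply: measurable_section; exact: measurableC.
have mCC : measurable (section U (~` C) x) by apply: measurable_section; exact: measurableC.
have mD : measurable (section U ((A `&` B) `\` C) x).
  by apply: measurable_section; apply: measurableD => //; exact: measurableI.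
rewrite !(prE mu)// -!EFinD lee_fin.
have mAB : measurable (section U (~` A) x `|` section U (~` B) x) by exact: measurableU.
apply: (@le_trans _ _ (pr mu ((section U (~` A) x `|` section U (~` B) x)
    `|` section U ((A `&` B) `\` C) x))).
  apply: pr_le => //; first exact: measurableU.
  move=> y /= nC; have [Ay|] := pselect (A (mix U x y)); last by left; left.
  by have [By|] := pselect (B (mix U x y)); [right|left; right].
by apply: le_trans (prU _ mAB mD) _; rewrite lerD2r prU.
Qed.

(** By [sub_cprob] the threshold events of [A] and [B] force that of [C], except where the null set
    that is left has positive conditional probability. This exception is null at stage [s i], and
    applying [th (s i)] to the threshold events removes it, so the inclusion holds at every
    point. *)
Lemma lim_density_sub A B C : measurable A -> measurable B -> measurable C ->
  dep_on S A -> dep_on S B -> dep_on S C -> mu ((A `&` B) `\` C) = 0%E ->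
  lim_density S th A `&` lim_density S th B `<=` lim_density S th C.
Proof.
move=> mA mB mC dA dB dC ABC.
have mABC : measurable ((A `&` B) `\` C) by apply: measurableD => //; exact: measurableI.
have [S0|S0] := pselect (S !=set0); last first.
  rewrite /lim_density; case: pselect => // ?.
  have dD : dep_on set0 ((A `&` B) `\` C).
    rewrite setDE; apply: dep_onI; last by apply: dep_onC; apply: dep_onS dC => c Sc; apply: S0; exists c.
    by apply: dep_onI; [apply: dep_onS dA|apply: dep_onS dB] => c Sc; apply: S0; exists c.
  move=> x ABx; apply: contrapT => nCx.
  have : (A `&` B) `\` C = setT.
    by apply/seteqP; split=> // y _; apply: dD (_ : ((A `&` B) `\` C) x).
  by move=> h; move: ABC; rewrite h probability_setT => /eqP; rewrite onee_eq0.
have [e|ne] := pselect (exists s, cofinal S s); last first.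
  have [a Sa da] := bounded_support S0 ne mA dA.
  have [b Sb db] := bounded_support S0 ne mB dB.
  have [c Sc dc] := bounded_support S0 ne mC dC.
  have [m [Sm am bm cm]] : exists m, [/\ S m, wle a m, wle b m & wle c m].
    have [m1 [S1 am1 bm1]] : exists m, [/\ S m, wle a m & wle b m].
      by have [ab|ba] := orP (wle_total a b); [exists b|exists a]; rewrite ?wlexx.
    have [mc|cm] := orP (wle_total m1 c); last by exists m1.
    by exists c; rewrite wlexx; split=> //; exact: wle_trans mc.
  have lift a' A' : wle a' m -> dep_on (below a') A' -> dep_on (below m) A'.
    by move=> am' ; apply: dep_onS => j /= ja; exact: wle_trans am'.
  rewrite !(@lim_density_coherent m)//; [|exact: lift dc|exact: lift db|exact: lift da].
  have [_ _ +] := thP Sm; apply => //; [exact: lift da|exact: lift db|exact: lift dc].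
rewrite /lim_density; case: pselect => // ?; case: pselect => // {}e.
case: (cid e) => s [sS sle sc] /= x [Ax Bx] m.
(* The index [m.*2.+1] is the threshold [1/(2m+2)]; two of them make [1/(m+1)]. *)
have [k hA] := Ax m.*2.+1; have [l hB] := Bx m.*2.+1.
exists (maxn k l) => i; rewrite geq_max => /andP[ki li].
have [_ _ +] := thP (sS i).
move/(_ _ _ [set y | (cprob R (below (s i)) (~` C) y < m.+1%:R^-1%:E)%E]
   (measurable_cprob_lt _ _ (measurableC mA)) (measurable_cprob_lt _ _ (measurableC mB))
   (measurable_cprob_lt _ _ (measurableC mC)) (@dep_on_cprob_lt _ _ _ _ _)
   (@dep_on_cprob_lt _ _ _ _ _) (@dep_on_cprob_lt _ _ _ _ _)).
move=> h; have := conj (hA _ ki) (hB _ li); apply: h.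
apply: measure_negligible.
  apply: measurableD; last by apply: measurable_cprob_lt; exact: measurableC.
  by apply: measurableI; apply: measurable_cprob_lt; exact: measurableC.
apply: (@negligibleS _ _ _ _ [set y | (0 < cprob R (below (s i)) ((A `&` B) `\` C) y)%E]).
  move=> y /= [[h1 h2]] /negP; rewrite -leNgt => h3.
  rewrite lt0e measure_ge0 andbT; apply/eqP => h0.
  have := sub_cprob (below (s i)) y mA mB mC; rewrite h0 adde0.
  apply/negP; rewrite -ltNge; apply: lt_le_trans h3.
  have -> : (m.+1%:R^-1%:E = m.*2.+2%:R^-1%:E + m.*2.+2%:R^-1%:E :> \bar R)%E.
    rewrite -EFinD; congr (_%:E); rewrite -doubleS -mul2n natrM.
    have : (m.+1%:R : R) != 0 by rewrite pnatr_eq0.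
    by move=> ?; field.
  by apply: lteD.
have m0 : measurable [set y | (0 < cprob R (below (s i)) ((A `&` B) `\` C) y)%E].
  rewrite (_ : [set y | _] = ~` [set y | (cprob R (below (s i)) ((A `&` B) `\` C) y <= 0)%E]); last first.
    by apply/seteqP; split=> y /=; rewrite ltNge => /negP.
  apply: measurableC; rewrite -[X in measurable X]setTI.
  by apply: measurable_lee => //; exact: measurable_cprob.
by apply/negligibleP => //; exact: null_cprob.
Qed.

Lemma lim_density_null A : measurable A -> dep_on S A -> mu A = 0%E ->
  lim_density S th A `<=` set0.
Proof.
move=> mA dA A0.
have [S0|S0] := pselect (S !=set0); last first.
  rewrite /lim_density; case: pselect => // ? x Ax.
  have AT : A = setT.
    by apply/seteqP; split=> // y _; apply: dA Ax => c Sc; exfalso; apply: S0; exists c.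
  by move: A0; rewrite AT probability_setT => /eqP; rewrite onee_eq0.
have [e|ne] := pselect (exists s, cofinal S s); last first.
  have [a Sa da] := bounded_support S0 ne mA dA.
  by rewrite (@lim_density_coherent a)//; have [_ + _] := thP Sa; apply.
rewrite /lim_density; case: pselect => // ?; case: pselect => // {}e.
case: (cid e) => s [sS sle sc] /= x /(_ 0%N)[k /(_ k (leqnn _))].
have [_ + _] := thP (sS k); apply; [by apply: measurable_cprob_lt; exact: measurableC|exact: dep_on_cprob_lt|].
rewrite (_ : [set y | _] = [set y | (0 < cprob R (below (s k)) A y)%E]).
  exact: null_cprob.
by apply/seteqP; split=> y /=; have [p [-> ->]] := cprobC (below (s k)) y mA;
  rewrite !lte_fin invr1; lra.
Qed.

Lemma lim_density_ae A : measurable A -> dep_on S A ->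
  mu.-negligible (A `+` lim_density S th A).
Proof.
move=> mA dA.
have [S0|S0] := pselect (S !=set0); last first.
  rewrite /lim_density; case: pselect => // ?; rewrite setYK; exact: negligible_set0.
have [e|ne] := pselect (exists s, cofinal S s); last first.
  have [a Sa da] := bounded_support S0 ne mA dA.
  by rewrite (@lim_density_coherent a)//; have [+ _ _] := thP Sa; apply.
rewrite /lim_density; case: pselect => // ?; case: pselect => // {}e.
case: (cid e) => s [sS sle sc] /=.
set L := fun i m => [set y | (cprob R (below (s i)) (~` A) y < m.+1%:R^-1%:E)%E].
have nL i m : mu.-negligible (L i m `+` th (s i) (L i m)).
  by have [+ _ _] := thP (sS i); apply; [by apply: measurable_cprob_lt; exact: measurableC|exact: dep_on_cprob_lt].
have nd i j : (i <= j)%N -> below (s i) `<=` below (s j).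
  by move=> ij c /= ci; exact: wle_trans (sle _ _ ij).
have dU (B : set (bits J)) : dep_on S B -> dep_on (\bigcup_i below (s i)) B.
  by apply: dep_onS => c /sc [i ci]; exists i.
pose Z (B : set (bits J)) m := B `&` \bigcap_k \bigcup_(i in [set i | (k <= i)%N])
    [set x | (m.+1%:R^-1%:E <= cprob R (below (s i)) (~` B) x)%E].
have nZ B m : measurable B -> dep_on S B -> mu.-negligible (Z B m).
  move=> mB dB; apply/negligibleP; last first.
    by apply: (levy_zero_one nd) => //; exact: dU.
  apply: measurableI => //; apply: bigcap_measurable => // k _.
  by apply: bigcup_measurable => i _; by apply: measurable_cprob_ge; exact: measurableC.
have nN : mu.-negligible (\bigcup_m (Z A m) `|` Z (~` A) 1%N `|`
    \bigcup_m \bigcup_i (L i m `+` th (s i) (L i m))).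
  apply: negligibleU; last by apply: negligible_bigcup => m; exact: negligible_bigcup.
  apply: negligibleU; last by apply: nZ; [exact: measurableC|exact: dep_onC].
  by apply: negligible_bigcup => m; exact: nZ.
apply: negligibleS nN => x; apply: contraPP => nN.
have LE i m : L i m x <-> th (s i) (L i m) x.
  split=> h; apply: contrapT => h'; apply: nN; right; exists m => //; exists i => //;
    rewrite setY_def; first [by left|by right].
have event B m : ~ Z B m x -> B x -> exists k, forall i, (k <= i)%N ->
    (cprob R (below (s i)) (~` B) x < m.+1%:R^-1%:E)%E.
  move=> nZx Bx; apply: contrapT => /forallNP h; apply: nZx; split=> // k _.
  apply: contrapT => h'; apply: (h k) => i ki; rewrite ltNge; apply/negP => h2.
  by apply: h'; exists i.
rewrite setY_def => -[[Ax]|[+ nAx]].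
  apply => m; have [|k hk] := event A m _ Ax.
    by move=> Zx; apply: nN; left; left; exists m.
  by exists k => i ki; apply/LE; exact: hk.
(* Index 1 is the threshold 1/2: the conditional probabilities of [A] and of its complement cannot
   both be below it. *)
move=> /(_ 1%N)[k hk].
have [|l hl] := event (~` A) 1%N _ nAx.
  by move=> Zx; apply: nN; left; right.
have /LE := hk _ (leq_maxl k l); have := hl _ (leq_maxr k l).
rewrite setCK /L/=.
have [p [-> ->]] := cprobC (below (s (maxn k l))) x mA.
by rewrite !lte_fin; lra.
Qed.

Lemma lim_densityP : is_density S (lim_density S th).
Proof.
split; [exact: lim_density_ae|exact: lim_density_null|exact: lim_density_sub].
Qed.

End limit.
End lower_density.

Section density_exists.
Context (J : choiceType) (R : realType).
Implicit Types (A B C : set (bits J)) (x y : bits J) (b c : J).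
Local Notation mu := (coin J R).
Local Notation operator := (set (bits J) -> set (bits J)).

(** Successor step: freeze the coin [c] at its actual value and take the density of the resulting
    event in the earlier coins. By [null_upd], freezing keeps null sets null. *)
Definition coord_density c (D : operator) : operator :=
  fun A => [set x | D [set y | A (upd y c (x c))] x].

Definition density_step c (rec : forall b, wlt b c -> operator) : operator :=
  coord_density c (lim_density R [set b | wlt b c]
    (fun b => if pselect (wlt b c) is left h then rec b h else id)).

Definition density_below : J -> operator :=
  Fix (@wlt_wf J) (fun=> operator) density_step.

Lemma density_belowE c : density_below c =
  coord_density c (lim_density R [set b | wlt b c] density_below).
Proof.
rewrite /density_below Fix_eq.
  rewrite {1}/density_step; congr coord_density; apply: eq_lim_density => b /= bc.
  by case: pselect.
move=> c' f g fg; rewrite /density_step; congr coord_density.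
apply: eq_lim_density => b /= bc; case: pselect => // h; exact: fg.
Qed.

Lemma coord_densityP c D : is_density R [set b | wlt b c] D ->
  is_density R (below c) (coord_density c D).
Proof.
move=> [ae nl sb].
have dA (b : bool) A : dep_on (below c) A -> dep_on [set b | wlt b c] [set y | A (upd y c b)].
  move=> dA x y xy /=; apply: dA => j /= jc; rewrite /upd.
  case: eqVneq => // jNc; apply: xy; rewrite /= /wlt jNc; exact: jc.
split.
- move=> A mA /dA dA'.
  apply: (@negligibleS _ _ _ _ (\bigcup_(b in [set: bool])
      ([set y | A (upd y c b)] `+` D [set y | A (upd y c b)]))).
    by move=> x; rewrite setY_def => -[[Ax nD]|[Dx nA]]; exists (x c) => //;
      rewrite setY_def; [left|right]; split; rewrite //= upd_id.
  rewrite (_ : \bigcup_(b in _) _ =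
      ([set y | A (upd y c true)] `+` D [set y | A (upd y c true)]) `|`
      ([set y | A (upd y c false)] `+` D [set y | A (upd y c false)])).
    by apply: negligibleU; apply: ae => //; exact: measurable_preimage_upd.
  apply/seteqP; split=> x; first by move=> [[] _ h]; [left|right].
  by move=> [h|h]; [exists true|exists false].
- move=> A mA dA' A0 x /=; apply: nl; [exact: measurable_preimage_upd|exact: dA|].
  exact: null_upd.
- move=> A B C mA mB mC dA' dB' dC' ABC x /= [Ax Bx].
  move: (conj Ax Bx); apply: (sb _ _ _ _ _ _ _ _ _ _ x);
    try exact: measurable_preimage_upd; try exact: dA.
  apply: (@null_upd _ _ c (x c) ((A `&` B) `\` C)) => //.
  by apply: measurableD => //; exact: measurableI.
Qed.

(** The two halves share one induction: the limit of the earlier densities is a density because they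
    are coherent, and coherence at [c] holds because this limit extends them and freezing [c] does
    not affect an event determined below [b]. *)
Lemma density_belowP c :
  is_density R (below c) (density_below c) /\
  forall b A, wle b c -> measurable A -> dep_on (below b) A ->
    density_below c A = density_below b A.
Proof.
elim/(well_founded_ind (@wlt_wf J)): c => c IH.
have Sdown b b' : wlt b' c -> wle b b' -> wlt b c.
  by move=> b'c bb'; exact: wle_lt_trans b'c.
have thP b : [set b | wlt b c] b -> is_density R (below b) (density_below b).
  by move=> /IH[].
have thC : coherent [set b | wlt b c] density_below.
  by move=> b b' _ /IH[_ h] bb' A mA dA; exact: h.
split; first by rewrite density_belowE; apply: coord_densityP; exact: lim_densityP.
move=> b A bc mA dA; have [->//|bNc] := eqVneq b c.
have bc' : wlt b c by rewrite /wlt bNc.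
rewrite density_belowE -(lim_density_coherent R thC bc' mA dA) /coord_density.
have AE t : [set y | A (upd y c t)] = A.
  by apply/seteqP; split=> y; apply: dA => j /= jb; rewrite /upd;
    case: eqVneq => // jc; move: bc'; rewrite wltNge -jc jb.
apply/funext => x.
exact: (congr1 (fun B => lim_density R [set b | wlt b c] density_below B x) (AE (x c))).
Qed.

Theorem density_exists : exists D, is_density R [set: J] D.
Proof.
exists (lim_density R setT density_below); apply: lim_densityP => //.
- by move=> b _; case: (density_belowP b).
- by move=> b c _ _ bc A mA dA; have [_] := density_belowP c; apply.
Qed.

End density_exists.

(** * Randomization *)

Section coin_independence.
Context (J : choiceType) (R : realType).
Local Notation mu := (coin J R).

Lemma coin_indep (S : set J) (A B : set (bits J)) : measurable A -> measurable B ->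
  dep_on S A -> dep_on (~` S) B -> mu (A `&` B) = (mu A * mu B)%E.
Proof.
move=> mA mB dA dB; rewrite -(@coin_mix _ R S); last exact: measurableI.
rewrite -product_measure1E//; congr (product_measure1 _ _ _).
have E1 x y : A (mix S x y) = A x.
  by apply: (dep_onE dA) => c Sc; rewrite /mix asboolT.
have E2 x y : B (mix S x y) = B y.
  by apply: (dep_onE dB) => c Sc; rewrite /mix asboolF.
by apply/seteqP; split=> -[x y] /=; rewrite /mix_pair /= E1 E2.
Qed.

End coin_independence.

Section randomization.
Context (R : realType).
Local Notation mu := (coin nat R).

Definition first_head (j : nat) : set (bits nat) :=
  [set b : bits nat | b j /\ forall i, (i < j)%N -> b i = false].

Definition no_head (j : nat) : set (bits nat) :=
  [set b : bits nat | forall i, (i < j)%N -> b i = false].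

Lemma measurable_no_head j : measurable (no_head j).
Proof.
rewrite (_ : no_head j = \bigcap_(i in [set i | (i < j)%N]) [set b : bits nat | b i = false]).
  by apply: fin_bigcap_measurable => [|i _]; [exact: finite_II|exact: measurable_coordb].
by apply/seteqP; split=> b h i; exact: h.
Qed.

Lemma first_headE j : first_head j = no_head j `&` [set b : bits nat | b j = true].
Proof. by apply/seteqP; split=> b [h1 h2]; exact: (conj h2 h1). Qed.

Lemma measurable_first_head j : measurable (first_head j).
Proof.
by rewrite first_headE; apply: measurableI; [exact: measurable_no_head|exact: measurable_coordb].
Qed.

Let no_head_step j t : pr mu (no_head j `&` [set b : bits nat | b j = t]) = pr mu (no_head j) * 2^-1.
Proof.
have m1 := measurable_no_head j; have m2 := @measurable_coordb nat j t.
apply: EFin_inj; rewrite EFinM -[in RHS](@coin_coordb nat R j t) -!prE//; last exact: measurableI.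
apply: (@coin_indep _ _ [set i | (i < j)%N]) => //.
  by move=> x y xy h i ij; rewrite -xy//; exact: h.
by move=> x y xy /= <-; rewrite xy//= ltnn.
Qed.

Lemma pr_no_head j : pr mu (no_head j) = 2^-1 ^+ j.
Proof.
elim: j => [|j IH].
  by rewrite (_ : no_head 0 = setT) ?prT ?expr0//; apply/seteqP; split.
rewrite exprSr -IH -(no_head_step j false); congr pr; apply/seteqP; split=> b.
  by move=> h; split=> [i ij|]; apply: h => //; exact: ltnW.
by move=> [h bj] i; rewrite ltnS leq_eqVlt => /orP[/eqP ->|/h].
Qed.

Lemma pr_first_head j : pr mu (first_head j) = 2^-1 ^+ j.+1.
Proof. by rewrite first_headE no_head_step pr_no_head exprSr. Qed.

Lemma half_expr_lt (e : R) : 0 < e -> exists j, 2^-1 ^+ j < e.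
Proof.
move=> e0; exists (Num.truncn e^-1).+1; set j := _.+1.
rewrite exprVn invf_plt ?posrE// ?exprn_gt0//.
apply: (lt_trans (truncnS_gt _)); rewrite -/j -natrX ltr_nat.
exact: ltn_expl.
Qed.

Section halving.
Context d (V : measurableType d).
Implicit Types (m n : {charge set V -> \bar R}) (A E : set V).

Definition between m n := forall A, measurable A -> (0 <= n A)%E /\ (n A <= m A)%E.

(** One binary digit of the density of [n] with respect to [m]. The digit is 1 on the positive part
    [E] of a Hahn decomposition of [2n - m]; the remainder [n'], which is [2n - m] on [E] and [2n]
    elsewhere, again lies between 0 and [m]. *)
Lemma charge_halving m n : between m n -> exists E, exists n' : {charge set V -> \bar R},
  [/\ measurable E, between m n' &
      forall A, measurable A -> (fine (n A) = 2^-1 * fine (m (A `&` E)) + 2^-1 * fine (n' A))%R].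
Proof.
move=> mn.
pose l : {charge set V -> \bar R} := cadd (cscale 2 n) (cscale (-1) m).
have [P [N [[mP pP] [mN nN] PNT PN0]]] := Hahn_decomposition l.
pose n' : {charge set V -> \bar R} := cadd (cscale 2 n) (cscale (-1) (crestr m mP)).
have fn (k : {charge set V -> \bar R}) A : measurable A -> k A = (fine (k A))%:E :> \bar R.
  by move=> mA; rewrite fineK//; exact: (@fin_num_measure _ _ _ k).
exists P, n'.
have lE A : measurable A -> l A = (2 * fine (n A) - fine (m A))%:E.
  move=> mA; transitivity (2%:E * n A + (-1)%:E * m A)%E => //.
  by rewrite {1}(fn n A mA) {1}(fn m A mA) -!EFinM mulN1r.
have n'E A : measurable A -> n' A = (2 * fine (n A) - fine (m (A `&` P)))%:E.
  move=> mA; transitivity (2%:E * n A + (-1)%:E * m (A `&` P))%E => //.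
  by rewrite {1}(fn n A mA) {1}(fn m (A `&` P) (measurableI _ _ mA mP)) -!EFinM mulN1r.
split=> //; last by move=> A mA; rewrite n'E//=; lra.
move=> A mA.
have mAP : measurable (A `&` P) by exact: measurableI.
have mAN : measurable (A `&` N) by exact: measurableI.
have nsplit (k : {charge set V -> \bar R}) : fine (k A) = fine (k (A `&` P)) + fine (k (A `&` N)) :> R.
  rewrite (charge_partition k mA mP mN PNT PN0) fineD//; exact: (@fin_num_measure _ _ _ k).
have h1 := pP _ mAP (@subIsetr _ A P); have h2 := nN _ mAN (@subIsetr _ A N).
rewrite lE// lee_fin in h1; rewrite lE// lee_fin in h2.
have [h3 h4] := mn _ mAP; have [h5 h6] := mn _ mAN.
rewrite (fn n)// lee_fin in h3; rewrite (fn n)// lee_fin in h5.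
rewrite (fn n)// (fn m)// lee_fin in h4; rewrite (fn n)// (fn m)// lee_fin in h6.
rewrite n'E//; split; first by rewrite lee_fin (nsplit n); lra.
by rewrite (fn m A mA) lee_fin (nsplit n) (nsplit m); lra.
Qed.

(* The [j]-th set is read off when the first head occurs at time [j]:
   this amounts to revealing the binary digits of the density. *)
Lemma randomization (m : probability V R) n :
  (forall A, measurable A -> (0 <= n A)%E /\ (n A <= m A)%E) ->
  exists2 E : set (V * bits nat), measurable E & forall A, measurable A ->
    n A = (m \x mu)%E (E `&` (A `*` setT)).
Proof.
move=> mn.
pose mc := charge_of_finite_measure m.
pose st := {k : {charge set V -> \bar R} | between mc k}.
have nextP (s : st) : exists p : set V * st, measurable p.1 /\
    forall A, measurable A -> fine (sval s A) = 2^-1 * fine (m (A `&` p.1)) + 2^-1 * fine (sval p.2 A).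
  case: s => k kb; have [E [k' [mE bk' kE]]] := charge_halving kb.
  by exists (E, exist _ k' bk').
pose s := fix s j : st := if j is j'.+1 then (sval (cid (nextP (s j')))).2 else exist _ n mn.
pose E j := (sval (cid (nextP (s j)))).1.
have mE j : measurable (E j) by case: (svalP (cid (nextP (s j)))).
have sE j A : measurable A ->
    fine (sval (s j) A) = 2^-1 * fine (m (A `&` E j)) + 2^-1 * fine (sval (s j.+1) A).
  by move=> mA; case: (svalP (cid (nextP (s j)))) => _; apply.
pose G j := E j `*` first_head j.
have mG j : measurable (G j) by apply: measurableX => //; exact: measurable_first_head.
have mU : measurable (\bigcup_j G j) by exact: bigcupT_measurable.
exists (\bigcup_j G j) => // A mA.
pose p : probability (V * bits nat)%type R := (m \x mu)%E.
pose H i := G i `&` (A `*` setT).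
pose F j := \big[setU/set0]_(i < j) H i.
have mAT : measurable (A `*` [set: bits nat]) by exact: measurableX.
have mGA j : measurable (H j) by exact: measurableI.
have mF j : measurable (F j) by exact: bigsetU_measurable.
have prG j : pr p (H j) = fine (m (A `&` E j)) * 2^-1 ^+ j.+1.
  have -> : H j = (A `&` E j) `*` first_head j.
    by apply/seteqP; split=> -[x b] /=; [move=> [[]] ? ? []|move=> [[]]].
  have mAE : measurable (A `&` E j) by exact: measurableI.
  rewrite /pr /p/= product_measure1E//; last exact: measurable_first_head.
  by rewrite -pr_first_head fineM//; apply: fin_num_measure => //; exact: measurable_first_head.
have dF j : [disjoint F j & H j].
  apply/disj_setPS => -[x b] [+ [[_ [/= _ bj]] _]].
  by rewrite /F -bigcup_mkord => -[i /= ij [[_ [/=]]]]; rewrite bj.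
(* The first [j] digits are accounted for by [F j]; the remainder is at most [m A], hence at most 1,
   and carries the weight [2^-j]. *)
have nF j : fine (n A) = pr p (F j) + 2^-1 ^+ j * fine (sval (s j) A).
  elim: j => [|j IH]; first by rewrite /F big_ord0 /pr measure0 expr0 mul1r add0r.
  have -> : F j.+1 = F j `|` H j by rewrite /F big_ord_recr.
  rewrite (prUD _ (mF j) (mGA j) (dF j)) prG IH (sE j)// exprS; ring.
have UF : \bigcup_j F j = (\bigcup_j G j) `&` (A `*` setT).
  apply/seteqP; split=> x; last first.
    by move=> [[j _ Gx] Ax]; exists j.+1 => //; rewrite /F big_ord_recr/=; right.
  by move=> [j _]; rewrite /F -bigcup_mkord => -[i _ [Gx Ax]]; split=> //; exists i.
have ndF : nondecreasing_seq F.
  by move=> i j ij; apply/subsetPset; exact: subset_bigsetU.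
have mUA : measurable ((\bigcup_j G j) `&` (A `*` setT)) by exact: measurableI.
have fnA : n A = (fine (n A))%:E by rewrite fineK//; exact: (@fin_num_measure _ _ _ n).
rewrite fnA -/p (prE p mUA); congr (_%:E); apply/eqP; rewrite eq_le; apply/andP; split.
  apply/ler_addgt0Pr => e e0.
  have [j hj] := half_expr_lt e0.
  rewrite (nF j); apply: lerD; first by apply: pr_le => //; rewrite -UF; exact: bigcup_sup.
  apply: le_trans (ltW hj); rewrite -[leRHS]mulr1.
  apply: ler_wpM2l; first by rewrite exprn_ge0// invr_ge0.
  have [h1 h2] := svalP (s j) _ mA.
  rewrite -lee_fin fineK; last exact: (@fin_num_measure _ _ _ (sval (s j))).
  by apply: (le_trans h2); exact: probability_le1.
apply/ler_addgt0Pr => e e0; rewrite -UF.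
have [j hj] := pr_cvg p mF ndF e0.
have mUF : measurable (\bigcup_j F j) by rewrite UF.
rewrite (prID p mUF (mF j)) setIidr; last exact: bigcup_sup.
apply: lerD => //; rewrite (nF j) lerDl mulr_ge0 ?exprn_ge0 ?invr_ge0//.
by rewrite fine_ge0//; case: (svalP (s j) _ mA).
Qed.
End halving.
End randomization.

(** * Exchangeable arrays *)

Section array_data.
Context (R : realType) (n : nat) (d : measure_display) (Omega : measurableType d)
  (P : probability Omega R) (dT : measure_display) (T : measurableType dT)
  (X : random_array n P T) (X_exch : exchangeable X).
Implicit Types (B : set T) (w : Omega).

(* Empty when [c.1] does not have size [n] or [c.2] is not measurable. *)
Definition array_event (c : {fset nat} * set T) : set Omega :=
  [set w | exists h : #|` c.1| == n, measurable c.2 /\ c.2 (X (exist _ c.1 h) w)].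

Lemma array_eventE (i : nsubset n) B : measurable B ->
  array_event (sval i, B) = X i @^-1` B.
Proof.
case: i => e h mB; apply/seteqP; split=> w /=; last by exists h.
by move=> [h' [_]]; rewrite (bool_irrelevance h' h).
Qed.

Lemma array_event_bad c : ~ (#|` c.1| == n /\ measurable c.2) -> array_event c = set0.
Proof. by move=> bad; rewrite -subset0 => w [h [mB _]]; apply: bad. Qed.

Lemma measurable_array_event c : measurable (array_event c).
Proof.
have [[h mB]|bad] := pselect (#|` c.1| == n /\ measurable c.2); last first.
  by rewrite array_event_bad.
case: c h mB => e B /= h mB; rewrite (array_eventE (exist _ e h))//.
by rewrite -[X in measurable X]setTI; exact: measurable_funPT.
Qed.

(** Exchangeability is applied to the hypergraph on the vertices occurring in [F], each edge
    carrying the intersection of all the sets that [F] attaches to it. A coordinate of wrong size or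
    with a nonmeasurable set makes both sides empty, because [f] preserves cardinalities. *)
Lemma array_event_exchange (F : {fset {fset nat} * set T}) (f : nat -> nat) :
  {in [pred i | [exists c : F, i \in (val c).1]] &, injective f} ->
  P (\bigcap_(c in [set` F]) array_event c) =
  P (\bigcap_(c in [set` F]) array_event ([fset f i | i in c.1]%fset, c.2)).
Proof.
move=> finj.
have fin c : c \in F -> {in c.1 &, injective f}.
  move=> cF i j ic jc; apply: finj; rewrite inE; apply/existsP;
    by exists [` cF]%fset.
have cardf c : c \in F -> #|` [fset f i | i in c.1]%fset| = #|` c.1|.
  by move=> cF; rewrite card_in_imfset//; exact: fin.
have [good|/existsNP[c /not_implyP[cF bad]]] :=
  pselect (forall c, c \in F -> #|` c.1| == n /\ measurable c.2); last first.
  have -> : \bigcap_(c in [set` F]) array_event c = set0.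
    by rewrite -subset0 => w /(_ c cF); rewrite array_event_bad.
  suff -> : \bigcap_(c in [set` F]) array_event ([fset f i | i in c.1]%fset, c.2) = set0 by [].
  by rewrite -subset0 => w /(_ c cF); rewrite array_event_bad//= cardf.
pose M := (\bigcup_(c <- F) c.1)%fset.
have MP c : c \in F -> (c.1 `<=` M)%fset.
  by move=> cF; apply: bigfcup_sup.
pose ev (e : {e : {set M} | #|e| == n}) := [set t | forall c, c \in F ->
  c.1 = [fset val i | i in sval e]%fset -> c.2 t].
have mev e : measurable (ev e).
  rewrite (_ : ev e = \bigcap_(c in [set` [fset c in F | c.1 == [fset val i | i in sval e]%fset]%fset]) c.2).
    apply: fin_bigcap_measurable => [|c /=]; first exact: finite_fset.
    by rewrite !inE/= => /andP[cF _]; case: (good _ cF).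
  apply/seteqP; split=> t h c /=; last by move=> cF ce; apply: h; rewrite /= !inE cF ce eqxx.
  by rewrite !inE/= => /andP[cF /eqP]; exact: h.
pose H := EventHypergraph mev.
have gi : injective (fun i : M => f (val i)).
  move=> i j /finj; rewrite !inE => h; apply: val_inj; apply: h.
    have /bigfcupP[c /andP[cF _] ic] := valP i.
    by apply/existsP; exists [` cF]%fset.
  have /bigfcupP[c /andP[cF _] jc] := valP j.
  by apply/existsP; exists [` cF]%fset.
have imE (c : {fset nat} * set T) : c \in F -> exists e : {e : {set M} | #|e| == n},
    c.1 = [fset val i | i in sval e]%fset.
  move=> cF; pose e : {set M} := [set i | val i \in c.1]%SET.
  have eE : c.1 = [fset val i | i in e]%fset.
    apply/fsetP => i; apply/idP/imfsetP => [ic|[j /=]]; last by rewrite inE => ? ->.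
    by exists [` fsubsetP (MP _ cF) _ ic]%fset => //=; rewrite inE.
  have he : #|e| == n.
    have [/eqP <- _] := good _ cF; rewrite eE eq_sym.
    exact: (@card_imfset_set M val #|e| e val_inj (eqxx _)).
  by exists (exist _ e he).
have hyp (g : M -> nat) (gj : injective g) (h : nat -> nat) : (forall i, g i = h (val i)) ->
    hypergraph_event (H := H) gj X =
    \bigcap_(c in [set` F]) array_event ([fset h i | i in c.1]%fset, c.2).
  move=> gh.
  have imgE (e : {e : {set M} | #|e| == n}) :
      sval (image_nsubset gj e) = [fset h i | i in [fset val i | i in sval e]]%fset.
    apply/fsetP => i; apply/imfsetP/imfsetP => [[j /= je ->]|[_ /imfsetP[j /= je ->] ->]].
      by exists (val j); rewrite ?gh//; apply/imfsetP; exists j.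
    by exists j; rewrite ?gh.
  apply/seteqP; split=> w.
    move=> hw c cF /=; have [e ce] := imE _ cF.
    have [_ mc] := good _ cF.
    by rewrite ce -imgE array_eventE//=; exact: hw.
  move=> hw e c cF ce; have := hw c cF; have [_ mc] := good _ cF.
  by rewrite /= ce -imgE array_eventE.
rewrite -(hyp _ gi f)// -(X_exch (H := H) (val_inj (sT := M)) gi) (hyp _ _ id)//.
by congr (P _); apply: eq_bigcapr => -[e B] _ /=; rewrite imfset_id.
Qed.

End array_data.

Definition relabel (I J : Type) (f : I -> J) (x : bits J) : bits I := fun c => x (f c).

Lemma measurable_relabel (I J : choiceType) (f : I -> J) :
  measurable_fun setT (relabel f).
Proof. by apply: measurable_bits => c; exact: measurable_coord. Qed.

HB.instance Definition _ (I J : choiceType) (f : I -> J) :=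
  isMeasurableFun.Build _ _ _ _ (relabel f) (measurable_relabel f).

Lemma measurable_preimage_relabel (I J : choiceType) (f : I -> J) (A : set (bits I)) :
  measurable A -> measurable (relabel f @^-1` A).
Proof. by move=> mA; rewrite -[X in measurable X]setTI; exact: measurable_relabel. Qed.

Definition dep_fst (J : Type) d (V : measurableType d) (S : set J) (Z : set (bits J * V)) :=
  forall x y v, (forall c, S c -> x c = y c) -> Z (x, v) -> Z (y, v).

Section product_law.
Context d1 d2 d3 (T1 : measurableType d1) (T2 : measurableType d2)
  (T3 : measurableType d3) (R : realType).

Definition map_fst (f : T1 -> T2) (p : T1 * T3) : T2 * T3 := (f p.1, p.2).

Lemma measurable_map_fst (f : T1 -> T2) : measurable_fun setT f ->
  measurable_fun setT (map_fst f).
Proof.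
move=> mf; apply: measurable_fun_pair; last exact: measurable_snd.
exact: measurableT_comp mf measurable_fst.
Qed.

Lemma eq_product_measure (m1 m2 : probability T1 R) (m : probability T3 R) :
  (forall A, measurable A -> m1 A = m2 A) ->
  forall A, measurable A -> (m1 \x m)%E A = (m2 \x m)%E A.
Proof.
move=> m12 A mA; apply: product_measure_unique => // B C mB mC.
transitivity (m2 B * m C)%E; first exact: product_measure1E.
by congr (_ * _)%E; exact/esym/m12.
Qed.

Lemma product_distribution (m1 : probability T1 R) (m : probability T3 R)
    (f : {mfun T1 >-> T2}) A : measurable A ->
  (distribution m1 f \x m)%E A = (m1 \x m)%E (map_fst f @^-1` A).
Proof.
have mf := measurable_map_fst (@measurable_funPT _ _ _ _ f).
pose g : {mfun (T1 * T3)%type >-> (T2 * T3)%type} :=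
  HB.pack (map_fst f) (isMeasurableFun.Build _ _ _ _ _ mf).
move: A; apply: (@product_measure_unique _ _ _ _ _ _ _ (distribution (m1 \x m)%E g)).
move=> B C mB mC; transitivity ((m1 \x m)%E ((f @^-1` B) `*` C)) => //.
rewrite product_measure1E//.
by rewrite -[X in measurable X]setTI; exact: measurable_funPT.
Qed.

End product_law.

Section data.
Context (R : realType) (n : nat) (d : measure_display) (Omega : measurableType d)
  (P : probability Omega R) (dT : measure_display) (T : measurableType dT)
  (X : random_array n P T) (X_exch : exchangeable X).

(* Even indices are the visible vertices, odd indices form a hidden infinite
   reservoir; the array indexed by the visible ones has the law of [X]. *)
Definition enc (s a : {fset nat}) : {fset nat} :=
  ([fset i.*2 | i in s] `|` [fset i.*2.+1 | i in a])%fset.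

Definition coord : choiceType := ({fset nat} * ({fset nat} * set T))%type.

Definition enc_coord (c : coord) : {fset nat} * set T := (enc c.1 c.2.1, c.2.2).

Definition data (w : Omega) : bits coord :=
  fun c => `[< array_event X (enc_coord c) w >].

Lemma data_coord c : [set w | data w c] = array_event X (enc_coord c).
Proof. by apply/seteqP; split=> w /asboolP. Qed.

Lemma measurable_data : measurable_fun setT data.
Proof.
by apply: measurable_bits => c; rewrite data_coord; exact: measurable_array_event.
Qed.

HB.instance Definition _ := isMeasurableFun.Build _ _ _ _ data measurable_data.

Definition law : probability (bits coord) R := distribution P data.

Lemma law_cyl F : law (cyl F) = P (\bigcap_(c in [set` F]) array_event X (enc_coord c)).
Proof.
rewrite /law /distribution /pushforward; congr (P _).
by apply/seteqP; split=> w h c cF; [rewrite -data_coord; exact: h|apply/asboolP; exact: h].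
Qed.

(** Injectivity is restricted to the vertices that [F] uses: a map sending vertices to fresh
    positions may collide elsewhere. *)
Definition moved_by (f : nat -> nat) (phi : coord -> coord) (F : {fset coord}) :=
  {in [pred i | [exists c : F, i \in (enc_coord (val c)).1]] &, injective f} /\
  forall c, c \in F -> enc_coord (phi c) = ([fset f i | i in (enc_coord c).1]%fset, c.2.2).

Lemma law_moved f phi F : moved_by f phi F ->
  law (relabel phi @^-1` cyl F) = law (cyl F).
Proof.
move=> [fi fE]; rewrite law_cyl.
pose F' := [fset enc_coord c | c in F]%fset.
have bigE (g : {fset nat} * set T -> set Omega) :
    \bigcap_(c in [set` F']) g c = \bigcap_(c in [set` F]) g (enc_coord c).
  apply/seteqP; split=> w h c cF; first by apply: h => /=; apply/imfsetP; exists c.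
  by have /imfsetP[c' /= c'F ->] := cF; exact: h.
rewrite -bigE (@array_event_exchange _ _ _ _ _ _ _ _ X_exch F' f); last first.
  move=> i j; rewrite !inE => /existsP[ci ici] /existsP[cj jcj].
  apply: fi; rewrite inE; apply/existsP.
    by have /imfsetP[c /= cF cE] := valP ci; exists [` cF]%fset; move: ici; rewrite (cE : val ci = _).
  by have /imfsetP[c /= cF cE] := valP cj; exists [` cF]%fset; move: jcj; rewrite (cE : val cj = _).
rewrite bigE /law /distribution /pushforward; congr (P _).
apply/seteqP; split=> w h c cF; have := h c cF; rewrite /= /relabel.
  by move/asboolP; rewrite fE.
by rewrite -fE// => ?; apply/asboolP.
Qed.

(** Exchangeability concerns finitely many coordinates at a time, so the image laws are compared on
    cylinders; [mask S] makes a cylinder that leaves [S] empty on both sides. *)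
Lemma law_relabel (S : set coord) phi :
  (forall F : {fset coord}, [set` F] `<=` S -> exists f, moved_by f phi F) ->
  forall A, measurable A ->
    distribution law (mask S) A = distribution law (mask S \o relabel phi) A.
Proof.
move=> h; apply: bits_measure_unique; first exact: (le_lt_trans (probability_le1 _ _) (ltry _)).
move=> F; rewrite /distribution /pushforward.
have [FS|/existsNP[c /not_implyP[cF nSc]]] := pselect ([set` F] `<=` S).
  have [f fF] := h F FS.
  have mE : mask S @^-1` cyl F = cyl F.
    by apply: preimage_mask; apply: dep_onS FS _; exact: dep_on_cyl.
  transitivity (law (cyl F)); first exact: (congr1 law mE).
  rewrite -(law_moved fF).
  exact: (congr1 (fun A => law (relabel phi @^-1` A)) (esym mE)).
have m0 : mask S @^-1` cyl F = set0.
  by rewrite -subset0 => x /(_ c cF); rewrite /mask asboolF.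
transitivity (law set0); first exact: (congr1 law m0).
exact: (congr1 (fun A => law (relabel phi @^-1` A)) (esym m0)).
Qed.

Local Notation mu := (coin nat R).
Local Notation law_noise := (law \x mu)%E.

Lemma law_noise_relabel (S : set coord) phi :
  (forall F : {fset coord}, [set` F] `<=` S -> exists f, moved_by f phi F) ->
  forall Z, measurable Z -> dep_fst S Z ->
  law_noise Z = law_noise (map_fst (relabel phi) @^-1` Z).
Proof.
move=> h Z mZ dZ.
have ZE : map_fst (mask S) @^-1` Z = Z.
  by apply/seteqP; split=> -[x b]; apply: dZ => c Sc; rewrite mask_id.
rewrite -[in LHS]ZE -[in RHS]ZE.
rewrite -(@product_distribution _ _ _ _ _ _ _ law mu (mask S))//.
rewrite (eq_product_measure _ (law_relabel h))//.
by rewrite product_distribution.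
Qed.

End data.

Section approximate_fst.
Context (J : choiceType) (R : realType).
Variable Q : probability (bits J * bits nat)%type R.

Let join (p : bits J * bits nat) : bits (J + nat)%type :=
  fun s => match s with inl c => p.1 c | inr i => p.2 i end.

Let split (y : bits (J + nat)%type) : bits J * bits nat :=
  (relabel inl y, relabel inr y).

Let measurable_join : measurable_fun setT join.
Proof.
apply: measurable_bits => -[c|i] /=.
  rewrite -[X in measurable X]setTI.
  exact: (@measurable_fst _ _ (bits J) (bits nat) measurableT _ (measurable_coord c)).
rewrite -[X in measurable X]setTI.
exact: (@measurable_snd _ _ (bits J) (bits nat) measurableT _ (measurable_coord i)).
Qed.

Let measurable_split : measurable_fun setT split.
Proof. by apply: measurable_fun_pair; exact: measurable_relabel. Qed.

HB.instance Definition _ := isMeasurableFun.Build _ _ _ _ join measurable_join.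

Lemma approximate_fst (S : set J) E (e : R) : measurable E -> dep_fst S E -> 0 < e ->
  exists F : {fset J}, exists E', [/\ measurable E', [set` F] `<=` S,
    dep_fst [set` F] E' & pr Q (E `+` E') <= e].
Proof.
move=> mE dE e0.
pose S' : set (J + nat)%type := [set s | if s is inl c then S c else True].
have mE' : measurable (split @^-1` E) by rewrite -[X in measurable X]setTI; exact: measurable_split.
have dE' : dep_on S' (split @^-1` E).
  move=> x y xy; rewrite /split/= (_ : relabel inr y = relabel inr x).
    by apply: dE => c Sc; exact: xy.
  by apply/funext => i; rewrite /relabel xy.
have [F [B [mB FS dB]]] := @approximate _ _ (distribution Q join) _ _ _ mE' dE' e0.
have jE : join @^-1` (split @^-1` E) = E by apply/seteqP; split=> -[].
exists [fset c in pmap (fun s : J + nat => if s is inl c then Some c else None) F]%fset.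
exists (join @^-1` B).
have FP c : c \in [fset c in pmap (fun s : J + nat => if s is inl c then Some c else None) F]%fset
    <-> inl c \in F.
  rewrite inE/= mem_pmap; split=> [/mapP[[c'|//] cF [->//]]|cF].
  by apply/mapP; exists (inl c).
split.
- by rewrite -[X in measurable X]setTI; exact: measurable_join.
- by move=> c /= /FP; exact: (FS (inl c)).
- by move=> x y b xy; apply: dB => -[c|i]//= cF; apply: xy => /=; exact/FP.
- by rewrite -{1}jE.
Qed.

End approximate_fst.

(** * Conditional independence given the local data *)

Section conditional_independence.
Context (R : realType) (n : nat) (d : measure_display) (Omega : measurableType d)
  (P : probability Omega R) (dT : measure_display) (T : measurableType dT)
  (X : random_array n P T) (X_exch : exchangeable X).
Implicit Types (b c : coord T) (F : {fset coord T}).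
Local Notation coord := (coord T).
Local Notation mu := (coin nat R).
Local Notation law := (law X).
Local Notation law_noise := (law \x mu)%E.

Definition local c : set coord :=
  [set b | (b.1 `<` c.1)%fset \/ b.1 = c.1 /\ wlt b.2 c.2].

(** The section of [E] over [x] has, as measure, the conditional probability of [c] given the local
    data of [x]: deciding [c] by fresh noise falling in this section reproduces the joint law with
    the local data. *)
Definition is_kernel c (E : set (bits coord * bits nat)) :=
  [/\ measurable E, dep_fst (local c) E & forall A, measurable A -> dep_on (local c) A ->
    law (A `&` [set x | x c]) = law_noise (E `&` (A `*` setT))].

(** Restricting the law of the local data to the event that [c] occurs gives a measure dominated by
    that law, which is the situation of [randomization]. *)
Lemma kernel_exists c : exists E, is_kernel c E.
Proof.
pose L := local c.
have mc : measurable [set x : bits coord | x c] by exact: measurable_coord.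
pose nm' : {measure set (bits coord) -> \bar R} :=
  pushforward (mrestr law mc) (mask L).
pose nm := nm' (measurable_mask L).
have nmE A : nm A = law (mask L @^-1` A `&` [set x | x c]) by [].
have nm_le A : measurable A -> (nm A <= distribution law (mask L) A)%E.
  move=> mA; rewrite nmE; apply: le_measure; rewrite ?inE; last exact: subIsetl.
    by apply: measurableI => //; exact: measurable_preimage_mask.
  exact: measurable_preimage_mask.
have nm_fin : fin_num_fun nm.
  move=> A mA; rewrite ge0_fin_numE//; apply: le_lt_trans (nm_le _ mA) _.
  exact: le_lt_trans (probability_le1 _ _) (ltry _).
pose nu : {charge set _ -> \bar R} :=
  HB.pack (nm : set _ -> \bar R) (isCharge.Build _ _ _ _ (measure0 nm) nm_fin
    (@measure_semi_sigma_additive _ _ _ nm)).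
have [|E mE EP] := @randomization R _ _ (distribution law (mask L)) nu.
  by move=> A mA; split; [exact: measure_ge0|exact: nm_le].
exists (map_fst (mask L) @^-1` E); split.
- rewrite -[X in measurable X]setTI.
  exact: (measurable_map_fst (measurable_mask _)).
- move=> x y b xy; rewrite /map_fst/= (_ : mask L x = mask L y)//.
  by apply/funext => i; rewrite /mask; case: asboolP => //= /xy.
- move=> A mA dA; rewrite -{1}(preimage_mask dA) -nmE.
  transitivity ((distribution law (mask L) \x mu)%E (E `&` (A `*` setT))); first exact: EP.
  rewrite product_distribution; last by apply: measurableI => //; exact: measurableX.
  congr (product_measure1 _ _ _).
  by rewrite preimage_setI -[in RHS](preimage_mask dA).
Qed.

Section reservoir.
Variables (s : {fset nat}) (N : nat).

(** A visible vertex outside [s] moves to a hidden position from [N] on; these are free once [N]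
    exceeds the hidden vertices in use. *)
Definition hide_vertex (i : nat) : nat :=
  if odd i || (i./2 \in s) then i else (N + i./2).*2.+1.

Definition hide_coord c : coord :=
  ((c.1 `&` s)%fset, ((c.2.1 `|` [fset (N + i)%N | i in (c.1 `\` s)%fset])%fset, c.2.2)).

Lemma hide_coord_id c : (c.1 `<=` s)%fset -> hide_coord c = c.
Proof.
case: c => t [a B] /= ts; rewrite /hide_coord/=.
move/fsetIidPl: (ts) => ->; move: ts; rewrite -fsetD_eq0 => /eqP ->.
by rewrite imfset0 fsetU0.
Qed.

Lemma hide_coordE c : enc_coord (hide_coord c) =
  ([fset hide_vertex i | i in (enc_coord c).1]%fset, c.2.2).
Proof.
rewrite /enc_coord; congr (_, _); rewrite /=; apply/fsetP => i; apply/idP/imfsetP.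
  rewrite /enc inE => /orP[/imfsetP[j /=]|/imfsetP[j /=]].
    rewrite inE => /andP[jc js] ->; exists j.*2 => /=.
      by rewrite inE; apply/orP; left; apply/imfsetP; exists j.
    by rewrite /hide_vertex odd_double doubleK js.
  rewrite inE => /orP[ja ->|/imfsetP[k /=]].
    exists j.*2.+1; last by rewrite /hide_vertex/= odd_double.
    by rewrite /= inE; apply/orP; right; apply/imfsetP; exists j.
  rewrite inE => /andP[ks kc] -> ->; exists k.*2 => /=.
    by rewrite inE; apply/orP; left; apply/imfsetP; exists k.
  by rewrite /hide_vertex odd_double doubleK (negbTE ks).
move=> [j /=]; rewrite /enc !inE => /orP[] /imfsetP[k /= kc ->] ->; rewrite /hide_vertex.
  rewrite odd_double doubleK /=; case: ifPn => ks; apply/orP; [left|right].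
    by apply/imfsetP; exists k => //=; rewrite inE kc.
  apply/imfsetP; exists (N + k)%N => //=; rewrite inE; apply/orP; right.
  by apply/imfsetP; exists k => //=; rewrite inE ks.
rewrite /= odd_double /=; apply/orP; right; apply/imfsetP; exists k => //=.
by rewrite inE kc.
Qed.

Lemma moved_hide F : (forall c i, c \in F -> i \in c.2.1 -> (i < N)%N) ->
  moved_by hide_vertex hide_coord F.
Proof.
move=> FN; split; last by move=> c _; exact: hide_coordE.
have key i : [exists c : F, i \in (enc_coord (val c)).1] -> odd i -> (i./2 < N)%N.
  move=> /existsP[c]; rewrite /enc_coord/= /enc inE => /orP[] /imfsetP[j /= ji ->].
    by rewrite odd_double.
  by move=> _; rewrite /= uphalf_double; apply: FN ji; exact: valP.
move=> i j; rewrite !inE => /key ki /key kj; rewrite /hide_vertex.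
have half (k : nat) : k = (odd k + k./2.*2)%N by rewrite odd_double_half.
case: ifPn => [hi|/norP[oi si]]; case: ifPn => [hj|/norP[oj sj]] => //.
- move=> ij; have oi : odd i by rewrite ij /= odd_double.
  by have := ki oi; rewrite ij/= uphalf_double; lia.
- move=> ij; have oj : odd j by rewrite -ij /= odd_double.
  by have := kj oj; rewrite -ij/= uphalf_double; lia.
- move=> [] /double_inj /addnI ij.
  by rewrite (half i) (half j) (negbTE oi) (negbTE oj) ij.
Qed.

End reservoir.

(* [E] is approximated by a set that depends on finitely many local
   coordinates; hiding the vertices outside [c.1] among fresh hidden ones fixes
   these coordinates and makes [F] local. *)
Lemma kernel_global c E F : is_kernel c E ->
  (forall b, b \in F -> local c b \/ ~~ (c.1 `<=` b.1)%fset) ->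
  law (cyl F `&` [set x | x c]) = law_noise (E `&` (cyl F `*` setT)).
Proof.
move=> [mE dE EP] Fc.
have mF : measurable (cyl F) by exact: measurable_cyl.
have mc : measurable [set x : bits coord | x c] by exact: measurable_coord.
pose q : probability (bits coord * bits nat)%type R := law_noise.
have mX (A : set (bits coord)) : measurable A -> measurable (A `*` [set: bits nat]).
  by move=> mA; exact: measurableX.
have mI1 : measurable (cyl F `&` [set x | x c]) by exact: measurableI.
have mI2 : measurable (E `&` (cyl F `*` setT)) by apply: measurableI => //; exact: mX.
rewrite (prE law mI1) -/q (prE q mI2); congr (_%:E); apply/eqP.
rewrite -subr_eq0 -normr_le0; apply/ler_addgt0Pl => e e0; rewrite addr0.
have e20 : 0 < e / 2 by lra.
have [G [E' [mE' Gc dE' EE']]] := approximate_fst q mE dE e20.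
pose F0 := (F `|` (c |` G))%fset.
have [N FN] : exists N, forall b i, b \in F0 -> i \in b.2.1 -> (i < N)%N.
  exists (\max_(b <- enum_fset F0) \max_(i <- enum_fset b.2.1) i)%N.+1 => b i bF ib; rewrite ltnS.
  have h1 := @leq_bigmax_seq _ (enum_fset b.2.1) xpredT id i ib isT.
  have h2 := @leq_bigmax_seq _ (enum_fset F0) xpredT
    (fun b : coord => \max_(i <- enum_fset b.2.1) i)%N b bF isT.
  exact: leq_trans h1 h2.
pose phi := hide_coord c.1 N.
have mv H : (H `<=` F0)%fset -> exists f, moved_by f phi H.
  move=> HF; exists (hide_vertex c.1 N); apply: moved_hide => b i bH.
  by apply: FN; exact: (fsubsetP HF).
have phiL b : local c b -> phi b = b.
  move=> lb; apply: hide_coord_id; case: lb => [/fproper_sub//|[-> _]].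
  exact: fsubset_refl.
have phic : phi c = c by apply: hide_coord_id; exact: fsubset_refl.
have phiF b : b \in F -> local c (phi b).
  move=> bF; have [lb|] := Fc _ bF; first by rewrite phiL.
  move=> ncb; left; rewrite /phi/= fproperE fsubsetIr/=.
  by apply: contra ncb => /fsubset_trans; apply; exact: fsubsetIl.
pose A := relabel phi @^-1` cyl F.
have mA : measurable A by exact: measurable_preimage_relabel.
have dA : dep_on (local c) A.
  by move=> x y xy h b bF; rewrite /relabel -xy; [exact: h|exact: phiF].
(* The exchange fixes [c] and turns [cyl F] into the local event [A], to which the defining property
   of the kernel applies. *)
have E1 : law (cyl F `&` [set x | x c]) = law (A `&` [set x | x c]).
  have [f fv] := mv (F `|` [fset c])%fset
    ltac:(by apply/fsubsetP => b; rewrite !inE => /orP[->//|/eqP ->]; rewrite eqxx orbT).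
  have := law_moved X_exch fv; rewrite cylU cyl1 => <-; congr (law _).
  by apply/seteqP; split=> x [Ax xc]; split=> //; move: xc; rewrite /relabel/= phic.
(* [E'] reads, besides the noise, only the coordinates in [G], which are local and so fixed by
   [phi]: the exchange acts on [cyl F] alone. *)
have E2 : q (E' `&` (A `*` setT)) = q (E' `&` (cyl F `*` setT)).
  transitivity (law_noise (map_fst (relabel phi) @^-1` (E' `&` (cyl F `*` setT)))).
    congr (q _); apply/seteqP; split=> -[x b] /= [E'x Ax]; split=> //.
      by apply: dE' E'x => b' b'G; rewrite /relabel phiL//; exact: Gc.
    by apply: dE' E'x => b' b'G; rewrite /relabel phiL//; exact: Gc.
  apply/esym; apply: (@law_noise_relabel _ _ _ _ _ _ _ X X_exch [set` (F `|` G)%fset] phi).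
  - move=> H HF; apply: mv; apply/fsubsetP => b /HF /=.
    by rewrite !inE => /orP[->//|->]; rewrite !orbT.
  - by apply: measurableI => //; exact: mX.
  - move=> x y b xy /= [E'x Fx]; split.
      by apply: dE' E'x => b' b'G; apply: xy; rewrite /= inE b'G orbT.
    split=> // b' b'F; rewrite -xy; last by rewrite /= inE b'F.
    by case: Fx => + _; apply.
have close (B : set (bits coord)) : measurable B ->
    `|pr q (E `&` (B `*` setT)) - pr q (E' `&` (B `*` setT))| <= e / 2.
  move=> mB; have mBX := mX _ mB.
  apply: (le_trans (pr_dist _ _ _)); [exact: measurableI|exact: measurableI|].
  apply: le_trans EE'; apply: pr_le.
  - by apply: measurableY; exact: measurableI.
  - exact: measurableY.
  - by rewrite -setIYl => x [].
have -> : pr law (cyl F `&` [set x | x c]) = pr q (E `&` (A `*` setT)).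
  by rewrite /pr E1; congr fine; exact: EP.
have := close A mA; have := close (cyl F) mF.
rewrite [pr q (E' `&` (A `*` _))]/pr E2 -/(pr q _).
rewrite distrC => h1 h2; apply: le_trans (ler_distD (pr q (E' `&` (cyl F `*` setT))) _ _) _.
by rewrite addrC; lra.
Qed.

End conditional_independence.

(** * Sequential sampling *)

Section increasing_embedding.
Implicit Types (s t : {fset nat}) (f : nat -> nat).

Definition strictly_increasing f := forall i j, (i < j)%N -> (f i < f j)%N.

Lemma strictly_increasing_inj f : strictly_increasing f -> injective f.
Proof. by move=> fi i j fij; case: (ltngtP i j) => // /fi; rewrite fij ltnn. Qed.

Definition std (k : nat) : {fset nat} := [fset i in iota 0 k]%fset.

Lemma in_std k i : (i \in std k) = (i < k)%N.
Proof. by rewrite inE/= mem_iota add0n. Qed.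

Lemma card_std k : #|` std k| = k.
Proof. by rewrite card_fseq undup_id ?iota_uniq// size_iota. Qed.

(* The increasing enumeration of [s], continued beyond its maximum. *)
Definition emb s (i : nat) : nat :=
  if (i < #|` s|)%N then nth 0%N (sort leq s) i else ((\max_(j <- enum_fset s) j) + i.+1)%N.

Lemma emb_nth s i : (i < #|` s|)%N -> emb s i \in s.
Proof. by move=> h; rewrite /emb h -(mem_sort leq) mem_nth// size_sort. Qed.

Lemma emb_increasing s : strictly_increasing (emb s).
Proof.
move=> i j ij; rewrite /emb.
have [js|sj] := ltnP j #|` s|.
  have is_ := ltn_trans ij js; rewrite is_.
  have srt : sorted ltn (sort leq s).
    by rewrite ltn_sorted_uniq_leq sort_uniq fset_uniq sort_sorted//; exact: leq_total.
  by apply: (sorted_ltn_nth ltn_trans 0%N srt) => //; rewrite inE size_sort.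
have [is_|si] := ltnP i #|` s|; last by rewrite ltn_add2l.
have := emb_nth is_; rewrite /emb is_ => h.
apply: (leq_ltn_trans (@leq_bigmax_seq _ (enum_fset s) xpredT id _ h isT)).
by rewrite addnS ltnS leq_addr.
Qed.

Lemma emb_inj s : injective (emb s).
Proof. exact/strictly_increasing_inj/emb_increasing. Qed.

Lemma emb_std s : [fset emb s i | i in std #|` s|]%fset = s.
Proof.
apply/eqP; rewrite eqEfcard card_imfset/=; last exact: emb_inj.
rewrite card_std leqnn andbT; apply/fsubsetP => _ /imfsetP[i /= + ->].
by rewrite in_std => /emb_nth.
Qed.

Lemma emb_comp f s i : strictly_increasing f -> (i < #|` s|)%N ->
  emb [fset f j | j in s]%fset i = f (emb s i).
Proof.
move=> fi is_; rewrite /emb card_imfset/=; last exact: strictly_increasing_inj.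
rewrite is_; have -> : sort leq [fset f j | j in s]%fset = map f (sort leq s).
  apply: (sorted_eq leq_trans anti_leq).
  - by apply: sort_sorted; exact: leq_total.
  - rewrite sorted_map; apply: sub_sorted (sort_sorted leq_total _) => j k /=.
    by rewrite leq_eqVlt => /orP[/eqP ->//|/fi/ltnW].
  - rewrite perm_sort; apply: uniq_perm.
    + exact: fset_uniq.
    + by rewrite map_inj_uniq ?sort_uniq ?fset_uniq//; exact: strictly_increasing_inj.
    + move=> j; apply/imfsetP/mapP => -[k /= ks ->]; exists k => //.
        by rewrite mem_sort.
      by move: ks; rewrite mem_sort.
by rewrite (nth_map 0%N)// size_sort.
Qed.

Lemma fproperP s t :
  reflect ((s `<=` t)%fset /\ exists2 i, i \in t & i \notin s) (s `<` t)%fset.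
Proof.
rewrite fproperE; apply: (iffP andP) => [[st /fsubsetPn h]|[st [i it ns]]]; first by split.
by split=> //; apply/fsubsetPn; exists i.
Qed.

Lemma imfset_comp f g s : [fset f i | i in [fset g j | j in s]]%fset = [fset f (g j) | j in s]%fset.
Proof.
apply/fsetP => k; apply/imfsetP/imfsetP => [[_ /imfsetP[j /= js ->] ->]|[j /= js ->]].
  by exists j.
by exists (g j) => //; apply/imfsetP; exists j.
Qed.

End increasing_embedding.

Section transported_kernel.
Context (R : realType) (n : nat) (d : measure_display) (Omega : measurableType d)
  (P : probability Omega R) (dT : measure_display) (T : measurableType dT)
  (X : random_array n P T) (X_exch : exchangeable X).
Local Notation coord := (coord T).
Local Notation mu := (coin nat R).
Local Notation law := (law X).
Local Notation law_noise := (law \x mu)%E.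
Implicit Types (b c : coord) (s t : {fset nat}).

Definition map_vertices (f : nat -> nat) c : coord := ([fset f i | i in c.1]%fset, c.2).

Lemma map_vertices_moved f (F : {fset coord}) : injective f -> exists g, moved_by g (map_vertices f) F.
Proof.
move=> fi; exists (fun i => if odd i then i else (f i./2).*2); split.
  move=> i j _ _; have half (k : nat) : k = (odd k + k./2.*2)%N by rewrite odd_double_half.
  case: ifPn => oi; case: ifPn => oj //.
  - by move=> ij; move: oi; rewrite ij odd_double.
  - by move=> ij; move: oj; rewrite -ij odd_double.
  - move=> /double_inj/fi ij.
    by rewrite (half i) (half j) (negbTE oi) (negbTE oj) ij.
move=> c _; rewrite /enc_coord/=; congr (_, _); apply/fsetP => i; apply/idP/imfsetP.
  rewrite /enc inE => /orP[/imfsetP[_ /= /imfsetP[j /= jc ->] ->]|/imfsetP[j /= ja ->]].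
    exists j.*2; last by rewrite odd_double doubleK.
    by rewrite /= inE; apply/orP; left; apply/imfsetP; exists j.
  exists j.*2.+1; last by rewrite /= odd_double.
  by rewrite /= inE; apply/orP; right; apply/imfsetP; exists j.
move=> [j /=]; rewrite /enc !inE => /orP[] /imfsetP[k /= kc ->] ->.
  rewrite odd_double doubleK; apply/orP; left; apply/imfsetP; exists (f k) => //=.
  by apply/imfsetP; exists k.
by rewrite /= odd_double/=; apply/orP; right; apply/imfsetP; exists k.
Qed.

Lemma law_map_vertices f A : injective f -> measurable A -> law (relabel (map_vertices f) @^-1` A) = law A.
Proof.
move=> fi mA.
have mE (B : set (bits coord)) : mask setT @^-1` B = B.
  apply: preimage_mask => x y xy; rewrite (_ : x = y)//.
  by apply/funext => b; exact: xy.
have := @law_relabel _ _ _ _ _ _ _ _ X_exch setT (map_vertices f) (fun F _ => map_vertices_moved F fi) A mA.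
by rewrite /distribution /pushforward comp_preimage mE.
Qed.

Lemma law_noise_map_vertices f Z : injective f -> measurable Z ->
  law_noise (map_fst (relabel (map_vertices f)) @^-1` Z) = law_noise Z.
Proof.
move=> fi mZ; apply/esym.
apply: (@law_noise_relabel _ _ _ _ _ _ _ _ X_exch setT (map_vertices f) (fun F _ => map_vertices_moved F fi)) => //.
by move=> x y b xy; rewrite (_ : x = y)//; apply/funext => c; exact: xy.
Qed.

Definition std_kernel k (a : {fset nat} * set T) : set (bits coord * bits nat) :=
  sval (cid (kernel_exists X (std k, a))).

Lemma std_kernelP k a : is_kernel X (std k, a) (std_kernel k a).
Proof. exact: (svalP (cid (kernel_exists X (std k, a)))). Qed.

(** The choice is made once for each size and mark; equivariance under increasing relabelings
    ([sample_map_vertices]) depends on it. *)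
Definition kernel c : set (bits coord * bits nat) :=
  map_fst (relabel (map_vertices (emb c.1))) @^-1` std_kernel #|` c.1| c.2.

Lemma map_vertices_local f c b : injective f -> local c b -> local (map_vertices f c) (map_vertices f b).
Proof.
move=> fi [/fproperP[bc [i ic nib]]|[bc lt]]; [left|right].
  apply/fproperP; split.
    apply/fsubsetP => _ /imfsetP[j /= jb ->]; apply/imfsetP; exists j => //.
    exact: (fsubsetP bc).
  exists (f i); first by apply/imfsetP; exists i.
  by apply/negP => /imfsetP[j /= jb /fi ij]; rewrite ij jb in nib.
by rewrite /map_vertices/= bc.
Qed.

Lemma map_vertices_std c : map_vertices (emb c.1) (std #|` c.1|, c.2) = c.
Proof. by rewrite /map_vertices/= emb_std; case: c. Qed.

(** On the coordinates local to [c], [psi] inverts the relabeling; so a local event is the preimage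
    of an event local to the standard coordinate, and the law is invariant under the relabeling. *)
Lemma kernelP c : is_kernel X c (kernel c).
Proof.
have [mE dE EP] := std_kernelP #|` c.1| c.2.
pose f := emb c.1; pose c0 : coord := (std #|` c.1|, c.2).
have fi : injective f by exact: emb_inj.
have upc0 : map_vertices f c0 = c by exact: map_vertices_std.
pose psi b : coord := ([fset i in std #|` c.1| | f i \in b.1]%fset, b.2).
have up_psi b : local c b -> map_vertices f (psi b) = b.
  move=> lb; have bc : (b.1 `<=` c.1)%fset.
    by case: lb => [/fproper_sub//|[-> _]]; exact: fsubset_refl.
  rewrite /map_vertices /psi/=; case: b lb bc => t a /= _ tc; congr (_, _).
  apply/fsetP => i; apply/imfsetP/idP => [[j /=]|it].
    by rewrite !inE/= => /andP[_ ?] ->.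
  have : i \in c.1 by exact: (fsubsetP tc).
  rewrite -{1}(emb_std c.1) => /imfsetP[j /= jk ij].
  by exists j => //; rewrite !inE/= -/f in jk *; rewrite jk -[f j]ij.
have psi_local b : local c b -> local c0 (psi b).
  move=> lb; case: (lb) => [/fproperP[bc [i ic nib]]|[bc lt]]; [left|right].
    apply/fproperP; split; first by apply/fsubsetP => j; rewrite !inE => /andP[].
    move: ic; rewrite -{1}(emb_std c.1) => /imfsetP[j /= jk ij]; exists j => //.
    by rewrite !inE/= negb_and; apply/orP; right; rewrite -[f j]ij.
  split=> //; rewrite /psi/=; apply/fsetP => j; rewrite !inE/=.
  apply/andP/idP => [[]//|jk]; split=> //.
  by rewrite bc; apply: emb_nth; rewrite -in_std inE.
split.
- rewrite -[X in measurable X]setTI.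
  exact: (measurable_map_fst (measurable_relabel _)).
- move=> x y b xy; apply: dE => b0 lb0; apply: xy.
  by rewrite -[X in local X _]map_vertices_std; exact: map_vertices_local.
move=> A mA dA; pose A0 := relabel psi @^-1` A.
have mA0 : measurable A0 by exact: measurable_preimage_relabel.
have dA0 : dep_on (local c0) A0.
  by move=> x y xy; apply: dA => b lb; apply: xy; exact: psi_local.
have A0E : relabel (map_vertices f) @^-1` A0 = A.
  by apply/seteqP; split=> x; apply: dA => b lb; rewrite /relabel up_psi.
transitivity (law (relabel (map_vertices f) @^-1` (A0 `&` [set x | x c0]))).
  by congr (law _); rewrite preimage_setI A0E /preimage/= /relabel upc0.
rewrite law_map_vertices//; last by apply: measurableI => //; exact: measurable_coord.
rewrite EP//; apply: etrans (esym (law_noise_map_vertices fi _)) _.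
  by apply: measurableI => //; exact: measurableX.
by congr (law_noise _); rewrite preimage_setI -[in RHS]A0E.
Qed.
End transported_kernel.

(** * The order of sampling *)

Section lexicographic.
Variable A : eqType.
Implicit Types b c : ({fset nat} * A)%type.

(** With cardinality first, an earlier coordinate whose vertex set contains [c.1] has vertex set
    [c.1] and is local to [c]. Hence [kernel_global] covers all earlier coordinates. *)
Definition clt b c := (#|` b.1| < #|` c.1|)%N ||
  (#|` b.1| == #|` c.1|) && (wlt b.1 c.1 || (b.1 == c.1) && wlt b.2 c.2).

Lemma clt_wf : well_founded clt.
Proof.
suff H k s a : #|` s| = k -> Acc clt (s, a) by move=> [s a]; exact: (H _ _ _ erefl).
elim/ltn_ind: k s a => k IHk s.
elim/(well_founded_ind (@wlt_wf {fset nat})): s => s IHs a.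
elim/(well_founded_ind (@wlt_wf A)): a => a IHa sk.
constructor => -[t a'] /orP[/= tk|/= /andP[/eqP ts /orP[lt|/andP[/eqP tE la]]]].
- by apply: (IHk #|` t|) => //; rewrite -sk.
- by apply: IHs => //; rewrite ts.
- by rewrite tE; apply: IHa.
Qed.

Lemma clt_total b c : b != c -> clt b c || clt c b.
Proof.
case: b => s a; case: c => t a' bc; rewrite /clt /=.
case: ltngtP => //= _; rewrite /wlt [t == s]eq_sym.
have [st|st] /= := eqVneq s t; last by rewrite !orbF; exact: wle_total.
have /= : a != a' by apply: contra bc => /eqP ->; rewrite st.
by move=> aa'; rewrite [a' == a]eq_sym aa' /=; exact: wle_total.
Qed.

Lemma clt_trans b a c : clt a b -> clt b c -> clt a c.
Proof.
have wlt_trans (B : eqType) (x y z : B) : wlt x y -> wlt y z -> wlt x z.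
  by move=> /wltW xy; exact: wle_lt_trans xy.
rewrite /clt => /orP[ab|/andP[/eqP -> ab]] /orP[bc|/andP[/eqP <- bc]].
- by rewrite (ltn_trans ab bc).
- by rewrite ab.
- by rewrite bc.
- rewrite eqxx ltnn /=.
  case/orP: ab => [ab|/andP[/eqP -> ab]]; case/orP: bc => [bc|/andP[/eqP <- bc]].
  + by rewrite (wlt_trans _ _ _ _ ab bc).
  + by rewrite ab.
  + by rewrite bc.
  + by rewrite eqxx (wlt_trans _ _ _ _ ab bc) orbT.
Qed.

Lemma clt_max (s : seq ({fset nat} * A)%type) : s != [::] ->
  exists2 m, m \in s & forall b, b \in s -> b = m \/ clt b m.
Proof.
elim: s => // c s IH _; have [->|s0] := eqVneq s [::].
  by exists c; rewrite ?mem_head// => b; rewrite inE => /eqP ->; left.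
have [m ms hm] := IH s0.
have [cm|cm] := eqVneq c m.
  exists m; first by rewrite inE ms orbT.
  by move=> b; rewrite inE => /orP[/eqP ->|/hm//]; left.
have /orP[cm'|mc] := clt_total cm.
  exists m; first by rewrite inE ms orbT.
  by move=> b; rewrite inE => /orP[/eqP ->|/hm//]; right.
exists c; first exact: mem_head.
move=> b; rewrite inE => /orP[/eqP ->|/hm [->|bm]]; [by left|by right|right].
exact: clt_trans bm mc.
Qed.

End lexicographic.

Lemma coin_relabel (I J : choiceType) (R : realType) (f : I -> J) (A : set (bits I)) :
  injective f -> measurable A -> coin J R (relabel f @^-1` A) = coin I R A.
Proof.
move=> fi; apply: (@bits_measure_unique _ _ (distribution (coin J R) (relabel f))).
  exact: (le_lt_trans (probability_le1 _ _) (ltry _)).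
move=> F; transitivity (coin J R (cyl [fset f c | c in F]%fset)).
  rewrite /distribution /pushforward; congr (coin J R _).
  apply/seteqP; split=> x h c.
    by move=> /imfsetP[c' /= c'F ->]; exact: h.
  by move=> cF; apply: h; apply/imfsetP; exists c.
by rewrite /= !coin_cyl card_imfset.
Qed.

Section sampling.
Context (R : realType) (n : nat) (d : measure_display) (Omega : measurableType d)
  (P : probability Omega R) (dT : measure_display) (T : measurableType dT)
  (X : random_array n P T) (X_exch : exchangeable X).
Local Notation coord := (coord T).
Local Notation mark := ({fset nat} * set T)%type.
Local Notation law := (law X).
Local Notation law_noise := (law \x coin nat R)%E.
Implicit Types (b c : coord) (s t : {fset nat}).

Definition noise := {fset nat} -> bits (mark * nat)%type.
Implicit Types v : noise.

Definition noise_at v c : bits nat := fun j => v c.1 (c.2, j).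

Lemma local_clt c b : local c b -> clt b c.
Proof.
rewrite /clt; move=> [bc|[-> ->]]; last by rewrite !eqxx !orbT.
by rewrite (fproper_ltn_card bc).
Qed.

(** Coordinates with more than [n] visible vertices are set to [false]: they have probability 0
    under the law of the data, and the noise is indexed by sets of at most [n] vertices. *)
Definition sample_step v c (rec : forall b, clt b c -> bool) : bool :=
  (#|` c.1| <= n)%N && `[< kernel X c
    (fun b => if pselect (clt b c) is left h then rec b h else false, noise_at v c) >].

Definition sample v : bits coord := Fix (@clt_wf mark) (fun=> bool) (sample_step v).

Lemma kernel_agree c x y (z : bits nat) : (forall b, local c b -> x b = y b) ->
  kernel X c (x, z) = kernel X c (y, z).
Proof.
have [_ dE _] := kernelP X_exch c; move=> xy.
by apply/propext; split; apply: dE => b lb; rewrite xy.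
Qed.

Lemma sampleE v c : sample v c =
  (#|` c.1| <= n)%N && `[< kernel X c (sample v, noise_at v c) >].
Proof.
rewrite /sample Fix_eq.
  rewrite {1}/sample_step; congr (_ && `[< _ >]); apply: kernel_agree => b lb.
  by case: pselect => // -[]; exact: local_clt.
move=> c' f g fg; rewrite /sample_step; congr (_ && `[< kernel _ _ (_, _) >]).
by apply/funext => b; case: pselect => // h; exact: fg.
Qed.

(** With [D] the coordinates before [c], this makes the noise at [c] independent of the past; with
    [D] the coordinates at subsets of an edge, it makes the bits at the edge functions of the coins
    at its subsets. *)
Lemma sample_agree (D : set coord) v v' : (forall c b, D c -> local c b -> D b) ->
  (forall c, D c -> noise_at v c = noise_at v' c) ->
  forall c, D c -> sample v c = sample v' c.
Proof.
move=> Dl vv'; elim/(well_founded_ind (@clt_wf mark)) => c IH Dc.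
rewrite !sampleE vv'//; congr (_ && `[< _ >]); apply: kernel_agree => b lb.
by apply: IH; [exact: local_clt|exact: Dl lb].
Qed.

(** An increasing [f] commutes with increasing enumerations ([emb_comp]), so both sides consult the
    same standard kernel with the same noise. A general injection could permute the standard
    vertices. *)
Lemma sample_map_vertices f v c : strictly_increasing f ->
  sample v (map_vertices f c) = sample (fun t => v [fset f i | i in t]%fset) c.
Proof.
move=> fi; have finj := strictly_increasing_inj fi.
elim/(well_founded_ind (@clt_wf mark)): c => c IH.
rewrite !sampleE /= card_imfset//; congr (_ && `[< _ >]).
rewrite /kernel /map_fst /preimage /= card_imfset//=.
have [_ dE _] := std_kernelP X #|` c.1| c.2.
have E b : local (std #|` c.1|, c.2) b ->
    sample v (map_vertices (emb [fset f i | i in c.1]%fset) b) =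
    sample (fun t => v [fset f i | i in t]%fset) (map_vertices (emb c.1) b).
  move=> lb; have bs : (b.1 `<=` std #|` c.1|)%fset.
    by case: lb => [/fproper_sub//|[-> _]]; exact: fsubset_refl.
  rewrite -IH.
    have ee i : i \in b.1 -> emb [fset f i | i in c.1]%fset i = f (emb c.1 i).
      by move=> ib; apply: emb_comp => //; rewrite -in_std; exact: (fsubsetP bs).
    congr (sample v _); rewrite /map_vertices/= imfset_comp; congr (_, _).
    by apply/fsetP => k; apply/imfsetP/imfsetP => -[i /= ib ->]; exists i => //; rewrite ee.
  apply: local_clt; rewrite -[X in local X _]map_vertices_std.
  by apply: map_vertices_local => //; exact: emb_inj.
by apply/propext; split; apply: dE => b lb; rewrite /relabel E.
Qed.

End sampling.

Section lesubset.
Variable n : nat.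
Implicit Types (s : lesubset n) (t : {fset nat}).

Definition vertices s : {fset nat} := sval (tagged s).

Lemma card_vertices s : #|` vertices s| = tag s.
Proof. by case: s => k [t h]; exact/eqP. Qed.

Lemma vertices_inj : injective vertices.
Proof.
move=> s s' E; have kk' : tag s = tag s'.
  by apply: val_inj; rewrite /= -!card_vertices E.
case: s s' kk' E => k t [k' t'] /= kk'; case: _ / kk' in t' * => E.
by congr existT; exact: val_inj.
Qed.

Definition lesubset_of t : lesubset n :=
  xget (Tagged (fun k : 'I_n.+1 => nsubset k) (first_nsubset (@ord_max n))) [set s | vertices s = t].

Lemma lesubset_ofK t : (#|` t| <= n)%N -> vertices (lesubset_of t) = t.
Proof.
rewrite -ltnS => h; apply: (@xgetPex _ _ [set s | vertices s = t]).
by exists (Tagged (fun k : 'I_n.+1 => nsubset k) (exist _ t (eqxx _) : nsubset (Ordinal h))).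
Qed.

End lesubset.

(** * The law of the sampled bits *)

Section sample_law.
Context (R : realType) (n : nat) (d : measure_display) (Omega : measurableType d)
  (P : probability Omega R) (dT : measure_display) (T : measurableType dT)
  (X : random_array n P T) (X_exch : exchangeable X).
Local Notation coord := (coord T).
Local Notation mark := ({fset nat} * set T)%type.
Local Notation law := (law X).
Local Notation mu := (coin nat R).
Local Notation law_noise := (law \x mu)%E.
Implicit Types (b c : coord) (s t : {fset nat}) (F : {fset coord}).

Definition noise_index : choiceType := (lesubset n * (mark * nat))%type.
Local Notation Prob := (coin noise_index R).

Definition noise_of (y : bits noise_index) : noise T := fun t q => y (lesubset_of n t, q).

Definition sample_of (y : bits noise_index) : bits coord := sample X (noise_of y).

Definition before c : set coord := [set b | clt b c].

Let masked c (y : bits noise_index) := mask (before c) (sample_of y).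

Let kernel_mask c x (z : bits nat) :
  kernel X c (mask (before c) x, z) = kernel X c (x, z).
Proof. by apply: kernel_agree => // b /local_clt cb; rewrite mask_id. Qed.

Let measurable_masked c : (forall b, clt b c -> measurable [set y | sample_of y b]) ->
  measurable_fun setT (masked c).
Proof.
move=> mb; apply: measurable_bits => b; have [bc|nbc] := pselect (before c b).
  rewrite (_ : [set y | _] = [set y | sample_of y b]); first exact: mb.
  by apply/seteqP; split=> y /=; rewrite /masked mask_id.
rewrite (_ : [set y | _] = set0)//; apply/seteqP; split=> y //=.
by rewrite /masked /mask asboolF.
Qed.

Let pair_at c (y : bits noise_index) := (masked c y, noise_at (noise_of y) c).

Let measurable_pair_at c : (forall b, clt b c -> measurable [set y | sample_of y b]) ->
  measurable_fun setT (pair_at c).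
Proof.
by move=> mb; apply: measurable_fun_pair; [exact: measurable_masked|exact: measurable_relabel].
Qed.

Let measurable_sample_coord c : measurable [set y | sample_of y c].
Proof.
elim/(well_founded_ind (@clt_wf mark)): c => c IH.
have [mE _ _] := kernelP X_exch c.
have [cn|nc] := leqP #|` c.1| n.
  rewrite (_ : [set y | _] = pair_at c @^-1` kernel X c).
    by rewrite -[X in measurable X]setTI; exact: measurable_pair_at.
  by apply/seteqP; split=> y /=; rewrite /sample_of sampleE// cn/= /pair_at kernel_mask => /asboolP.
rewrite (_ : [set y | _] = set0)//; apply/seteqP; split=> y //=.
by rewrite /sample_of sampleE// leqNgt nc.
Qed.

Lemma measurable_sample_of : measurable_fun setT sample_of.
Proof. exact: measurable_bits. Qed.

HB.instance Definition _ := isMeasurableFun.Build _ _ _ _ sample_of measurable_sample_of.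

HB.instance Definition _ c := isMeasurableFun.Build _ _ _ _ (masked c)
  (measurable_masked (fun b _ => measurable_sample_coord b)).

HB.instance Definition _ c := isMeasurableFun.Build _ _ _ _ (pair_at c)
  (measurable_pair_at (fun b _ => measurable_sample_coord b)).

Let clt_card b c : clt b c -> (#|` b.1| <= #|` c.1|)%N.
Proof. by move=> /orP[/ltnW//|/andP[/eqP -> _]]. Qed.

(** The bits before [c] use coins reserved for other pairs of a vertex set and a mark; [lesubset_of]
    keeps these apart because all the sets involved have size at most [n]. *)
Let pair_at_law c Z : (#|` c.1| <= n)%N -> measurable Z ->
  Prob (pair_at c @^-1` Z) = (distribution Prob (masked c) \x mu)%E Z.
Proof.
move=> cn mZ; apply/esym; move: Z mZ.
apply: (@product_measure_unique _ _ _ _ _ _ _ (distribution Prob (pair_at c))).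
move=> A B mA mB.
transitivity (Prob ((masked c @^-1` A) `&`
    (relabel (fun j => (lesubset_of n c.1, (c.2, j))) @^-1` B))) => //.
have mMA : measurable (masked c @^-1` A).
  by rewrite -[X in measurable X]setTI; exact: measurable_funPT.
rewrite (@coin_indep _ _ [set q : noise_index | ~ (q.1 = lesubset_of n c.1 /\ q.2.1 = c.2)])//.
- congr (_ * _)%E; apply: coin_relabel => //.
  by move=> i j [].
- exact: measurable_preimage_relabel.
- move=> y y' yy' /=; rewrite (_ : masked c y = masked c y')//.
  apply/funext => b; rewrite /masked /mask; case: asboolP => //= bc.
  apply: (@sample_agree _ _ _ _ _ _ _ _ X_exch (before c)) => //.
    move=> c' b' c'c /local_clt b'c'; exact: clt_trans b'c' c'c.
  move=> c' c'c; apply/funext => j; rewrite /noise_at /noise_of; apply: yy' => /= -[lE cE].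
  have c'n : (#|` c'.1| <= n)%N by apply: leq_trans cn; exact: clt_card.
  have c1E : c'.1 = c.1 by rewrite -(lesubset_ofK c'n) lE lesubset_ofK.
  have : clt c' c by exact: c'c.
  by rewrite /clt c1E cE ltnn !wltxx !andbF.
- move=> y y' yy' /=; rewrite (_ : relabel _ y = relabel (fun j => (lesubset_of n c.1, (c.2, j))) y')//.
  by apply/funext => j; apply: yy' => /= -[].
Qed.

Let law_big c : (n < #|` c.1|)%N -> law [set x | x c] = 0%E.
Proof.
move=> nc; rewrite -cyl1 law_cyl (_ : \bigcap_(c in _) _ = set0) ?measure0//.
rewrite -subset0 => w /(_ c) h; have := h (fset11 c).
rewrite array_event_bad// => -[/eqP /= E _]; move: nc; rewrite -E ltnNge => /negP; apply.
have := fsubset_leq_card (fsubsetUl [fset i.*2 | i in c.1]%fset [fset i.*2.+1 | i in c.2.1]%fset).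
by rewrite card_imfset//=; exact: double_inj.
Qed.

(** The past has the right law by [E] and is independent of the coins at [c]. The kernel thus yields
    the right joint law with the past, because [kernel_global] extends its defining property from
    local events to all earlier cylinders. *)
Let sample_law_step c F : (forall A, measurable A ->
    distribution Prob (masked c) A = distribution law (mask (before c)) A) ->
  [set` F] `<=` before c ->
  Prob (sample_of @^-1` cyl (c |` F)%fset) = law (cyl (c |` F)%fset).
Proof.
move=> E Fc; rewrite cylU cyl1 [in RHS]setIC.
have [cn|nc] := leqP #|` c.1| n; last first.
  transitivity (Prob set0).
    congr (Prob _); rewrite -subset0 => y [/=].
    by rewrite /sample_of sampleE// leqNgt nc.
  rewrite measure0; apply/esym/eqP; rewrite -measure_le0 -(law_big nc).
  have mF : measurable (cyl F) by exact: measurable_cyl.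
  have mc : measurable [set x : bits coord | x c] by exact: measurable_coord.
  by apply: le_measure; rewrite ?inE//; exact: measurableI.
have kc := kernelP X_exch c; have [mE dE _] := kc.
have mZ : measurable (kernel X c `&` (cyl F `*` setT)).
  by apply: measurableI => //; apply: measurableX => //; exact: measurable_cyl.
have cylM x : cyl F (mask (before c) x) <-> cyl F x.
  by split=> h b bF; have := h b bF; rewrite mask_id//; exact: Fc.
transitivity (Prob (pair_at c @^-1` (kernel X c `&` (cyl F `*` setT)))).
  congr (Prob _); apply/seteqP; split=> y /=.
    rewrite /sample_of sampleE// cn/= => -[/asboolP h1 h2].
    by rewrite kernel_mask; split=> //; split=> //; exact/cylM.
  rewrite kernel_mask => -[h1 [/cylM h2 _]]; split=> //.
  by rewrite /sample_of sampleE// cn/=; exact/asboolP.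
rewrite pair_at_law// (eq_product_measure _ E)// product_distribution//.
rewrite (kernel_global X_exch kc); last first.
  move=> b /Fc /orP[bc|/andP[/eqP bc /orP[bc'|/andP[/eqP bE bc']]]].
  - by right; apply/negP => /fsubset_leq_card; rewrite leqNgt bc.
  - right; apply/negP => sub; have /eqP cb : c.1 == b.1 by rewrite eqEfcard sub bc /=.
    by move: bc'; rewrite cb wltxx.
  - by left; right.
congr (product_measure1 _ _ _); apply/seteqP; split=> -[x z] /=; rewrite /map_fst/=.
  by rewrite kernel_mask => -[h1 [/cylM h2 _]].
by move=> [h1 [h2 _]]; rewrite kernel_mask; split=> //; split=> //; exact/cylM.
Qed.

(** A cylinder is treated through its largest coordinate [c]. The induction on [c] provides the
    joint law of the whole past of [c], itself tested on cylinders with an earlier largest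
    coordinate. *)
Lemma sample_law A : measurable A -> Prob (sample_of @^-1` A) = law A.
Proof.
have step c : forall F, [set` F] `<=` before c ->
    Prob (sample_of @^-1` cyl (c |` F)%fset) = law (cyl (c |` F)%fset).
  elim/(well_founded_ind (@clt_wf mark)): c => c IH F Fc; apply: sample_law_step => //.
  apply: bits_measure_unique; first exact: (le_lt_trans (probability_le1 _ _) (ltry _)).
  move=> G; have [Gc|/existsNP[b /not_implyP[bG nbc]]] := pselect ([set` G] `<=` before c).
    have mE (y : bits noise_index) : cyl G (masked c y) <-> cyl G (sample_of y).
      by split=> h b bG; have := h b bG; rewrite /masked mask_id//; exact: Gc.
    transitivity (Prob (sample_of @^-1` cyl G)).
      by congr (Prob _); apply/seteqP; split=> y /mE.
    transitivity (law (cyl G)); last first.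
      congr (law _); apply/esym; apply: preimage_mask; apply: dep_onS Gc _.
      exact: dep_on_cyl.
    have [->|G0] := eqVneq G fset0; first by rewrite !cyl0 preimage_setT !probability_setT.
    have [|m mG hm] := @clt_max _ (enum_fset G).
      by apply: contra G0 => /eqP G0; apply/eqP/fsetP => b; rewrite -[b \in G]/(b \in enum_fset G) G0.
    rewrite -(fsetD1K mG); apply: IH; first exact: Gc.
    move=> b /=; rewrite !inE => /andP[bm bG].
    by have [bE|//] := hm b bG; rewrite bE eqxx in bm.
  transitivity (Prob set0).
    congr (Prob _); rewrite -subset0 => y /(_ b bG) /=; rewrite /masked /mask asboolF//.
  rewrite measure0 -(measure0 law); congr (law _); apply/esym.
  rewrite -subset0 => y h; have : mask (before c) y b by exact: h.
  by rewrite /mask asboolF.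
move: A; apply: (@bits_measure_unique _ _ (distribution Prob sample_of)).
  exact: (le_lt_trans (probability_le1 _ _) (ltry _)).
move=> G; have [->|G0] := eqVneq G fset0.
  rewrite !cyl0; transitivity (1 : \bar R)%E; first exact: probability_setT.
  exact/esym/probability_setT.
have [|m mG hm] := @clt_max _ (enum_fset G).
  by apply: contra G0 => /eqP G0; apply/eqP/fsetP => b; rewrite -[b \in G]/(b \in enum_fset G) G0.
rewrite -(fsetD1K mG); apply: step.
move=> b /=; rewrite !inE => /andP[bm bG].
by have [bE|//] := hm b bG; rewrite bE eqxx in bm.
Qed.

End sample_law.

(** * Realization by points *)

Section completion_lemmas.
Context d (V : measurableType d) (R : realType) (P : probability V R).

Lemma measurable_completion (A G : set V) : measurable G -> P.-negligible (A `+` G) ->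
  measurable (A : set (completion P)).
Proof.
move=> mG [M [mM M0 AGM]]; apply: sub_sigma_algebra.
exists (G `\` M); first exact: measurableD.
exists (A `&` M); first by exists M; split => //; exact: subIsetr.
have out x : ~ M x -> A x <-> G x.
  move=> nMx; split=> h; apply: contrapT => h'; apply: nMx; apply: AGM;
    rewrite setY_def; [by left|by right].
apply/seteqP; split=> x; first by move=> [[Gx nMx]|[]//]; apply/out.
by move=> Ax; have [Mx|nMx] := pselect (M x); [right|left; split=> //; apply/out].
Qed.

Lemma completed_prob_ae (A G : set V) : measurable G -> P.-negligible (A `+` G) ->
  completed_prob P A = P G.
Proof.
move=> mG [M [mM M0 AGM]].
have out x : ~ M x -> A x <-> G x.
  move=> nMx; split=> h; apply: contrapT => h'; apply: nMx; apply: AGM;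
    rewrite setY_def; [by left|by right].
have PU : P (G `|` M) = P G by rewrite measureU0.
have PD : P (G `\` M) = P G.
  have mGM : measurable (G `\` M) by exact: measurableD.
  have mGM' : measurable (G `&` M) by exact: measurableI.
  have : pr P (G `&` M) <= pr P M by apply: pr_le => //; exact: subIsetr.
  rewrite (pr_eq0 P mM).2// => h; have := pr_ge0 P (G `&` M).
  by rewrite !prE// (prID P mG mM) => ?; congr (_%:E); lra.
apply/eqP; rewrite eq_le; apply/andP; split.
  rewrite -PU -completed_probE; last exact: measurableU.
  apply: le_mu_ext => x Ax; have [Mx|nMx] := pselect (M x); [by right|left].
  exact/out.
rewrite -PD -completed_probE; last exact: measurableD.
by apply: le_mu_ext => x [Gx nMx]; exact/out.
Qed.

End completion_lemmas.

Section coin_products.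
Context (I J : choiceType) (R : realType).

Lemma coin_rectangle (r : seq I) (A : I -> set (bits J)) : uniq r ->
  (forall i, i \in r -> measurable (A i)) ->
  coin (I * J)%type R (\bigcap_(i in [set` r]) relabel (pair i) @^-1` A i) =
  (\prod_(i <- r) coin J R (A i))%E.
Proof.
elim: r => [|i r IH] /=.
  move=> _ _; rewrite big_nil (_ : \bigcap_(i in _) _ = setT) ?probability_setT//.
  by apply/seteqP; split=> // x _ i.
move=> /andP[ir ur] mA; rewrite big_cons -IH//; last first.
  by move=> j jr; apply: mA; rewrite inE jr orbT.
have mAi : measurable (A i) by apply: mA; rewrite mem_head.
have -> : \bigcap_(j in [set` i :: r]) relabel (pair j) @^-1` A j =
    (relabel (pair i) @^-1` A i) `&` \bigcap_(j in [set` r]) relabel (pair j) @^-1` A j.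
  apply/seteqP; split=> x.
    by move=> h; split=> [|j /= jr]; apply: h => /=; rewrite inE ?eqxx// jr orbT.
  by move=> [h1 h2] j /=; rewrite inE => /orP[/eqP -> //|jr]; exact: h2.
rewrite (@coin_indep _ _ [set c : (I * J)%type | c.1 = i]).
- by congr (_ * _)%E; apply: coin_relabel => // j k [].
- exact: measurable_preimage_relabel.
- apply: fin_bigcap_measurable => // j /= jr; apply: measurable_preimage_relabel.
  by apply: mA; rewrite inE jr orbT.
- move=> x y xy /=; rewrite (_ : relabel (pair i) x = relabel (pair i) y)//.
  by apply/funext => j; exact: xy.
- move=> x y xy h j jr; have := h j jr; rewrite /preimage/=.
  rewrite (_ : relabel (pair j) x = relabel (pair j) y)//.
  by apply/funext => k; apply: xy => /= ji; move: jr; rewrite /= ji (negbTE ir).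
Qed.

End coin_products.

(** * The coin cube over the subsets of an edge *)

Section cube.
Context (n : nat) (M : choiceType) (R : realType).

Definition cube : measurableType _ :=
  @subsets_space n (fun=> bits_display M) (fun=> bits M).

Definition cube_prob : probability cube R :=
  @subsets_prob n (fun=> bits_display M) (fun=> bits M) R (fun=> coin M R).

Definition cube_index : choiceType := ({set 'I_n} * M)%type.

Definition cube_point (x : bits cube_index) : cube := fun tau q => x (tau, q).

Definition cube_bits (z : cube) : bits cube_index := fun c => z c.1 c.2.

Lemma cube_pointK : cancel cube_point cube_bits.
Proof. by move=> x; apply/funext => -[]. Qed.

Lemma measurable_cube_point : measurable_fun setT cube_point.
Proof.
by apply: measurable_pi_fun => tau; exact: (measurable_relabel (pair tau)).
Qed.

HB.instance Definition _ := isMeasurableFun.Build _ _ _ _ cube_point measurable_cube_point.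

Lemma measurable_cube_coord (tau : {set 'I_n}) (q : M) : measurable [set z : cube | z tau q].
Proof.
rewrite -[X in measurable X]setTI.
exact: (@measurable_pi_proj _ _ (fun _ : {set 'I_n} => bits M) tau measurableT _ (measurable_coord q)).
Qed.

Lemma measurable_cube_bits : measurable_fun setT cube_bits.
Proof. by apply: measurable_bits => c; exact: measurable_cube_coord. Qed.

Lemma cube_probE (A : set cube) : measurable A ->
  cube_prob A = coin cube_index R (cube_point @^-1` A).
Proof.
pose E (tau : {set 'I_n}) : measurableType _ := bits M.
pose rects : set (set cube) := [set rectangle B | B in [set B : forall tau, set (E tau) | forall tau, measurable (B tau)]].
move=> mA; have mA' : (<<s rects >>) A.
  suff : <<s @cylinders _ _ E >> `<=` <<s rects >> by apply.
  apply: smallest_sub; first exact: smallest_sigma_algebra.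
  move=> _ [tau [B mB ->]]; apply: sub_sigma_algebra.
  exists (@dfwith _ (fun tau => set (E tau)) (fun=> setT) tau B).
    by move=> tau'; have [<-|ne] := eqVneq tau tau'; [rewrite dfwithin|rewrite dfwithout].
  apply/seteqP; split=> z /=; first by move=> /(_ tau); rewrite dfwithin.
  by move=> Bz tau'; have [<-|ne] := eqVneq tau tau'; [rewrite dfwithin|rewrite dfwithout].
apply: (@g_sigma_algebra_measure_unique _ R cube rects _ (fun=> setT) _ _
  cube_prob (distribution (coin cube_index R) cube_point)) => //.
- by move=> _ [B mB <-]; exact: measurable_rectangle.
- by move=> _; exists (fun=> setT) => //; apply/seteqP; split.
- by rewrite bigcup_const.
- move=> _ _ [B mB <-] [C mC <-]; exists (fun tau => B tau `&` C tau).
    by move=> tau; exact: measurableI.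
  by apply/seteqP; split=> z; [move=> h; split=> tau; case: (h tau)|move=> [hB hC] tau; split].
- move=> _ [B mB <-].
  transitivity (\prod_tau coin M R (B tau))%E; first exact: pi_probE.
  transitivity (coin cube_index R (\bigcap_(i in [set` enum {set 'I_n}]) relabel (pair i) @^-1` B i)).
    rewrite coin_rectangle ?enum_uniq//; first by rewrite big_enum.
    by move=> i _; exact: mB.
  congr (coin _ _ _); apply/seteqP; split=> x h tau; last by move=> _; exact: h.
  by apply: h; rewrite /= mem_enum.
- by move=> _; exact: (le_lt_trans (probability_le1 _ _) (ltry _)).
Qed.

End cube.

Definition is_lower_density d (V : measurableType d) (R : realType)
    (mu : probability V R) (theta : set V -> set V) :=
  [/\ forall A, measurable A -> mu.-negligible (A `+` theta A),
      forall A, measurable A -> mu A = 0%E -> theta A `<=` set0 &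
      forall A B C, measurable A -> measurable B -> measurable C ->
        mu ((A `&` B) `\` C) = 0%E -> theta A `&` theta B `<=` theta C].

Lemma cube_density n (M : choiceType) (R : realType) :
  exists theta, is_lower_density (cube_prob n M R) theta.
Proof.
have [D [ae nl sb]] := density_exists (cube_index n M) R.
have all_dep (A : set (bits (cube_index n M))) : dep_on setT A.
  by move=> x y xy; rewrite (_ : x = y)//; apply/funext => c; exact: xy.
have mpt (A : set (cube n M)) : measurable A -> measurable (@cube_point n M @^-1` A).
  by move=> mA; rewrite -[X in measurable X]setTI; exact: measurable_cube_point.
exists (fun A => @cube_bits n M @^-1` D (@cube_point n M @^-1` A)); split.
- move=> A mA; have [N [mN N0 AN]] := ae _ (mpt _ mA) (all_dep _).
  have mN' : measurable (@cube_bits n M @^-1` N).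
    by rewrite -[X in measurable X]setTI; exact: measurable_cube_bits.
  exists (@cube_bits n M @^-1` N); split => //; last by move=> z h; exact: AN.
  rewrite cube_probE//; rewrite -N0; congr (coin _ _ _).
  by apply/seteqP; split=> x; rewrite /preimage/= cube_pointK.
- move=> A mA A0 z; apply: nl; [exact: mpt|exact: all_dep|].
  by rewrite -cube_probE.
- move=> A B C mA mB mC ABC z; apply: sb; try exact: mpt; try exact: all_dep.
  rewrite -[X in X = _](@cube_probE n M R ((A `&` B) `\` C))//.
  by apply: measurableD => //; exact: measurableI.
Qed.

(* [rho z] is picked in all the compact sets whose event has density 1 at [z]:
   a lower density turns the finite intersection property, which the events
   only have almost everywhere, into one that holds at every point. *)
Lemma point_realization d (V : measurableType d) (R : realType)
    (mu : probability V R) (theta : set V -> set V)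
    dT (T : measurableType dT) (nu : probability T R) (K : set (set T))
    (G : set T -> set V) :
  is_lower_density mu theta -> compact_witness nu K ->
  (forall B, measurable B -> measurable (G B)) ->
  (forall F : {fset set T}, (forall B, B \in F -> measurable B) ->
    mu (\bigcap_(B in [set` F]) G B) = nu (\bigcap_(B in [set` F]) B)) ->
  exists rho : V -> T, forall B, measurable B -> mu.-negligible (rho @^-1` B `+` G B).
Proof.
move=> [ae nl sb] [Km KF Kreg] mG GE.
pose S z := [set B | K B /\ theta (G B) z].
have S0 z : \bigcap_(B in S z) B !=set0.
  apply: KF => [B []//|F FS]; apply: contrapT => F0.
  have FK B : B \in F -> K B /\ theta (G B) z by move=> /FS; rewrite inE.
  have [B0 B0F] : exists B0, B0 \in F.
    apply: contrapT => nF; apply: F0; exists point => B /= BF; exfalso; apply: nF.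
    by exists B.
  have mGF B : B \in F -> measurable (G B) by move=> /FK[/Km/mG].
  have mI (s : seq (set T)) : {subset s <= F} -> measurable (\bigcap_(B in [set` s]) G B).
    move=> sF; apply: fin_bigcap_measurable => [|B Bs]; first exact: finite_seq.
    by apply: mGF; exact: sF.
  (* [B0] provides the base case; the third clause of a lower density then adds one event at a
     time. *)
  have thF (s : seq (set T)) : {subset s <= F} ->
      theta (G B0 `&` \bigcap_(B in [set` s]) G B) z.
    elim: s => [_|B s IH sF].
      rewrite (_ : \bigcap_(B in _) _ = setT) ?setIT; first by have [] := FK _ B0F.
      by apply/seteqP; split=> // x _ i.
    have BF : B \in F by apply: sF; rewrite mem_head.
    have sF' : {subset s <= F} by move=> B' h; apply: sF; rewrite inE h orbT.
    have [_ thB] := FK _ BF.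
    apply: (sb _ _ _ (mGF _ BF) (measurableI _ _ (mGF _ B0F) (mI _ sF'))
       (measurableI _ _ (mGF _ B0F) (mI _ sF)) _ z); last by split=> //; exact: IH.
    rewrite (_ : _ `\` _ = set0) ?measure0//; rewrite -subset0 => x [[Bx [B0x sx]]].
    by apply; split=> // B' /=; rewrite inE => /orP[/eqP ->//|]; exact: sx.
  (* If the sets in [F] had no common point, their events would have a null intersection, whose
     density is empty; but [z] lies in it. *)
  have := thF F (fun B BF => BF).
  apply: (nl _ (measurableI _ _ (mGF _ B0F) (mI _ (fun B BF => BF)))).
  rewrite setIidr; last by move=> x; apply.
  rewrite GE; last by move=> B /FK[/Km].
  rewrite (_ : \bigcap_(B in _) _ = set0) ?measure0//; rewrite -subset0 => t Ft.
  by apply: F0; exists t.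
pose rho z := sval (cid (S0 z)).
have rhoP z B : K B -> theta (G B) z -> B (rho z).
  by move=> KB tB; apply: (svalP (cid (S0 z)) B).
have prG1 B : measurable B -> pr mu (G B) = pr nu B.
  move=> mB; have /GE : forall B', B' \in [fset B]%fset -> measurable B'.
    by move=> B'; rewrite inE => /eqP ->.
  by rewrite set_fset1 !bigcap_set1 /pr => ->.
have prG2 B B' : measurable B -> measurable B' -> pr mu (G B `&` G B') = pr nu (B `&` B').
  move=> mB mB'; have /GE : forall B'', B'' \in [fset B; B']%fset -> measurable B''.
    by move=> B''; rewrite !inE => /orP[] /eqP ->.
  have E (U : Type) (g : set T -> set U) :
      \bigcap_(i in [set` [fset B; B']%fset]) g i = g B `&` g B'.
    apply/seteqP; split=> x.
      by move=> h; split; apply: h; rewrite /= !inE eqxx ?orbT.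
    by move=> [h1 h2] i /=; rewrite !inE => /orP[] /eqP ->.
  by rewrite !E /pr => ->.
(* By inner regularity some [C] in [K] inside [B] misses at most [e] of it, and almost every point
   of [G C] is in its density, where [rho] takes values in [C]. If [nu B] is at most [e], the event
   [G B] is itself small enough. *)
have half B e : measurable B -> 0 < e -> exists N,
    [/\ measurable N, pr mu N <= e & G B `\` rho @^-1` B `<=` N].
  move=> mB e0; have [le|gt] := leP (pr nu B) e.
    by exists (G B); split; [exact: mG|rewrite prG1|move=> z []].
  have [C [KC CB Ce]] : exists C, [/\ K C, C `<=` B & pr nu B - e < pr nu C].
    have : ((pr nu B - e)%:E < nu B)%E by rewrite prE// lte_fin; lra.
    rewrite {1}(Kreg _ mB) => /ereal_sup_gt[_ [->|[C [KC CB] <-]]].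
      by rewrite lte_fin => h; exfalso; lra.
    move=> h; exists C; split=> //; move: h; rewrite prE ?lte_fin//; exact: Km.
  have mC : measurable C by exact: Km.
  have [N [mN N0 CN]] := ae _ (mG _ mC).
  have mBC : measurable (G B `\` G C) by apply: measurableD; exact: mG.
  exists ((G B `\` G C) `|` N); split; first exact: measurableU.
    have := prU mu mBC mN; rewrite (pr_eq0 mu mN).2//.
    have := prID mu (mG _ mB) (mG _ mC); rewrite prG1// prG2// setIidr//; lra.
  move=> z [Gz nB]; have [Cz|nC] := pselect (G C z); [right|by left].
  apply: contrapT => nN; apply: nB; apply: CB; apply: rhoP => //.
  by apply: contrapT => nt; apply: nN; apply: CN; rewrite setY_def; left.
exists rho => B mB.
(* Points of [G B] sent outside [B] are bounded by [half] for [B]; points outside [G B] sent into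
   [B] by [half] for the complement, whose event contains almost every point outside [G B]. *)
have close m : exists N, [/\ measurable N, pr mu N <= m.+1%:R^-1 & rho @^-1` B `+` G B `<=` N].
  have e0 : (0 : R) < m.+1%:R^-1 / 2 by rewrite divr_gt0// invr_gt0.
  have mC : measurable (~` B) by exact: measurableC.
  have [N1 [m1 p1 h1]] := half _ _ mB e0.
  have [N2 [m2 p2 h2]] := half _ _ mC e0.
  pose N3 := ~` (G B `|` G (~` B)).
  have mGU : measurable (G B `|` G (~` B)) by apply: measurableU; exact: mG.
  have m3 : measurable N3 by exact: measurableC.
  have p3 : pr mu N3 = 0.
    have mGBC : measurable (G (~` B) `\` G B) by apply: measurableD; exact: mG.
    have q1 := prID mu measurableT mGU; rewrite prT setTI setTD -/N3 in q1.
    have q2 : pr mu (G B `|` G (~` B)) = pr mu (G B) + pr mu (G (~` B) `\` G B).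
      rewrite -prUD; [|exact: mG|by []|by apply/disj_setPS => x [? []]].
      congr pr; apply/seteqP; split=> x; last by move=> [?|[? _]]; [left|right].
      by move=> [?|?]; [left|have [?|?] := pselect (G B x); [left|right]].
    have q3 := prID mu (mG _ mC) (mG _ mB).
    have q4 : pr mu (G (~` B) `&` G B) = 0 by rewrite prG2// setICl /pr measure0.
    have q5 := prID nu measurableT mB; rewrite prT setTI setTD in q5.
    rewrite prG1// q4 add0r in q3; rewrite prG1// -q3 -q5 in q2.
    by apply: (addrI 1); rewrite addr0 {2}q1 q2.
  have m12 : measurable (N1 `|` N2) by exact: measurableU.
  exists (N1 `|` N2 `|` N3); split; first exact: measurableU.
    have := prU mu m12 m3; have := prU mu m1 m2; move: p1 p2; rewrite p3.
    by move: (m.+1%:R^-1) => t; lra.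
  move=> z; rewrite setY_def => -[[rB nG]|[Gz nr]]; last by left; left; apply: h1.
  have [Gc|nGc] := pselect (G (~` B) z); last by right => -[].
  by left; right; apply: h2; split=> // nB; exact: nB.
have /choice [N NP] := close.
have mN m : measurable (N m) by case: (NP m).
exists (\bigcap_m N m); split; first exact: bigcapT_measurable.
  apply: (pr_eq0 mu (bigcapT_measurable mN)).1.
  apply/eqP; rewrite eq_le pr_ge0 andbT; apply/ler_addgt0Pl => e e0; rewrite addr0.
  apply: (@le_trans _ _ (Num.truncn e^-1).+1%:R^-1).
    have [_ le _] := NP (Num.truncn e^-1); apply: le_trans le; apply: pr_le => //.
      exact: bigcapT_measurable.
    exact: bigcap_inf.
  by rewrite invf_ple ?posrE//; exact/ltW/truncnS_gt.
by move=> z h m _; have [_ _] := NP m; apply.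
Qed.

(** * The representation *)

Section representation.
Context (R : realType) (n : nat) (d : measure_display) (Omega : measurableType d)
  (P : probability Omega R) (dT : measure_display) (T : measurableType dT)
  (X : random_array n P T) (X_exch : exchangeable X).
Local Notation coord := (coord T).
Local Notation noise_index := (noise_index n T).
Implicit Types (e : nsubset n) (a : ({fset nat} * set T)%type).

Definition mark_bit : choiceType := (({fset nat} * set T) * nat)%type.

Definition facet_point (y : bits noise_index) e : cube n mark_bit :=
  fun tau q => y (subset_at e tau, q).

(** On a vertex set that leaves the standard edge this repeats coins of its trace; the bits at
    subsets of the standard edge do not read those copies. *)
Definition unfold_cube (z : cube n mark_bit) : bits noise_index :=
  fun c => z [set i | val i \in vertices c.1]%SET c.2.

Definition read (z : cube n mark_bit) : bits coord := sample_of X (unfold_cube z).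

Lemma measurable_read : measurable_fun setT read.
Proof.
apply: (measurableT_comp (measurable_sample_of X_exch)).
by apply: measurable_bits => c; exact: measurable_cube_coord.
Qed.

Lemma vertices_subset_at e (tau : {set 'I_n}) :
  vertices (subset_at e tau) = [fset emb (sval e) (val i) | i in tau]%fset.
Proof.
apply/fsetP => j; apply/imfsetP/imfsetP => -[i /= it ->]; exists i => //;
  by rewrite /increasing_enum /emb (eqP (svalP e)) ltn_ord.
Qed.

(** Equivariance replaces [e] by the standard edge, and by [sample_agree] only the noise at its
    subsets matters, which a point of the cube stores. *)
Lemma read_facet_point (y : bits noise_index) e a :
  read (facet_point y e) (std n, a) = sample_of X y (sval e, a).
Proof.
have eE : (sval e, a) = map_vertices (emb (sval e)) (std n, a).
  by rewrite /map_vertices/=; have := emb_std (sval e); rewrite (eqP (svalP e)) => ->.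
rewrite eE /sample_of sample_map_vertices//; last exact: emb_increasing.
apply: (@sample_agree _ _ _ _ _ _ _ _ X_exch [set c | (c.1 `<=` std n)%fset]).
- move=> c b cn [/fproper_sub bc|[bc _]]; first exact: fsubset_trans cn.
  by rewrite /= bc.
- move=> [t b] /= tn; apply/funext => j.
  rewrite /noise_at /noise_of /unfold_cube /facet_point/=; congr (y (_, _)).
  have t_n : (#|` t| <= n)%N by rewrite -(card_std n); exact: fsubset_leq_card.
  apply: vertices_inj; rewrite vertices_subset_at (lesubset_ofK t_n) lesubset_ofK; last first.
    by rewrite card_imfset//; exact: emb_inj.
  apply/fsetP => k; apply/imfsetP/imfsetP => [[i /= + ->]|[i /= it ->]].
    by rewrite inE => it; exists (val i).
  have i_n : (i < n)%N by rewrite -in_std; exact: (fsubsetP tn).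
  by exists (Ordinal i_n) => //=; rewrite inE.
- exact: fsubset_refl.
Qed.

Lemma subset_at_inj e : injective (subset_at e).
Proof.
move=> tau tau' E; apply/setP => i.
have tauE (t : {set 'I_n}) : (i \in t) = (emb (sval e) (val i) \in vertices (subset_at e t)).
  rewrite vertices_subset_at; apply/idP/imfsetP => [it|[j /= jt /emb_inj/val_inj ->//]].
  by exists i.
by rewrite !tauE E.
Qed.

Lemma measurable_facet_point e : measurable_fun setT (fun y => facet_point y e).
Proof.
by apply: measurable_pi_fun => tau; exact: (measurable_relabel (pair (subset_at e tau))).
Qed.

Lemma facet_point_law e (A : set (cube n mark_bit)) : measurable A ->
  cube_prob n mark_bit R A = coin noise_index R [set y | A (facet_point y e)].
Proof.
move=> mA; rewrite cube_probE//.
pose f (c : cube_index n mark_bit) : noise_index := (subset_at e c.1, c.2).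
have fi : injective f by move=> [t q] [t' q'] /pair_equal_spec[/= /(@subset_at_inj e) -> ->].
rewrite -(coin_relabel R fi)//.
by rewrite -[X in measurable X]setTI; exact: measurable_cube_point.
Qed.

Definition facet_event (B : set T) : set (cube n mark_bit) :=
  [set z | read z (std n, (fset0, B))].

Lemma measurable_facet_event B : measurable (facet_event B).
Proof.
rewrite -[X in measurable X]setTI.
exact: (measurable_read measurableT (measurable_coord (std n, (fset0, B)))).
Qed.

Lemma enc_first (s : {fset nat}) : enc s fset0 = [fset i.*2 | i in s]%fset.
Proof. by rewrite /enc imfset0 fsetU0. Qed.

(** The events of one edge are sampled jointly, so their finite intersections have the right
    probability, as [point_realization] demands. Visible vertices sit at even positions;
    exchangeability absorbs the doubling. *)
Lemma facet_event_law (F : {fset set T}) : (forall B, B \in F -> measurable B) ->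
  cube_prob n mark_bit R (\bigcap_(B in [set` F]) facet_event B) =
  distribution P (X (first_nsubset n)) (\bigcap_(B in [set` F]) B).
Proof.
move=> mF; pose e := first_nsubset n.
have mI : measurable (\bigcap_(B in [set` F]) facet_event B).
  by apply: fin_bigcap_measurable => [|B _]; [exact: finite_fset|exact: measurable_facet_event].
rewrite (facet_point_law e)//.
pose H := [fset ((sval e, (fset0, B)) : coord) | B in F]%fset.
transitivity (coin noise_index R (sample_of X @^-1` cyl H)).
  congr (coin _ _ _); apply/seteqP; split=> y h.
    move=> _ /imfsetP[B /= BF ->]; have := h B BF.
    by rewrite /facet_event/= read_facet_point.
  move=> B BF; rewrite /facet_event/= read_facet_point; apply: h.
  by apply/imfsetP; exists B.
rewrite sample_law//; last exact: measurable_cyl.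
rewrite law_cyl; pose F' := [fset (sval e, B) | B in F]%fset.
transitivity (P (\bigcap_(c in [set` F']) array_event X ([fset i.*2 | i in c.1]%fset, c.2))).
  congr (P _); apply/seteqP; split=> w h.
    move=> _ /imfsetP[B /= BF ->] /=; rewrite -enc_first.
    by apply: (h (sval e, (fset0, B))); apply/imfsetP; exists B.
  move=> _ /imfsetP[B /= BF ->]; rewrite /enc_coord/= enc_first.
  by apply: (h (sval e, B)); apply/imfsetP; exists B.
rewrite -(array_event_exchange X_exch (f := double)); last by move=> i j _ _; exact: double_inj.
rewrite /distribution /pushforward; congr (P _); apply/seteqP; split=> w h.
  move=> B BF; have : array_event X (sval e, B) w.
    by apply: h; apply/imfsetP; exists B.
  by rewrite (array_eventE X e (mF _ BF)).
move=> _ /imfsetP[B /= BF ->].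
suff : array_event X (sval e, B) w by [].
by rewrite (array_eventE X e (mF _ BF)); exact: h.
Qed.

Section noise_realization.
Context (d' : measure_display) (Omega' : measurableType d') (Q : probability Omega' R)
  (xi : lesubset n -> {RV Q >-> bits mark_bit}).
Hypothesis xi_indep : independent xi.
Hypothesis xi_law : forall s A, measurable A -> distribution Q (xi s) A = coin mark_bit R A.

Definition noise_map (w : Omega') : bits noise_index := fun c => xi c.1 w c.2.

Lemma measurable_noise_map : measurable_fun setT noise_map.
Proof.
apply: measurable_bits => -[s q]; rewrite -[X in measurable X]setTI.
have mx : measurable_fun setT (xi s) by exact: measurable_funPT.
exact: (mx measurableT _ (@measurable_coord mark_bit q)).
Qed.

HB.instance Definition _ := isMeasurableFun.Build _ _ _ _ noise_map measurable_noise_map.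

(** A cylinder groups into one cylinder for each vertex set; independence and the marginal laws turn
    its probability into the product given by [coin_rectangle]. *)
Lemma noise_map_law A : measurable A -> Q (noise_map @^-1` A) = coin noise_index R A.
Proof.
move: A; apply: (@bits_measure_unique _ _ (distribution Q noise_map)).
  exact: (le_lt_trans (probability_le1 _ _) (ltry _)).
move=> F; pose S := [fset c.1 | c in F]%fset.
pose G s := cyl [fset c.2 | c in F & c.1 == s]%fset.
have GP s q : q \in [fset c.2 | c in F & c.1 == s]%fset <-> (s, q) \in F.
  split=> [/imfsetP[[s' q'] /=]|sqF]; first by rewrite inE => /andP[/= cF /eqP <-] ->.
  by apply/imfsetP; exists (s, q) => //=; rewrite inE sqF/=.
have SP s q : (s, q) \in F -> s \in S by move=> sqF; apply/imfsetP; exists (s, q).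
transitivity (Q (\bigcap_(s in [set` S]) (xi s @^-1` G s))).
  rewrite /distribution /pushforward; congr (Q _); apply/seteqP; split=> w h.
    by move=> s _ q /GP; exact: (h (s, q)).
  by move=> [s q] sqF; apply: (h s (SP _ _ sqF) q); exact/GP.
rewrite xi_indep; last by move=> s _; exact: measurable_cyl.
transitivity (\prod_(s <- S) coin mark_bit R (G s))%E.
  by apply: eq_bigr => s _; apply: (xi_law s); exact: measurable_cyl.
rewrite -coin_rectangle//; last by move=> s _; exact: measurable_cyl.
congr (coin _ _ _); apply/seteqP; split=> y h.
  by move=> [s q] sqF; apply: (h s (SP _ _ sqF) q); exact/GP.
by move=> s _ q /GP; exact: (h (s, q)).
Qed.

Lemma facet_point_realized e (A : set (cube n mark_bit)) : measurable A ->
  Q [set w | A (facet_point (noise_map w) e)] = cube_prob n mark_bit R A.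
Proof.
move=> mA; rewrite (facet_point_law e)// -noise_map_law//.
rewrite (_ : [set y | _] = relabel (fun c : cube_index n mark_bit => (subset_at e c.1, c.2)) @^-1` (@cube_point n mark_bit @^-1` A))//.
apply: measurable_preimage_relabel.
by rewrite -[X in measurable X]setTI; exact: measurable_cube_point.
Qed.

End noise_realization.
End representation.

Section hypergraph_law.
Context (R : realType) (n : nat) (d : measure_display) (Omega : measurableType d)
  (P : probability Omega R) (dT : measure_display) (T : measurableType dT)
  (X : random_array n P T).

Definition hypergraph_coords (H : event_hypergraph n T) (g : eh_vertex H -> nat)
    (gi : injective g) : {fset coord T} :=
  [fset ((sval (image_nsubset gi e), (fset0, eh_event H e)) : coord T) |
    e in {: {e : {set eh_vertex H} | #|e| == n}}]%fset.

Lemma double_injective (S : finType) (g : S -> nat) : injective g -> injective (double \o g).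
Proof. by move=> gi; apply: inj_comp gi; exact: double_inj. Qed.

Lemma law_hypergraph (H : event_hypergraph n T) (g : eh_vertex H -> nat) (gi : injective g) :
  law X (cyl (hypergraph_coords gi)) = P (hypergraph_event (double_injective gi) X).
Proof.
rewrite law_cyl; congr (P _).
have encE (e : {e : {set eh_vertex H} | #|e| == n}) : enc_coord (sval (image_nsubset gi e), (fset0, eh_event H e)) =
    (sval (image_nsubset (double_injective gi) e), eh_event H e).
  rewrite /enc_coord /=; congr (_, _); rewrite enc_first.
  apply/fsetP => i; apply/imfsetP/imfsetP => [[_ /imfsetP[j /= je ->] ->]|[j /= je ->]].
    by exists j.
  by exists (g j) => //; apply/imfsetP; exists j.
apply/seteqP; split=> w h.
  move=> e; have : array_event X (enc_coord (sval (image_nsubset gi e), (fset0, eh_event H e))) w.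
    by apply: h; apply/imfsetP; exists e.
  by rewrite encE array_eventE//; exact: eh_measurable.
move=> _ /imfsetP[e /= _ ->]; rewrite encE array_eventE; last exact: eh_measurable.
exact: h.
Qed.

End hypergraph_law.

Theorem theorem4p1 (R : realType) (n : nat) (n_ge1 : (1 <= n)%N)
    (d : measure_display) (Omega : measurableType d) (P : probability Omega R)
    (dT : measure_display) (T : measurableType dT)
    (X : random_array n P T) (X_exch : exchangeable X)
    (K : set (set T))
    (X_compact : compact_witness (distribution P (X (first_nsubset n))) K) :
  exists (dD : 'I_n.+1 -> measure_display)
    (D : forall k, measurableType (dD k))
    (mu : forall k, probability (D k) R)
    (rho : {mfun completion (subsets_prob mu) >-> T}),
  forall (d' : measure_display) (Omega' : measurableType d')
    (Q : probability Omega' R)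
    (xi : forall s : lesubset n, {RV Q >-> D (tag s)}),
    independent xi ->
    (forall s A, measurable A -> distribution Q (xi s) A = mu (tag s) A) ->
  exists2 Y : random_array n (completed_prob Q) T,
    (forall e w, Y e w = rho (subsets_point (fun s => xi s w) e))
    & exchangeable Y /\ same_distribution X Y.
Proof.
pose M := mark_bit T; pose N := noise_index n T.
have [theta thetaP] := cube_density n M R.
have mG := measurable_facet_event X_exch.
have [rho rhoP] := point_realization thetaP X_compact (fun B _ => mG B)
  (facet_event_law X_exch).
have mrho : measurable_fun [set: completion (cube_prob n M R)] rho.
  move=> _ B mB; rewrite setTI.
  by apply: measurable_completion (mG B) _; exact: rhoP.
pose rho_mfun : {mfun completion (cube_prob n M R) >-> T} :=
  HB.pack rho (isMeasurableFun.Build _ _ (completion (cube_prob n M R)) T rho mrho).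
exists (fun=> bits_display M), (fun=> bits M), (fun=> coin M R), rho_mfun.
move=> d' Omega' Q xi xi_indep xi_law /=.
pose point_at (e : nsubset n) (w : Omega') : cube n M := facet_point (noise_map xi w) e.
have mpoint e : measurable_fun setT (point_at e).
  apply: (measurableT_comp (measurable_facet_point e)).
  exact: measurable_noise_map.
(* The law of [point_at e] is [cube_prob], so null sets pull back to null sets of [Q]. This makes
   [Y] measurable for the completion of [Q]. *)
have point_ae e (A G : set (cube n M)) : (cube_prob n M R).-negligible (A `+` G) ->
    Q.-negligible ((point_at e @^-1` A) `+` (point_at e @^-1` G)).
  move=> [Z [mZ Z0 AGZ]]; exists (point_at e @^-1` Z); split.
  - by rewrite -[X in measurable X]setTI; exact: mpoint.
  - by rewrite -Z0; exact: (facet_point_realized xi_indep xi_law).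
  - by move=> w; exact: AGZ.
have mpG e B : measurable (point_at e @^-1` facet_event X B).
  by rewrite -[X in measurable X]setTI; exact: mpoint.
have mY e : measurable_fun [set: completion Q] (fun w => rho (point_at e w)).
  move=> _ B mB; rewrite setTI.
  apply: measurable_completion (mpG e B) _.
  by apply: (point_ae e (rho @^-1` B)); exact: rhoP.
pose Y_mfun e : {mfun completion Q >-> T} := HB.pack (fun w => rho (point_at e w))
  (isMeasurableFun.Build _ _ (completion Q) T (fun w => rho (point_at e w)) (mY e)).
pose Y : random_array n (completed_prob Q) T := Y_mfun.
have Y_law (H : event_hypergraph n T) (g : eh_vertex H -> nat) (gi : injective g) :
    completed_prob Q (hypergraph_event gi Y) = P (hypergraph_event (double_injective gi) X).
  rewrite -law_hypergraph -(sample_law X_exch); last exact: measurable_cyl.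
  have mC : measurable (sample_of X @^-1` cyl (hypergraph_coords gi)).
    rewrite -[X in measurable X]setTI.
    exact: (measurable_sample_of X_exch measurableT (measurable_cyl _)).
  rewrite -(noise_map_law xi_indep xi_law)//.
  apply: completed_prob_ae.
    by rewrite -[X in measurable X]setTI; exact: measurable_noise_map.
  (* A hypergraph has finitely many edges, so the exceptional sets of all of them together are still
     negligible. *)
  have nU : Q.-negligible (\big[setU/set0]_(e : {e : {set eh_vertex H} | #|e| == n})
      ((point_at (image_nsubset gi e) @^-1` (rho @^-1` eh_event H e)) `+`
       (point_at (image_nsubset gi e) @^-1` facet_event X (eh_event H e)))).
    elim/big_ind: _ => [|A B nA nB|e _]; first exact: negligible_set0.
      exact: negligibleU.
    by apply: point_ae; apply: rhoP; exact: eh_measurable.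
  apply: negligibleS nU => w; apply: contraPP => nw.
  have eqE (e : {e : {set eh_vertex H} | #|e| == n}) : eh_event H e (Y (image_nsubset gi e) w) <->
      sample_of X (noise_map xi w) (sval (image_nsubset gi e), (fset0, eh_event H e)).
    have nwe : ~ ((point_at (image_nsubset gi e) @^-1` (rho @^-1` eh_event H e)) `+`
        (point_at (image_nsubset gi e) @^-1` facet_event X (eh_event H e))) w.
      by move=> we; apply: nw; rewrite -bigcup_seq; exists e; rewrite //= mem_index_enum.
    rewrite -(read_facet_point X_exch).
    by split=> h; apply: contrapT => h'; apply: nwe; rewrite setY_def; [left|right].
  rewrite setY_def => -[[h nc]|[hc nh]].
    by apply: nc => _ /imfsetP[e /= _ ->]; apply/eqE; exact: h.
  by apply: nh => e; apply/eqE; apply: hc; apply/imfsetP; exists e.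
have Y_same : same_distribution X Y.
  by move=> H f g fi gi; rewrite [RHS]Y_law; exact: X_exch.
exists Y => //; split => // H f g fi gi.
(* The two injections in [same_distribution] are unrelated: both events of [Y] are compared with one
   event of [X]. *)
exact: etrans (esym (Y_same H f f fi fi)) (Y_same H f g fi gi).
Qed.
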